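(* Let $V_0$ and $V_1$ be real closed valuation rings and let $A = V_0 \times V_1$, with componentwise ring operations and componentwise (lattice) order. Let $\mathrm{T}_2 = \mathrm{Th}(A)$ be its complete first-order theory in the language $\mathcal{L}_{\mathrm{lor}} \cup \{\mid, \preceq, \mid_{\mathrm{loc}}\}$. Then $\mathrm{T}_2$ admits elimination of quantifiers in the language $\mathcal{L}_{\mathrm{lor}} \cup \{\mid, \preceq, \mid_{\mathrm{loc}}\}$.
   Context: All rings are commutative with unity. A real closed valuation ring is an ordered domain that satisfies the intermediate value property for polynomials in one variable but is not a field. $\mathcal{L}_{\mathrm{lor}} = \{0,1,+,-,\cdot,\wedge,\vee\}$ is the language of lattice-ordered rings (either lattice operation is quantifier-free definable from the other and the ring operations). The extra binary relation symbols are interpreted in a ring $R$ as follows: $x \mid y$ iff $\exists z\,(xz = y)$ (divisibility); $a \preceq b$ iff $\mathrm{Ann}(b) \subseteq \mathrm{Ann}(a)$, i.e. $\forall x\,(bx = 0 \to ax = 0)$ (the radical relation associated to the minimal prime spectrum); $y \mid_{\mathrm{loc}} w$ iff $w = 0$ or there exists $w'$ with $w' \neq 0$, $w'(w - w') = 0$ and $y \mid w'$ (local divisibility). *)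

(* Defs.v *)
From mathcomp Require Import all_boot all_order all_algebra.

Set Implicit Arguments.
Unset Strict Implicit.
Unset Printing Implicit Defensive.

Import Order.TTheory GRing.Theory Num.Theory.
Local Open Scope ring_scope.

(* [term n] and [formula n] have their free variables among the [n] variables
   indexed by 'I_n; a quantifier binds variable [ord0] of its body and shifts
   the other ones. *)

Inductive term (n : nat) : Type :=
| TVar of 'I_n
| TZero
| TOne
| TAdd of term n & term n
| TOpp of term n
| TMul of term n & term n
| TMeet of term n & term n
| TJoin of term n & term n.

(* The symbols |, ⪯ and |_loc. *)
Inductive relsym : Type := RDvd | RRad | RDvdLoc.

Inductive formula : nat -> Type :=
| FEq n : term n -> term n -> formula n
| FRel n : relsym -> term n -> term n -> formula n
| FNot n : formula n -> formula n
| FAnd n : formula n -> formula n -> formula n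
| FOr n : formula n -> formula n -> formula n
| FImp n : formula n -> formula n -> formula n
| FAll n : formula n.+1 -> formula n
| FEx n : formula n.+1 -> formula n.

Definition FIff n (f g : formula n) : formula n := FAnd (FImp f g) (FImp g f).

Definition sentence : Type := formula 0.

Fixpoint quantifier_free n (f : formula n) : bool :=
  match f with
  | FEq _ _ _ | FRel _ _ _ _ => true
  | FNot _ g => quantifier_free g
  | FAnd _ g h | FOr _ g h | FImp _ g h =>
      quantifier_free g && quantifier_free h
  | FAll _ _ | FEx _ _ => false
  end.

(* An arbitrary structure for the language: no axiom is imposed, and the three
   relation symbols may be interpreted in any way. *)
Record structure : Type := Structure {
  carrier :> Type;
  s_zero : carrier;
  s_one : carrier;
  s_add : carrier -> carrier -> carrier;
  s_opp : carrier -> carrier;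
  s_mul : carrier -> carrier -> carrier;
  s_meet : carrier -> carrier -> carrier;
  s_join : carrier -> carrier -> carrier;
  s_rel : relsym -> carrier -> carrier -> Prop
}.

Fixpoint eval (M : structure) n (e : 'I_n -> M) (t : term n) : M :=
  match t with
  | TVar i => e i
  | TZero => s_zero M
  | TOne => s_one M
  | TAdd u v => s_add (eval e u) (eval e v)
  | TOpp u => s_opp (eval e u)
  | TMul u v => s_mul (eval e u) (eval e v)
  | TMeet u v => s_meet (eval e u) (eval e v)
  | TJoin u v => s_join (eval e u) (eval e v)
  end.

Definition extend (T : Type) n (x : T) (e : 'I_n -> T) : 'I_n.+1 -> T :=
  fun i => if unlift ord0 i is Some j then e j else x.

Fixpoint holds (M : structure) n (f : formula n) : ('I_n -> M) -> Prop :=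
  match f in formula n return ('I_n -> M) -> Prop with
  | FEq _ t u => fun e => eval e t = eval e u
  | FRel _ r t u => fun e => s_rel r (eval e t) (eval e u)
  | FNot _ g => fun e => ~ holds g e
  | FAnd _ g h => fun e => holds g e /\ holds h e
  | FOr _ g h => fun e => holds g e \/ holds h e
  | FImp _ g h => fun e => holds g e -> holds h e
  | FAll _ g => fun e => forall x : M, holds g (extend x e)
  | FEx _ g => fun e => exists x : M, holds g (extend x e)
  end.

(* For [n = 0] there is exactly one assignment, up to extensionality. *)
Definition valid (M : structure) n (f : formula n) : Prop :=
  forall e : 'I_n -> M, holds f e.

Definition theory : Type := sentence -> Prop.

Definition Th (M : structure) : theory := fun s => valid M s.

Definition model (T : theory) (M : structure) : Prop :=
  forall s, T s -> valid M s.

Definition entails (T : theory) n (f : formula n) : Prop :=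
  forall M : structure, model T M -> valid M f.

Definition quantifier_elimination (T : theory) : Prop :=
  forall n (f : formula n),
    exists2 g : formula n, quantifier_free g & entails T (FIff f g).

Definition divides (R : comPzRingType) (x y : R) : Prop := exists z, x * z = y.

Definition radical_rel (R : comPzRingType) (a b : R) : Prop :=
  forall x, b * x = 0 -> a * x = 0.

Definition loc_divides (R : comPzRingType) (y w : R) : Prop :=
  w = 0 \/ exists w', [/\ w' <> 0, w' * (w - w') = 0 & divides y w'].

Definition lor_structure (R : comPzRingType) (meet join : R -> R -> R) :
    structure :=
  {| carrier := R;
     s_zero := 0;
     s_one := 1;
     s_add := fun x y => x + y;
     s_opp := fun x => - x;
     s_mul := fun x y => x * y;
     s_meet := meet;
     s_join := join;
     s_rel := fun r => match r with
                       | RDvd => @divides R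
                       | RRad => @radical_rel R
                       | RDvdLoc => @loc_divides R
                       end |}.

(* [V0 * V1] carries the componentwise ring operations; the componentwise
   order and its lattice operations live on the alias [V0 *p V1]. *)
Definition prod_structure (V0 V1 : realDomainType) : structure :=
  @lor_structure (V0 * V1)%type
    (fun x y => Order.meet (x : (V0 *p V1)%type) y)
    (fun x y => Order.join (x : (V0 *p V1)%type) y).

(* In [V : realDomainType], [GRing.unit] is exactly the set of invertible
   elements, so [GRing.field_axiom V] says that the ordered domain [V] is a
   field; [Num.real_closed_axiom V] is the intermediate value property for
   polynomials and does not presuppose a field. *)
Definition real_closed_valuation_ring (V : realDomainType) : Prop :=
  Num.real_closed_axiom V /\ ~ GRing.field_axiom V.

(* Main.v *)
(* The componentwise relation to control is divisibility in a real closed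
   valuation ring V. Its fraction field K is real closed and V is a convex
   subring of K, and a tuple of K is described by the signs of polynomials at the
   tuple and by the divisibilities [v(p) <= v(q)] between them. The core is a
   back-and-forth with finite data: for every finite list L of polynomials there
   is a finite list L' such that two tuples that agree on L' can be extended,
   a new element y on one side being answered by a y' on the other, so that they
   agree on L. Signs alone are handled by Tarski queries. If y is algebraic, two
   terms of its equation dominate, so that v(y) is a rational multiple of a
   difference of values of coefficients. Otherwise write y = r + h with r the
   root closest to y of the polynomials in L and their derivatives: each p(y) then
   has the same value as one monomial in h, and h lies between two consecutive
   algebraic elements, which determine its possible values.

   A tuple of V0 x V1 is then determined, up to exchanging the factors, by
   quantifier-free formulas. An element c that vanishes in exactly one factor
   gives access to each factor separately, through c * q | c * r and through the
   radical relation. If no such c is generated, both factors induce the same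
   order, their convex valuation rings are comparable, and | and |_loc are the
   divisibility relations of the two factors. *)
Require Import Defs.
From HB Require Import structures.
From mathcomp Require Import all_boot all_order all_algebra.
From mathcomp Require Import generic_quotient.
From mathcomp Require Import polyorder polyrcf qe_rcf_th.
From mathcomp Require Import ring lra.
From Stdlib Require Import Classical.

Set Implicit Arguments.
Unset Strict Implicit.
Unset Printing Implicit Defensive.

Import Order.TTheory GRing.Theory Num.Theory.
Local Open Scope ring_scope.

(** * Polynomial terms and data determined by signs *)

(** The elimination is semantic: no formula about valued fields is written down. A property of
    tuples that is invariant under agreement on finitely many quantifier-free formulas is a Boolean
    combination of them, so only invariance has to be shown, and only in the one structure at hand,
    whose theory is complete. Each quantifier costs one back-and-forth step, from a list [L] to a
    list [L']. The obstacle is uniformity: the two factors are different fields, and an exchange of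
    the factors compares tuples of one with tuples of the other. Every list and every numerical
    constant must therefore be chosen before the fields and the tuples, which explains the shape
    [exists L, forall K K' e e'] of the statements. Values are reached through inequalities: a
    convex subring contains the integers, so elements within an integer factor of each other have
    the same value, and such a bound is a sign condition. Signs thus transport every value that is
    comparable, up to a fixed integer, with a monomial in known elements; only elements in a gap
    between algebraic ones require a choice of value. *)

Inductive pterm : Type :=
| PVar of nat
| PNat of nat
| PAdd of pterm & pterm
| POpp of pterm
| PMul of pterm & pterm.

Lemma pterm_comparable : comparable pterm.
Proof. by move=> s t; rewrite /decidable; decide equality; exact: eq_comparable. Qed.

HB.instance Definition _ := comparableMixin pterm_comparable.

Fixpoint peval (R : nzRingType) (e : nat -> R) (t : pterm) : R :=
  match t with
  | PVar i => e i
  | PNat n => n%:R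
  | PAdd u v => peval e u + peval e v
  | POpp u => - peval e u
  | PMul u v => peval e u * peval e v
  end.

Lemma eq_peval (R : nzRingType) (e e' : nat -> R) t :
  e =1 e' -> peval e t = peval e' t.
Proof. by move=> ee; elim: t => //= [u -> v -> | u -> | u -> v ->]. Qed.

Definition scons (T : Type) (x : T) (e : nat -> T) (n : nat) : T :=
  if n is m.+1 then e m else x.

Definition ppoly (R : nzRingType) (e : nat -> R) (s : seq pterm) : {poly R} :=
  Poly (map (peval e) s).

Definition pcoef (s : seq pterm) (i : nat) : pterm := nth (PNat 0) s i.

Lemma coef_ppoly (R : nzRingType) (e : nat -> R) s i :
  (ppoly e s)`_i = peval e (pcoef s i).
Proof.
rewrite coef_Poly /pcoef; have [ltis|leis] := ltnP i (size s).
  by rewrite (nth_map (PNat 0)).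
by rewrite !nth_default ?size_map.
Qed.

Lemma size_ppoly (R : nzRingType) (e : nat -> R) s : (size (ppoly e s) <= size s)%N.
Proof. by rewrite (leq_trans (size_Poly _)) ?size_map. Qed.

Lemma ppoly_take (R : nzRingType) (e : nat -> R) s n :
  (size (ppoly e s) <= n)%N -> ppoly e (take n s) = ppoly e s.
Proof.
move=> szn; apply/polyP => i; rewrite !coef_ppoly /pcoef.
have [ltin|lein] := ltnP i n; first by rewrite nth_take.
rewrite [in LHS]nth_default; last first.
  by rewrite size_take_min (leq_trans _ lein) ?geq_minl.
by rewrite -[RHS]coef_ppoly nth_default ?(leq_trans szn).
Qed.

(** The coefficient list is chosen before the field and the assignment: [P] is one polynomial over
    the terms, specialized everywhere. *)
Definition formal (P : forall K : rcfType, (nat -> K) -> {poly K}) : Prop :=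
  exists s, forall (K : rcfType) (e : nat -> K), P K e = ppoly e s.

Lemma formal_ppoly s : formal (fun K e => ppoly e s).
Proof. by exists s. Qed.

Lemma formal_coefs (P : forall K : rcfType, (nat -> K) -> {poly K}) (n : nat)
    (c : nat -> pterm) :
  (forall K e, size (P K e) <= n)%N ->
  (forall K e i, (i < n)%N -> (P K e)`_i = peval e (c i)) ->
  formal P.
Proof.
move=> szP Pc; exists (mkseq c n) => K e; apply/polyP => i.
rewrite coef_ppoly /pcoef; have [ltin|lein] := ltnP i n.
  by rewrite nth_mkseq // Pc.
by rewrite !nth_default ?size_mkseq // (leq_trans (szP K e)).
Qed.

Lemma formalC t : formal (fun K e => (peval e t)%:P).
Proof.
apply: (@formal_coefs _ 1 (fun=> t)) => K e; first exact: size_polyC_leq1.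
by move=> i; rewrite ltnS leqn0 coefC => ->.
Qed.

Lemma formalX : formal (fun K e => 'X).
Proof.
apply: (@formal_coefs _ 2 (fun i => PNat (i == 1%N))) => K e.
  by rewrite size_polyX.
by move=> i _; rewrite coefX.
Qed.

Lemma formalD P Q : formal P -> formal Q -> formal (fun K e => P K e + Q K e).
Proof.
move=> [s sP] [t tQ].
apply: (@formal_coefs _ (maxn (size s) (size t))
          (fun i => PAdd (pcoef s i) (pcoef t i))) => K e; rewrite sP tQ.
  rewrite (leq_trans (size_polyD _ _)) // geq_max !leq_max.
  by rewrite !size_ppoly ?orbT.
by move=> i _; rewrite coefD !coef_ppoly.
Qed.

Definition psum (c : nat -> pterm) (n : nat) : pterm :=
  iteri n (fun i => PAdd (c i)) (PNat 0).

Lemma peval_psum (R : nzRingType) (e : nat -> R) c n :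
  peval e (psum c n) = \sum_(i < n) peval e (c i).
Proof.
elim: n => [|n IHn]; first by rewrite big_ord0.
by rewrite big_ord_recr /= IHn addrC.
Qed.

Lemma formalM P Q : formal P -> formal Q -> formal (fun K e => P K e * Q K e).
Proof.
move=> [s sP] [t tQ].
apply: (@formal_coefs _ (size s + size t)
          (fun i => psum (fun j => PMul (pcoef s j) (pcoef t (i - j))) i.+1)) =>
  K e; rewrite sP tQ.
  rewrite (leq_trans (size_polyMleq _ _)) // (leq_trans (leq_pred _)) //.
  by rewrite leq_add ?size_ppoly.
by move=> i _; rewrite coefM peval_psum; apply: eq_bigr => j _; rewrite /= !coef_ppoly.
Qed.

Lemma formalN P : formal P -> formal (fun K e => - P K e).
Proof.
move=> [s sP]; apply: (@formal_coefs _ (size s) (fun i => POpp (pcoef s i))) =>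
  K e; rewrite sP ?size_polyN ?size_ppoly //.
by move=> i _; rewrite coefN coef_ppoly.
Qed.

Lemma formalXn P n : formal P -> formal (fun K e => P K e ^+ n).
Proof.
move=> fP; elim: n => [|n IHn].
  have [s sP] := formalC (PNat 1).
  by exists s => K e; rewrite -sP expr0.
by have [s sP] := formalM fP IHn; exists s => K e; rewrite exprS sP.
Qed.

Lemma formal_deriv P : formal P -> formal (fun K e => (P K e)^`()).
Proof.
move=> [s sP]; apply: (@formal_coefs _ (size s)
  (fun i => PMul (PNat i.+1) (pcoef s i.+1))) => K e; rewrite sP.
  by rewrite (leq_trans (size_poly _ _)) ?(leq_trans (leq_pred _)) ?size_ppoly.
by move=> i _; rewrite coef_deriv coef_ppoly -mulr_natl.
Qed.

Lemma formal_prod (T : eqType) (l : seq T) (P : T -> forall K : rcfType, (nat -> K) -> {poly K}) :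
  {in l, forall i, formal (P i)} -> formal (fun K e => \prod_(i <- l) P i K e).
Proof.
elim: l => [_|x l IHl Pl].
  by have [s sP] := formalC (PNat 1); exists s => K e; rewrite big_nil -sP.
have [s sP] : formal (fun K e => P x K e * \prod_(i <- l) P i K e).
  apply: formalM; first by apply: Pl; rewrite mem_head.
  by apply: IHl => i li; apply: Pl; rewrite in_cons li orbT.
by exists s => K e; rewrite big_cons sP.
Qed.

(** * Agreement of signs and quantities decided by it *)

Definition sign_agree (L : seq pterm) (K K' : rcfType)
    (e : nat -> K) (e' : nat -> K') : Prop :=
  {in L, forall t, sgz (peval e t) = sgz (peval e' t)}.

Lemma sign_agree_sub L M (K K' : rcfType) (e : nat -> K) (e' : nat -> K') :
  {subset L <= M} -> sign_agree M e e' -> sign_agree L e e'.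
Proof. by move=> LM agM t /LM /agM. Qed.

Lemma sign_agree_cat L M (K K' : rcfType) (e : nat -> K) (e' : nat -> K') :
  sign_agree (L ++ M) e e' -> sign_agree L e e' /\ sign_agree M e e'.
Proof.
by move=> ag; split; apply: sign_agree_sub ag => t; rewrite mem_cat => ->;
  rewrite ?orbT.
Qed.

Lemma sign_agree_sym L (K K' : rcfType) (e : nat -> K) (e' : nat -> K') :
  sign_agree L e e' -> sign_agree L e' e.
Proof. by move=> ag t /ag. Qed.

(** Semantic substitute for a quantifier-free case distinction: finitely many signs, the same for
    all fields, decide the value. *)
Definition sign_determined (X : Type) (f : forall K : rcfType, (nat -> K) -> X) : Prop :=
  exists L, forall (K K' : rcfType) (e : nat -> K) (e' : nat -> K'),
    sign_agree L e e' -> f K e = f K' e'.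

(** Finite choice for witnesses that may be enlarged on either side: concatenating the lists of all
    [x] serves every [x]. *)
Lemma seq_finite_choice (T : eqType) (U : Type) (l : seq T) (P : T -> seq U -> Prop) :
  (forall x s s', P x s -> P x (s ++ s')) -> (forall x s s', P x s' -> P x (s ++ s')) ->
  {in l, forall x, exists s, P x s} -> exists s, {in l, forall x, P x s}.
Proof.
move=> Pl Pr; elim: l => [|x l IHl] ex; first by exists [::].
have [s Ps] := ex x (mem_head _ _).
have [|s' Ps'] := IHl; first by move=> y ly; apply: ex; rewrite in_cons ly orbT.
exists (s ++ s') => y; rewrite in_cons => /predU1P[->|/Ps']; first exact: Pl.
exact: Pr.
Qed.

Lemma sign_determined_in (T : eqType) (l : seq T) (X : Type)
    (f : T -> forall K : rcfType, (nat -> K) -> X) :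
  {in l, forall x, sign_determined (f x)} ->
  exists L, {in l, forall x (K K' : rcfType) (e : nat -> K) (e' : nat -> K'),
    sign_agree L e e' -> f x K e = f x K' e'}.
Proof.
by apply: seq_finite_choice => x s s' fx K K' e e' /sign_agree_cat[] ? ?; apply: fx.
Qed.

Lemma sign_determined_cst (X : Type) (x : X) : sign_determined (fun K e => x).
Proof. by exists [::]. Qed.

Lemma sign_determined_comp2 (X Y Z : Type) (h : X -> Y -> Z) f g :
  sign_determined f -> sign_determined g ->
  sign_determined (fun K e => h (f K e) (g K e)).
Proof.
move=> [L fL] [M gM]; exists (L ++ M) => K K' e e' /sign_agree_cat[agL agM].
by rewrite (fL _ _ _ _ agL) (gM _ _ _ _ agM).
Qed.

Lemma sign_determined_comp (X Y : Type) (h : X -> Y) f :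
  sign_determined f -> sign_determined (fun K e => h (f K e)).
Proof. by move=> [L fL]; exists L => K K' e e' /fL ->. Qed.

Lemma eq_sign_determined (X : Type) (f g : forall K : rcfType, (nat -> K) -> X) :
  (forall K e, f K e = g K e) -> sign_determined g -> sign_determined f.
Proof. by move=> fg [L gL]; exists L => K K' e e' /gL; rewrite !fg. Qed.

Lemma sign_determined_size P : formal P -> sign_determined (fun K e => size (P K e)).
Proof.
move=> [s sP]; exists s => K K' e e'; rewrite !sP {sP}.
elim: s => [|t s IHs] ag; first by rewrite !size_poly0.
rewrite /ppoly /= !size_cons_poly -!/(ppoly _ _) !nil_poly -!size_poly_eq0 IHs.
  rewrite -[peval e t == 0]sgz_eq0 -[peval e' t == 0]sgz_eq0.
  by rewrite ag ?mem_head.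
by apply: sign_agree_sub ag => u su; rewrite in_cons su orbT.
Qed.

Lemma sign_determined_sgz t : sign_determined (fun K e => sgz (peval e t)).
Proof. by exists [:: t] => K K' e e'; apply; rewrite mem_head. Qed.

(** Case distinction on a bounded index, by concatenating the lists of all cases. Mostly [m] is the
    size of a polynomial: once it is fixed, the leading coefficient is a fixed term. *)
Lemma sign_determined_nat (X : Type) (n : nat)
    (m : forall K : rcfType, (nat -> K) -> nat)
    (f : nat -> forall K : rcfType, (nat -> K) -> X) :
  (forall K e, m K e < n)%N -> sign_determined m ->
  (forall i, sign_determined (f i)) -> sign_determined (fun K e => f (m K e) K e).
Proof.
move=> mn [L mL] df.
have [M fM] : exists M, {in iota 0 n, forall i (K K' : rcfType) (e : nat -> K) (e' : nat -> K'),
    sign_agree M e e' -> f i K e = f i K' e'}.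
  by apply: sign_determined_in => i _; apply: df.
exists (L ++ M) => K K' e e' /sign_agree_cat[agL agM].
by rewrite (mL _ _ _ _ agL); apply: fM; rewrite ?mem_iota ?add0n ?mn.
Qed.

Lemma sign_determined_lead P : formal P -> sign_determined (fun K e => sgz (lead_coef (P K e))).
Proof.
move=> [s sP]; pose f i (K : rcfType) (e : nat -> K) := sgz (peval e (pcoef s i.-1)).
apply: (@eq_sign_determined _ _ (fun K e => f (size (P K e)) K e)) => [K e|].
  by rewrite /f lead_coefE sP coef_ppoly.
apply: (@sign_determined_nat _ (size s).+1).
- by move=> K e; rewrite sP ltnS size_ppoly.
- by apply: sign_determined_size; exists s.
- by move=> i; apply: sign_determined_sgz.
Qed.

(* Values of the form (x, p) that range over finitely many pairs of a constant
   and a formal polynomial, the choice being made by the signs of terms. *)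
Definition piecewise (X : eqType)
    (f : forall K : rcfType, (nat -> K) -> X * {poly K}) : Prop :=
  exists L (l : seq (X * seq pterm)),
    forall (K K' : rcfType) (e : nat -> K) (e' : nat -> K'), sign_agree L e e' ->
    exists2 d, d \in l & f K e = (d.1, ppoly e d.2) /\ f K' e' = (d.1, ppoly e' d.2).

Lemma piecewise_formal (X : eqType) (x : X) P :
  formal P -> piecewise (fun K e => (x, P K e)).
Proof.
move=> [s sP]; exists [::], [:: (x, s)] => K K' e e' _.
by exists (x, s); rewrite ?mem_head // !sP.
Qed.

Lemma eq_piecewise (X : eqType) (f g : forall K : rcfType, (nat -> K) -> X * {poly K}) :
  (forall K e, f K e = g K e) -> piecewise g -> piecewise f.
Proof. by move=> fg [L [l gL]]; exists L, l => K K' e e' /gL; rewrite !fg. Qed.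

Lemma piecewise_bind (X Y : eqType) f
    (g : forall K : rcfType, (nat -> K) -> X * {poly K} -> Y * {poly K}) :
  piecewise f -> (forall x s, piecewise (fun K e => g K e (x, ppoly e s))) ->
  piecewise (fun K e => g K e (f K e)).
Proof.
move=> [L [l fL]] pg.
suff [M [m gM]] : exists M (m : seq (Y * seq pterm)), {in l,
  forall d (K K' : rcfType) (e : nat -> K) (e' : nat -> K'),
    sign_agree M e e' -> exists2 c, c \in m &
    g K e (d.1, ppoly e d.2) = (c.1, ppoly e c.2) /\
    g K' e' (d.1, ppoly e' d.2) = (c.1, ppoly e' c.2)}.
  exists (L ++ M), m => K K' e e' /sign_agree_cat[/fL[d ld [-> ->]] agM].
  exact: (gM d ld _ _ _ _ agM).
elim: l {fL} => [|[x s] l [M [m IH]]]; first by exists [::], [::].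
have [M' [m' gM']] := pg x s.
exists (M ++ M'), (m ++ m') => d.
rewrite in_cons => /predU1P[->|ld] K K' e e' /sign_agree_cat[agM agM'].
  by have [c mc gc] := gM' _ _ _ _ agM'; exists c; rewrite // mem_cat mc orbT.
by have [c mc gc] := IH d ld _ _ _ _ agM; exists c; rewrite // mem_cat mc.
Qed.

Lemma piecewise_nat (X : eqType) (n : nat)
    (m : forall K : rcfType, (nat -> K) -> nat)
    (f : nat -> forall K : rcfType, (nat -> K) -> X * {poly K}) :
  (forall K e, m K e < n)%N -> sign_determined m ->
  (forall i, piecewise (f i)) -> piecewise (fun K e => f (m K e) K e).
Proof.
move=> mn [L mL] pf.
pose f0 (K : rcfType) (e : nat -> K) := (m K e, 0 : {poly K}).
have pf0 : piecewise f0.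
  exists L, [seq (i, [::]) | i <- iota 0 n] => K K' e e' agL.
  exists (m K e, [::]).
    by apply/mapP; exists (m K e); rewrite ?mem_iota ?add0n ?mn.
  by rewrite /f0 (mL _ _ _ _ agL).
by have := piecewise_bind (g := fun K e d => f d.1 K e) pf0 (fun i _ => pf i).
Qed.

Lemma piecewise_if (X : eqType) (b : forall K : rcfType, (nat -> K) -> bool)
    (f g : forall K : rcfType, (nat -> K) -> X * {poly K}) :
  sign_determined b -> piecewise f -> piecewise g ->
  piecewise (fun K e => if b K e then f K e else g K e).
Proof.
move=> db pf pg; pose h (i : nat) := if i == 1%N then f else g.
apply: (@eq_piecewise _ _ (fun K e => h (b K e) K e)) => [K e|].
  by rewrite /h; case: (b K e).
apply: (@piecewise_nat _ 2); first by move=> K e; case: (b K e).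
  exact: (sign_determined_comp nat_of_bool).
by move=> i; rewrite /h; case: ifP.
Qed.

(** * Tarski queries are determined by signs *)

Import Pdiv.Ring.

(** Once the sizes of the divisor and of the current remainder are fixed, one step of
    pseudo-division is formal. Only the exponent and the remainder are tracked, so the accumulated
    quotient [Q] is arbitrary. *)
Lemma piecewise_redivp_rec P (F Q : forall K : rcfType, (nat -> K) -> {poly K}) n k :
  formal P -> formal F ->
  piecewise (fun K e =>
    let d := redivp_rec (P K e) k (Q K e) (F K e) n in (d.1.1, d.2)).
Proof.
move=> [sP PE]; elim: n k F Q => [|n IHn] k F Q [sF FE];
  set h := (X in piecewise X).
(* The next remainder when the divisor has size [i] and the current remainder size [j]: both leading
   coefficients are then fixed terms. *)
all: pose R1 i j (K : rcfType) (e : nat -> K) :=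
    F K e * (peval e (pcoef sP i.-1))%:P
    - (peval e (pcoef sF j.-1))%:P * 'X^(j - i) * P K e.
all: have fR1 i j : formal (R1 i j) by
  apply: formalD; [apply: formalM (formalC _); exists sF
  | apply: formalN; apply: formalM; [|by exists sP];
    apply: formalM (formalC _) (formalXn _ formalX)].
all: pose Q1 i j (K : rcfType) (e : nat -> K) :=
    Q K e * (peval e (pcoef sP i.-1))%:P + (peval e (pcoef sF j.-1))%:P * 'X^(j - i).
- pose g i j (K : rcfType) (e : nat -> K) :=
    if (j < i)%N then (k, F K e) else (k.+1, R1 i j K e).
  pose g' i (K : rcfType) (e : nat -> K) := g i (size (F K e)) K e.
  apply: (@eq_piecewise _ _ (fun K e => g' (size (P K e)) K e)) => [K e|].
    rewrite /h /g' /g /R1 /=; case: ifP => //= _.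
    by rewrite -!(coef_ppoly e) -PE -FE -!lead_coefE mul_polyC.
  apply: (@piecewise_nat _ (size sP).+1) => [K e||i].
  + by rewrite PE ltnS size_ppoly.
  + by apply: sign_determined_size; exists sP.
  apply: (@piecewise_nat _ (size sF).+1) => [K e||j].
  + by rewrite FE ltnS size_ppoly.
  + by apply: sign_determined_size; exists sF.
  rewrite /g; case: (j < i)%N; apply: piecewise_formal => //.
  by exists sF.
- pose g i j (K : rcfType) (e : nat -> K) :=
    if (j < i)%N then (k, F K e) else
    let d := redivp_rec (P K e) k.+1 (Q1 i j K e) (R1 i j K e) n in (d.1.1, d.2).
  pose g' i (K : rcfType) (e : nat -> K) := g i (size (F K e)) K e.
  apply: (@eq_piecewise _ _ (fun K e => g' (size (P K e)) K e)) => [K e|].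
    rewrite /h /g' /g /R1 /Q1 /=; case: ifP => //= _.
    by rewrite -!(coef_ppoly e) -PE -FE -!lead_coefE mul_polyC.
  apply: (@piecewise_nat _ (size sP).+1) => [K e||i].
  + by rewrite PE ltnS size_ppoly.
  + by apply: sign_determined_size; exists sP.
  apply: (@piecewise_nat _ (size sF).+1) => [K e||j].
  + by rewrite FE ltnS size_ppoly.
  + by apply: sign_determined_size; exists sF.
  rewrite /g; case: (j < i)%N; first by apply: piecewise_formal; exists sF.
  exact: IHn.
Qed.

Lemma sign_determined_eq0 P : formal P -> sign_determined (fun K e => P K e == 0).
Proof.
move=> fP; apply: (@eq_sign_determined _ _ (fun K e => size (P K e) == 0%N)) => [K e|].
  by rewrite size_poly_eq0.
exact: (sign_determined_comp (fun n => n == 0%N)) (sign_determined_size fP).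
Qed.

Lemma piecewise_rmodp P F : formal P -> formal F ->
  piecewise (fun K e => (rscalp (F K e) (P K e), rmodp (F K e) (P K e))).
Proof.
move=> fP fF; pose g n (K : rcfType) (e : nat -> K) :=
  if P K e == 0 then (0%N, F K e) else
  let d := redivp_rec (P K e) 0 0 (F K e) n in (d.1.1, d.2).
apply: (@eq_piecewise _ _ (fun K e => g (size (F K e)) K e)) => [K e|].
  by rewrite /g /rscalp /rmodp unlock; case: ifP.
have [s FE] := fF.
apply: (@piecewise_nat _ (size s).+1) => [K e||n].
- by rewrite FE ltnS size_ppoly.
- exact: sign_determined_size.
apply: piecewise_if; first exact: sign_determined_eq0.
  exact: piecewise_formal.
exact: (@piecewise_redivp_rec P F (fun K e => 0)).
Qed.

Lemma piecewise_next_mod P F : formal P -> formal F ->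
  piecewise (fun K e => (tt, next_mod (F K e) (P K e))).
Proof.
move=> fP fF; have [s PE] := fP.
pose g (n : nat) (K : rcfType) (e : nat -> K) (d : nat * {poly K}) :=
  (tt, (- (peval e (pcoef s n.-1)) ^+ d.1)%:P * d.2).
pose f n (K : rcfType) (e : nat -> K) := g n K e (rscalp (F K e) (P K e), rmodp (F K e) (P K e)).
apply: (@eq_piecewise _ _ (fun K e => f (size (P K e)) K e)) => [K e|].
  by rewrite /f /g /next_mod mul_polyC -(coef_ppoly e) -PE -lead_coefE.
apply: (@piecewise_nat _ (size s).+1) => [K e||n].
- by rewrite PE ltnS size_ppoly.
- exact: sign_determined_size.
apply: piecewise_bind (piecewise_rmodp fP fF) _ => k r.
apply: piecewise_formal; apply: formalM (formal_ppoly r).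
have [u uE] := formalN (formalXn k (formalC (pcoef s n.-1))).
by exists u => K e; rewrite -uE polyCN polyC_exp.
Qed.

(** Cutting the coefficient lists at a known bound on the size makes their length usable as an
    induction measure. *)
Lemma piecewise_size (X : eqType) (f : forall K : rcfType, (nat -> K) -> X * {poly K}) n :
  (forall (K : rcfType) (e : nat -> K), size (f K e).2 <= n)%N ->
  piecewise f -> exists L (l : seq (X * seq pterm)),
    {in l, forall d, size d.2 <= n}%N /\
    forall (K K' : rcfType) (e : nat -> K) (e' : nat -> K'), sign_agree L e e' ->
    exists2 d, d \in l & f K e = (d.1, ppoly e d.2) /\ f K' e' = (d.1, ppoly e' d.2).
Proof.
move=> fn [L [l fL]]; exists L, [seq (d.1, take n d.2) | d <- l]; split.
  by move=> _ /mapP[d _ ->]; rewrite /= size_take_min geq_minl.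
move=> K K' e e' /fL[d ld [fd fd']]; exists (d.1, take n d.2); first exact: map_f.
have := fn K e; have := fn K' e'; rewrite fd fd' /= => sz' sz.
by rewrite !ppoly_take.
Qed.

(** Induction on the length of the coefficient list of [P]: the next remainder ranges over finitely
    many formal pieces, each with a shorter list. *)
Lemma sign_determined_mods P F : formal P -> formal F ->
  sign_determined (fun K e =>
    [seq (sgz (lead_coef r), size r) | r <- mods (F K e) (P K e)]).
Proof.
move=> [s PE] fF.
have [n] := ubnP (size s); elim: n => // n IHn in s P F PE fF *; rewrite ltnS => sn.
have fP : formal P by exists s.
pose out (K : rcfType) (r : {poly K}) := (sgz (lead_coef r), size r).
have dout G : formal G -> sign_determined (fun K e => out K (G K e)).
  move=> fG; exact: sign_determined_comp2 (sign_determined_lead fG) (sign_determined_size fG).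
(* Division by 0 leaves [F] as remainder, whose size is not bounded by that of [P]; the default 0
   keeps the bound. *)
pose N (K : rcfType) (e : nat -> K) :=
  if P K e == 0 then (tt, 0) else (tt, next_mod (F K e) (P K e)).
have pwN : piecewise N.
  apply: piecewise_if; first exact: sign_determined_eq0.
    by apply: piecewise_formal; exists [::].
  exact: piecewise_next_mod.
have szN (K : rcfType) (e : nat -> K) : (size (N K e).2 <= (size s).-1)%N.
  rewrite /N; case: eqVneq => [_|P0]; rewrite /= ?size_poly0 //.
  rewrite /next_mod (leq_trans (size_scale_leq _ _)) //.
  have := ltn_rmodp (F K e) (P K e); rewrite P0.
  have : (size (P K e) <= size s)%N by rewrite PE size_ppoly.
  by case: (size s) => [|m] le lt; have := leq_trans lt le; rewrite ?ltn0 ?ltnS.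
have [L [l [szl NL]]] := piecewise_size szN pwN.
pose rest (K : rcfType) (e : nat -> K) :=
  if P K e == 0 then [::] else [seq out K r | r <- mods (P K e) (N K e).2].
have drest : sign_determined rest.
  case: (posnP (size s)) => [s0|s_gt0].
    exists [::] => K K' e e' _; rewrite /rest !PE (size0nil s0).
    by rewrite !eqxx.
  have [M MP] : exists M, {in l, forall d (K K' : rcfType) (e : nat -> K) (e' : nat -> K'),
      sign_agree M e e' -> [seq out K r | r <- mods (P K e) (ppoly e d.2)]
        = [seq out K' r | r <- mods (P K' e') (ppoly e' d.2)]}.
    apply: sign_determined_in => d ld; apply: (IHn d.2) => //.
    by rewrite (leq_ltn_trans (szl d ld)) // -ltnS prednK.
  have [M0 P0] := sign_determined_eq0 fP.
  exists (M0 ++ L ++ M) => K K' e e' /sign_agree_cat[ag0 /sign_agree_cat[agL agM]].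
  have [d ld [Nd Nd']] := NL _ _ _ _ agL.
  rewrite /rest (P0 _ _ _ _ ag0) Nd Nd' /=.
  by rewrite (MP d ld _ _ _ _ agM).
pose out2 b (a : int * nat) r : seq (int * nat) := if b then [::] else a :: r.
have [M ME] := dout _ fF; have [M' ME'] := drest; have [M0 E0] := sign_determined_eq0 fF.
exists (M ++ M' ++ M0) => K K' e e' /sign_agree_cat[/ME a1 /sign_agree_cat[/ME' a2 /E0 a3]].
suff E (K1 : rcfType) (e1 : nat -> K1) : [seq out K1 r | r <- mods (F K1 e1) (P K1 e1)]
    = out2 (F K1 e1 == 0) (out K1 (F K1 e1)) (rest K1 e1).
  by rewrite !E a1 a2 a3.
rewrite mods_rec /out2; case: ifP => //= F0; congr (_ :: _); rewrite /rest /N.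
by have [->|_] := eqVneq (P K1 e1) 0; rewrite ?mods0p.
Qed.

Lemma eq_changes (K K' : rcfType) (s : seq K) (s' : seq K') :
  map (@sgz K) s = map (@sgz K') s' -> changes s = changes s'.
Proof.
elim: s s' => [|a s IHs] [|a' s'] //= [saa' ss']; congr (_ + _)%N; last exact: IHs.
rewrite -sgz_lt0 -[in RHS]sgz_lt0 !sgzM saa'.
case: s s' ss' {IHs} => [|b s] [|b' s'] //=; first by rewrite !sgz0.
by case=> [-> _].
Qed.

(** A Tarski query is the difference of the numbers of sign changes of a signed remainder sequence
    at the two infinities, where a sign depends only on the leading coefficient and the parity of
    the degree. *)
Lemma sign_determined_taqR P F : formal P -> formal F ->
  sign_determined (fun K e => taqR (P K e) (F K e)).
Proof.
move=> fP fF.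
have [L LE] := sign_determined_mods (formalM (formal_deriv fP) fF) fP.
exists L => K K' e e' /LE; rewrite /taqR /changes_mods /changes_poly.
move: (mods _ _) (mods _ _) => s s' ss'; congr (_%:Z - _%:Z); apply: eq_changes.
  elim: s s' ss' => [|a s IHs] [|a' s'] //= [sa na /IHs->]; congr (_ :: _).
  by rewrite !sgzM na sa; case: (odd _); rewrite /= ?expr1 ?expr0 ?sgzN ?sgz1.
by elim: s s' ss' => [|a s IHs] [|a' s'] //= [sa na /IHs->]; rewrite sa.
Qed.

(** * Back-and-forth for signs *)

(** For [r = 1] this is the number of roots of [p] that meet the sign constraints; the weight by [r]
    allows constraints to be removed one at a time by multiplying [r]. *)
Definition root_count (K : rcfType) (p r : {poly K}) (l : seq ({poly K} * int)) : int :=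
  \sum_(x <- rootsR p) sgz r.[x] * \prod_(q <- l) (sgz q.1.[x] == q.2)%:R.

Definition eval_constraints (K : rcfType) (e : nat -> K) (l : seq (seq pterm * int)) :=
  [seq (ppoly e q.1, q.2) | q <- l].

(* The indicators of s = 1, s = -1 and s = 0 are (s^2 + s)/2, (s^2 - s)/2 and
   1 - s^2 for s in {-1, 0, 1}: the count is a combination of Tarski queries. *)
Lemma sign_determined_root_count P R (l : seq (seq pterm * int)) :
  formal P -> formal R -> all (fun q => q.2 \in [:: 1; -1; 0]) l ->
  sign_determined (fun K e => root_count (P K e) (R K e) (eval_constraints e l)).
Proof.
move=> fP; elim: l R => [|[q s] l IHl] R fR => [_|/= /andP[s3 l3]].
  apply: eq_sign_determined (sign_determined_taqR fP fR) => K e.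
  by rewrite -taq_taqR /root_count /taq; apply: eq_bigr => x _; rewrite big_nil mulr1.
pose C0 (K : rcfType) (e : nat -> K) :=
  root_count (P K e) (R K e) (eval_constraints e l).
pose C1 (K : rcfType) (e : nat -> K) :=
  root_count (P K e) (R K e * ppoly e q) (eval_constraints e l).
pose C2 (K : rcfType) (e : nat -> K) :=
  root_count (P K e) (R K e * ppoly e q * ppoly e q) (eval_constraints e l).
pose h (c : int * int * int) : int := if s == 1 then c.1.2 + c.2 else if s == -1 then c.2 - c.1.2
  else 2 * c.1.1 - 2 * c.2.
apply: (@eq_sign_determined _ _ (fun K e => (h (C0 K e, C1 K e, C2 K e) %/ 2)%Z)) => [K e|].
  set c := root_count _ _ _; suff <- : 2 * c = h (C0 K e, C1 K e, C2 K e) by rewrite mulKz.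
  rewrite /h /=; move: s3; rewrite !inE => /or3P[] /eqP s0; move: @c; rewrite {}s0 /=.
  - rewrite /C1 /C2 /root_count mulr_sumr -big_split /=; apply: eq_bigr => x _.
    rewrite big_cons /= !hornerM !sgzM; set pr := \prod_(i <- _) _.
    by case: (sgzP (ppoly e q).[x]) => _ /=; ring.
  - rewrite /C1 /C2 /root_count mulr_sumr -sumrB /=; apply: eq_bigr => x _.
    rewrite big_cons /= !hornerM !sgzM; set pr := \prod_(i <- _) _.
    by case: (sgzP (ppoly e q).[x]) => _ /=; ring.
  - rewrite /C0 /C2 /root_count !mulr_sumr -sumrB /=; apply: eq_bigr => x _.
    rewrite big_cons /= !hornerM !sgzM; set pr := \prod_(i <- _) _.
    by case: (sgzP (ppoly e q).[x]) => _ /=; ring.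
apply: (sign_determined_comp (fun c => (h c %/ 2)%Z)).
have fq := formal_ppoly q.
apply: (sign_determined_comp2 pair); first apply: (sign_determined_comp2 pair).
- exact: IHl.
- by apply: IHl => //; apply: formalM.
- by apply: IHl => //; do 2?apply: formalM.
Qed.

Fixpoint sign_vectors (n : nat) : seq (seq int) :=
  if n is m.+1 then [seq s :: v | s <- [:: 1; -1; 0], v <- sign_vectors m] else [:: [::]].

Lemma mem_sgz (R : realDomainType) (x : R) : sgz x \in [:: 1; -1; 0 : int].
Proof. by case: sgzP. Qed.

Lemma sign_vectorsP (T : eqType) (l : seq T) (f : T -> int) :
  (forall x, f x \in [:: 1; -1; 0 : int]) -> [seq f x | x <- l] \in sign_vectors (size l).
Proof.
move=> f3; elim: l => [|x l IHl]; first by rewrite mem_head.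
exact: (@allpairs_f _ _ _ (fun s v => s :: v)).
Qed.

Lemma sign_vectors_zip (T : Type) (l : seq T) n v : v \in sign_vectors n ->
  all (fun q => q.2 \in [:: 1; -1; 0 : int]) (zip l v).
Proof.
elim: n v l => [|n IHn] v l; first by rewrite /= inE => /eqP->; case: l.
move=> /allpairsP[[s w] /= [s3 wn ->]]; case: l => //= x l.
by rewrite s3 /=; apply: IHn.
Qed.

(** The number of roots with the sign vector of [y] is determined by signs. It is positive on one
    side, where [y] is counted, hence on the other. *)
Lemma sign_back_forth_root P (l : seq (seq pterm)) : formal P ->
  exists L, forall (K K' : rcfType) (e : nat -> K) (e' : nat -> K'),
    sign_agree L e e' -> forall y, P K e != 0 -> root (P K e) y ->
    exists2 y', root (P K' e') y' &
      {in l, forall s, sgz (ppoly e s).[y] = sgz (ppoly e' s).[y']}.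
Proof.
move=> fP; pose count v (K : rcfType) (e : nat -> K) :=
  root_count (P K e) 1 (eval_constraints e (zip l v)).
have [L LE] : exists L, {in sign_vectors (size l), forall v (K K' : rcfType) (e : nat ->
  K) (e' : nat -> K'),
    sign_agree L e e' -> count v K e = count v K' e'}.
  apply: sign_determined_in => v vl; apply: (@sign_determined_root_count P _) => //.
    by have [s sE] := formalC (PNat 1); exists s => K e; rewrite -sE.
  exact: sign_vectors_zip vl.
have [M ME] := sign_determined_eq0 fP.
exists (L ++ M) => K K' e e' /sign_agree_cat[agL /ME PP'] y P0 Py.
have P0' : P K' e' != 0 by rewrite -PP'.
pose v := [seq sgz (ppoly e s).[y] | s <- l].
have vl : v \in sign_vectors (size l) by apply: sign_vectorsP => s; apply: mem_sgz.
have cE (K1 : rcfType) (e1 : nat -> K1) : count v K1 e1 =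
    \sum_(x <- rootsR (P K1 e1)) (all (fun s => sgz (ppoly e1 s).[x] == sgz (ppoly e s).[y]) l)%:R.
  apply: eq_bigr => x _; rewrite hornerC sgz1 mul1r /eval_constraints big_map /v.
  elim: (l) => [|s l' IHl]; first by rewrite big_nil.
  by rewrite /= big_cons IHl /= -mulnb natrM.
have : count v K e > 0.
  rewrite cE (big_rem y) /=; last by rewrite -roots_on_rootsR.
  rewrite (introT allP) => [|s _]; last by rewrite /= eqxx.
  by rewrite ltr_pwDl ?sumr_ge0 // => x _; rewrite ler0n.
rewrite (LE v vl _ _ _ _ agL) cE.
have [/hasP[x xr /allP xl] _|nx] := boolP (has (fun x =>
    all (fun s => sgz (ppoly e' s).[x] == sgz (ppoly e s).[y]) l) (rootsR (P K' e'))).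
  exists x; first by rewrite -(roots_on_rootsR P0') in xr.
  by move=> s /xl/eqP.
rewrite big_seq big1 ?ltxx // => x xr.
by move: nx; rewrite -all_predC => /allP/(_ x xr) /= /negbTE->.
Qed.

(** If [y] is a root of a nonzero polynomial of [l], root counting answers. Otherwise the signs are
    an open condition, and one that is realized is realized near an infinity or, by Rolle, at a
    critical point of the product: leading coefficients decide the former and root counting the
    latter. *)
Lemma sign_back_forth_poly (l : seq (seq pterm)) :
  exists L, forall (K K' : rcfType) (e : nat -> K) (e' : nat -> K'),
    sign_agree L e e' -> forall y, exists y',
      {in l, forall s, sgz (ppoly e s).[y] = sgz (ppoly e' s).[y']}.
Proof.
(* Multiplication by the prescribed sign turns the constraints into positivity. Prescribed zeros are
   dropped: where [sq] is used, they belong to zero polynomials. *)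
pose sq (v : seq int) (K : rcfType) (e : nat -> K) : seq {poly K} :=
  [seq (ppoly e q.1) * (q.2%:~R)%:P | q <- zip l v & q.2 != 0].
pose sqf (q : seq pterm * int) (K : rcfType) (e : nat -> K) := ppoly e q.1 * (q.2%:~R)%:P.
have fsq q : formal (sqf q).
  rewrite /sqf; apply: formalM (formal_ppoly _) _; case: (intP q.2) => [|n|n].
  - by have [s sE] := formalC (PNat 0); exists s => K e; rewrite -sE.
  - by have [s sE] := formalC (PNat n.+1); exists s => K e; rewrite -sE.
  - have [s sE] := formalC (POpp (PNat n.+1)).
    by exists s => K e; rewrite -sE /= mulrNz polyCN.
pose bq (v : seq int) (K : rcfType) (e : nat -> K) := bounding_poly (sq v K e).
have fbq v : formal (bq v).
  have [s sE] : formal (fun K e => (\prod_(q <- [seq q <- zip l v | q.2 != 0]) sqf q K e)^`()).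
    by apply: formal_deriv; apply: formal_prod.
  by exists s => K e; rewrite -sE /bq /bounding_poly /sq big_map.
have [L0 L0E] : exists L, {in l, forall s (K K' : rcfType) (e : nat -> K) (e' : nat -> K'),
    sign_agree L e e' -> (ppoly e s == 0) = (ppoly e' s == 0)}.
  by apply: sign_determined_in => s _; apply: sign_determined_eq0; apply: formal_ppoly.
pose info (v : seq int) (K : rcfType) (e : nat -> K) :=
  [seq (size p, sgz (lead_coef p)) | p : {poly K} <- sq v K e].
have dinfo v : sign_determined (info v).
  rewrite /info /sq; elim: (filter _ _) => [|q s IHs]; first exact: sign_determined_cst.
  apply: (sign_determined_comp2 cons) IHs; apply: (sign_determined_comp2 pair).
    exact: (sign_determined_size (fsq q)).
  exact: (sign_determined_lead (fsq q)).
have [L1 L1E] := sign_determined_in (l := sign_vectors (size l)) (fun v _ => dinfo v).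
have [L2 L2E] : exists L, {in sign_vectors (size l), forall v (K K' : rcfType) (e : nat ->
  K) (e' : nat -> K'),
    sign_agree L e e' -> forall y, bq v K e != 0 -> root (bq v K e) y ->
    exists2 y', root (bq v K' e') y' &
      {in l, forall s, sgz (ppoly e s).[y] = sgz (ppoly e' s).[y']}}.
  apply: seq_finite_choice => [v s s' H|v s s' H|v _]; last exact: sign_back_forth_root.
    by move=> K K' e e' /sign_agree_cat[ag _]; apply: H.
  by move=> K K' e e' /sign_agree_cat[_ ag]; apply: H.
have [L3 L3E] : exists L, {in l, forall s (K K' : rcfType) (e : nat -> K) (e' : nat -> K'),
    sign_agree L e e' -> forall y, ppoly e s != 0 -> root (ppoly e s) y ->
    exists2 y', root (ppoly e' s) y' &
      {in l, forall s, sgz (ppoly e s).[y] = sgz (ppoly e' s).[y']}}.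
  apply: seq_finite_choice => [v s s' H|v s s' H|v _].
  - by move=> K K' e e' /sign_agree_cat[ag _]; apply: H.
  - by move=> K K' e e' /sign_agree_cat[_ ag]; apply: H.
  - by apply: (sign_back_forth_root l); apply: formal_ppoly.
exists (L0 ++ L1 ++ L2 ++ L3) => K K' e e'.
move=> /sign_agree_cat[ag0 /sign_agree_cat[ag1 /sign_agree_cat[ag2 ag3]]] y.
have [/hasP[s sl /andP[s0 sy]]|] := boolP (has (fun s => (ppoly e s != 0) && root (ppoly e s) y) l).
  by have [y' _ yy'] := L3E s sl _ _ _ _ ag3 y s0 sy; exists y'.
rewrite -all_predC => /allP noroot {L3E ag3}.
pose v := [seq sgz (ppoly e s).[y] | s <- l].
have vl : v \in sign_vectors (size l) by apply: sign_vectorsP => s; apply: mem_sgz.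
have v_eq0 s : s \in l -> (sgz (ppoly e s).[y] == 0) = (ppoly e s == 0).
  move=> sl; have := noroot s sl; rewrite /= sgz_eq0 negb_and negbK rootE.
  by have [->|_ /= /negbTE] := eqVneq (ppoly e s) 0; rewrite ?horner0 ?eqxx.
have sqP (K1 : rcfType) (e1 : nat -> K1) q : q \in sq v K1 e1 -> exists2 s, s \in l &
    sgz (ppoly e s).[y] != 0 /\ q = ppoly e1 s * ((sgz (ppoly e s).[y])%:~R)%:P.
  move=> /mapP[[s i]]; rewrite mem_filter /v /= => /andP[i0 si] ->.
  have /(nthP (s, i)) [j] := si; rewrite size_zip size_map minnn => jl.
  rewrite nth_zip ?size_map // (nth_map s) // => -[js]; rewrite js => ei.
  by exists s; rewrite ?ei // -js mem_nth.
have mem_sq (K1 : rcfType) (e1 : nat -> K1) s : s \in l -> sgz (ppoly e s).[y] != 0 ->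
    ppoly e1 s * ((sgz (ppoly e s).[y])%:~R)%:P \in sq v K1 e1.
  move=> sl i0; apply/mapP; exists (s, sgz (ppoly e s).[y]) => //.
  rewrite mem_filter /= i0 /v; apply/(nthP (s, 0)); exists (index s l).
    by rewrite size_zip size_map minnn index_mem.
  by rewrite nth_zip ?size_map // (nth_map s) ?index_mem // nth_index.
have sq_gt0 (K1 : rcfType) (e1 : nat -> K1) (x : K1) : {in l, forall s, (ppoly e s == 0) ->
  (ppoly e1 s == 0)} ->
    (forall q, q \in sq v K1 e1 -> q.[x] > 0) ->
    {in l, forall s, sgz (ppoly e s).[y] = sgz (ppoly e1 s).[x]}.
  move=> s0 sqx s sl; have [i0|i0] := eqVneq (sgz (ppoly e s).[y]) 0.
    rewrite i0; move/eqP: i0; rewrite v_eq0 // => /(s0 s sl) /eqP->.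
    by rewrite horner0 sgz0.
  have := sqx _ (mem_sq _ e1 _ sl i0); rewrite hornerM hornerC.
  rewrite -sgz_gt0 sgzM; case: (sgzP (ppoly e s).[y]) i0 => // _ _.
    by rewrite sgz1 mulr1; case: sgzP.
  by rewrite sgzN1 mulrN1; case: sgzP.
have sq_y : \big[andb/true]_(q <- sq v K e) (q.[y] > 0).
  rewrite big_all; apply/allP => q /sqP[s sl [s0 ->]]; rewrite hornerM hornerC.
  by rewrite -sgz_gt0 sgzM; case: sgzP s0 => // _; rewrite ?sgz1 ?sgzN1.
have key : [\/ exists x, \big[andb/true]_(q <- sq v K' e') (q.[x] > 0) |
    exists y', {in l, forall s, sgz (ppoly e s).[y] = sgz (ppoly e' s).[y']}].
  have infoE := L1E v vl _ _ _ _ ag1.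
  have transf (f : nat * int -> bool) :
      all (fun p : {poly K} => f (size p, sgz (lead_coef p))) (sq v K e) ->
      all (fun p : {poly K'} => f (size p, sgz (lead_coef p))) (sq v K' e').
    have : all f (info v K e) = all f (info v K' e') by rewrite infoE.
    by rewrite /info !all_map => E h; exact: (etrans (esym E) h).
  have case1 : all (fun q : {poly K} => 0 < lead_coef q) (sq v K e) ->
      exists x, \big[andb/true]_(q <- sq v K' e') (q.[x] > 0).
    move=> pos; apply/bounding_polyP; constructor 1; rewrite big_all.
    have /(transf (fun d => 0 < d.2)) : all (fun q : {poly K} => 0 < sgz (lead_coef q)) (sq v K e).
      by apply: sub_all pos => q; rewrite sgz_gt0.
    by apply: sub_all => q /=; rewrite sgz_gt0.
  have := (bounding_polyP (sq v K e)).2 (ex_intro _ y sq_y) => -[].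
  - by rewrite big_all => /case1; left.
  - move=> neg; left; apply/bounding_polyP; constructor 2; move: neg; rewrite !big_all => neg.
    have E (K1 : rcfType) (q : {poly K1}) : (0 < (-1) ^+ (size q).-1 * lead_coef q)
        = (0 < (-1) ^+ (size q).-1 * sgz (lead_coef q)).
      rewrite -[in LHS]signr_odd -[in RHS]signr_odd.
      by case: (odd _); rewrite ?expr1 ?expr0 ?mulN1r ?mul1r ?oppr_gt0 ?sgz_gt0 ?sgz_lt0.
    have /(transf (fun d => 0 < (-1) ^+ d.1.-1 * d.2)) :
        all (fun q : {poly K} => 0 < (-1) ^+ (size q).-1 * sgz (lead_coef q)) (sq v K e).
      by apply: sub_all neg => q; rewrite E.
    by apply: sub_all => q /=; rewrite E.
  - move=> [x /andP[bx pos]]; have [b0|b0] := eqVneq (bq v K e) 0.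
      (* A vanishing derivative makes the product a nonzero constant, and with it every factor;
         positive constants have positive leading coefficients. *)
      left; apply: case1; move: b0; rewrite /bq /bounding_poly => b0.
      have ppos : \prod_(q <- sq v K e) q != 0.
        rewrite prodf_seq_neq0; apply/allP => q qs; apply: contraTneq isT => q0.
        by move: pos; rewrite big_all => /allP/(_ q qs); rewrite q0 horner0 ltxx.
      have sz1 : size (\prod_(q <- sq v K e) q) == 1%N.
        rewrite eqn_leq size_poly_gt0 ppos andbT.
        by rewrite polyorder.derivn_poly0 derivn1 b0.
      apply/allP => q qs.
      have /(_ q qs)/eqP/size_poly1P[c _ qc] := elimT (size_prod_eq1 _) sz1.
      by move: pos; rewrite big_all => /allP/(_ q qs); rewrite qc hornerC lead_coefC.
    have [x' _ xx'] := L2E v vl _ _ _ _ ag2 x b0 bx; right; exists x' => s sl.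
    rewrite -xx' //; apply: (sq_gt0 K e x) => //.
    by move=> q; move: q; apply/allP; rewrite -big_all.
case: key => [[x]|//]; rewrite big_all => /allP pos; exists x.
apply: sq_gt0 => //; first by move=> s sl; rewrite (L0E s sl _ _ _ _ ag0).
Qed.

(** * Values of algebraic elements *)

Definition tpoly (K : rcfType) (t : pterm) (e : nat -> K) : {poly K} :=
  peval (scons 'X (fun i => (e i)%:P)) t.

Lemma horner_tpoly (K : rcfType) (e : nat -> K) t y :
  (tpoly t e).[y] = peval (scons y e) t.
Proof.
elim: t => [[|i]|n|u IHu v IHv|u IHu|u IHu v IHv] /=.
- exact: hornerX.
- exact: hornerC.
- by rewrite /tpoly /= -polyC_natr hornerC.
- by rewrite hornerD IHu IHv.
- by rewrite hornerN IHu.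
- by rewrite hornerM IHu IHv.
Qed.

Lemma formal_tpoly t : formal (fun K e => tpoly t e).
Proof.
elim: t => [[|i]|n|u IHu v IHv|u IHu|u IHu v IHv].
- exact: formalX.
- by have [s sE] := formalC (PVar i); exists s => K e; rewrite -sE.
- by have [s sE] := formalC (PNat n); exists s => K e; rewrite -sE /tpoly /= polyC_natr.
- exact: formalD.
- exact: formalN.
- exact: formalM.
Qed.

Fixpoint pren (f : nat -> nat) (t : pterm) : pterm :=
  match t with
  | PVar i => PVar (f i)
  | PNat n => PNat n
  | PAdd u v => PAdd (pren f u) (pren f v)
  | POpp u => POpp (pren f u)
  | PMul u v => PMul (pren f u) (pren f v)
  end.

Lemma peval_pren (R : nzRingType) (e : nat -> R) f t :
  peval e (pren f t) = peval (e \o f) t.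
Proof. by elim: t => //= [u -> v -> | u -> | u -> v ->]. Qed.

Lemma peval_lift (R : nzRingType) (e : nat -> R) y t :
  peval (scons y e) (pren succn t) = peval e t.
Proof. exact: peval_pren. Qed.

Definition pexp (t : pterm) (n : nat) : pterm := iter n (PMul t) (PNat 1).

Lemma peval_pexp (R : nzRingType) (e : nat -> R) t n :
  peval e (pexp t n) = peval e t ^+ n.
Proof. by elim: n => // n IHn; rewrite exprS -IHn. Qed.

(** Tarski's quantifier elimination for real closed fields in back-and-forth form. *)
Lemma sign_back_forth (L : seq pterm) :
  exists L', forall (K K' : rcfType) (e : nat -> K) (e' : nat -> K'),
    sign_agree L' e e' -> forall y, exists y', sign_agree L (scons y e) (scons y' e').
Proof.
have [l lE] : exists l : seq (seq pterm), forall t, t \in L -> exists2 s, s \in l &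
    forall (K : rcfType) (e : nat -> K), tpoly t e = ppoly e s.
  elim: L => [|t L [l IHl]]; first by exists [::].
  have [s sE] := formal_tpoly t; exists (s :: l) => u.
  rewrite in_cons => /predU1P[->|/IHl[r rl rE]]; first by exists s; rewrite ?mem_head.
  by exists r; rewrite // in_cons rl orbT.
have [L' L'E] := sign_back_forth_poly l.
exists L' => K K' e e' /L'E ll' y; have [y' yy'] := ll' y.
by exists y' => t /lE[s /yy' ss' sE]; rewrite -!horner_tpoly !sE.
Qed.

Lemma sgz_near (K : rcfType) (l : seq {poly K}) x :
  (forall p, p \in l -> p != 0 -> ~~ root p x) ->
  exists2 d, 0 < d & forall y, `|y - x| < d -> {in l, forall p, sgz p.[y] = sgz p.[x]}.
Proof.
elim: l => [|p l IHl] px; first by exists 1.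
have [|d d0 dP] := IHl; first by move=> q ql; apply: px; rewrite in_cons ql orbT.
have [p0|p0] := eqVneq p 0.
  exists d => // y /dP yd q; rewrite in_cons => /predU1P[->|/yd//].
  by rewrite p0 !horner0.
have pneq0 : 0 < `|p.[x]| by rewrite normr_gt0 -rootE px ?mem_head.
have [b b0 bP] := poly_cont x p pneq0.
exists (Num.min d b) => [|y]; first by rewrite lt_min d0.
rewrite lt_min => /andP[/dP yd /bP yb] q; rewrite in_cons => /predU1P[->|/yd//].
move: yb; rewrite ltr_distl => /andP[lo hi]; case: (sgzP p.[x]) => px0.
- by move: pneq0; rewrite px0 normr0 ltxx.
- by apply/eqP; rewrite sgz_cp0; move: lo; rewrite gtr0_norm // subrr.
- by apply/eqP; rewrite sgz_cp0; move: hi; rewrite ltr0_norm // subrr.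
Qed.

(* If the value x of t were no root of the terms whose signs decide whether x is
   such a value, then so would be all elements near x, but q has finitely many roots. *)
Lemma annihilators (q t : pterm) :
  exists R : seq pterm, forall (K : rcfType) (e : nat -> K) y,
    tpoly q e != 0 -> peval (scons y e) q = 0 ->
    exists2 m, m \in R & tpoly m e != 0 /\ root (tpoly m e) (peval (scons y e) t).
Proof.
pose up i := if i is j.+1 then j.+2 else 0%N.
have upE (K : rcfType) (e : nat -> K) y x s :
    peval (scons y (scons x e)) (pren up s) = peval (scons y e) s.
  by rewrite peval_pren; apply: eq_peval => -[].
(* Variable 1 holds [x]: the two terms vanish together exactly when the new element is a root of [q]
   at which [t] takes the value [x]. *)
have [R RP] := sign_back_forth [:: pren up q; PAdd (pren up t) (POpp (PVar 1))].
exists R => K e y q0 qy; set x := peval _ t.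
have [//|noR] := classic (exists2 m, m \in R & tpoly m e != 0 /\ root (tpoly m e) x).
have [|d d0 dP] := @sgz_near K [seq tpoly m e | m <- R] x.
  move=> p /mapP[m mR ->] m0; apply/negP => rm; apply: noR; exists m => //.
have val z : `|z - x| < d -> z \in [seq peval (scons b e) t | b <- rootsR (tpoly q e)].
  move=> /dP zx; have [|b ab] := RP K K (scons x e) (scons z e) _ y.
    by move=> m mR; rewrite -!horner_tpoly zx //; apply/mapP; exists m.
  have := ab (pren up q); rewrite mem_head !upE qy sgz0 => /(_ isT)/esym/eqP.
  rewrite sgz_eq0 => qb.
  have := ab (PAdd (pren up t) (POpp (PVar 1))); rewrite !inE eqxx orbT => /(_ isT) /=.
  rewrite !upE -/x subrr sgz0 => /esym/eqP; rewrite sgz_eq0 subr_eq0 => /eqP <-.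
  by apply: map_f; rewrite -(roots_on_rootsR q0) rootE horner_tpoly.
pose n := size (rootsR (tpoly q e)).
(* The offsets start at [d / 2], so all these points lie strictly within [d] of [x]; one more of
   them is taken than [q] has roots. *)
pose z i := x + d / i.+2%:R.
have zinj : injective z.
  move=> i j /addrI /(mulfI (lt0r_neq0 d0)) /invr_inj /eqP.
  by rewrite eqr_nat => /eqP[].
have := @uniq_leq_size _ [seq z i | i <- iota 0 n.+1] _ _ _.
rewrite map_inj_uniq ?iota_uniq // => /(_ [seq peval (scons b e) t | b <- rootsR (tpoly q e)] isT).
rewrite !size_map size_iota ltnn => impossible; have : false by
  apply: impossible => _ /mapP[i _ ->]; apply: val;
  rewrite addrC addKr gtr0_norm ?divr_gt0 ?ltr0n // ltr_pdivrMr ?ltr0n // ltr_pMr // ltr1n.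
by [].
Qed.

(** The terms of [p] at the root [x] sum to 0, so the largest is bounded by the sum of the others,
    and one of these reaches at least [1 / n] of it. *)
Lemma dominant_terms (K : rcfType) (p : {poly K}) x n :
  p != 0 -> root p x -> x != 0 -> (size p <= n)%N ->
  exists i j, [/\ (i < j < n)%N, p`_i != 0, p`_j != 0,
    `|p`_j * x ^+ (j - i)| <= n%:R * `|p`_i| & `|p`_i| <= n%:R * `|p`_j * x ^+ (j - i)|].
Proof.
move=> p0 px x0 szp.
have szp0 : (0 < size p)%N by rewrite size_poly_gt0.
have n_gt0 : (0 < n)%N := leq_trans szp0 szp.
pose F (i : 'I_n) := `|p`_i * x ^+ i|.
have [k _ kmax] := @arg_maxP _ K _ (Ordinal n_gt0) predT F isT.
have Fk0 : 0 < F k.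
  have lt : ((size p).-1 < n)%N by rewrite prednK.
  apply: lt_le_trans (kmax (Ordinal lt) isT); rewrite /F /= normr_gt0.
  by rewrite mulf_neq0 ?expf_neq0 // -lead_coefE lead_coef_eq0.
have sum0 : \sum_(i < n) p`_i * x ^+ i = 0 by rewrite -(horner_coef_wide _ szp); apply/eqP.
have [j jk Fj] : exists2 j, j != k & F k <= n%:R * F j.
  apply: NNPP => no.
  have small j : j != k -> F j < F k / n%:R.
    move=> jk; rewrite ltr_pdivlMr ?ltr0n // mulrC ltNge; apply/negP => ?.
    by apply: no; exists j.
  move: sum0; rewrite (bigD1 k) //= => /eqP; rewrite addr_eq0 => /eqP ek.
  have : F k <= \sum_(i < n | i != k) F k / n%:R.
    rewrite {1}/F ek normrN (le_trans (ler_norm_sum _ _ _)) //.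
    by apply: ler_sum => i /small/ltW.
  rewrite sumr_const cardC1 card_ord -[X in _ <= X]mulr_natr -mulrA ler_pMr // mulrC.
  by rewrite ler_pdivlMr ?ltr0n // mul1r ler_nat -ltnS prednK // ltnn.
have Fj0 : 0 < F j by move: Fk0; rewrite -(pmulr_rgt0 (F j) (_ : 0 < n%:R)) ?ltr0n // =>
  /lt_le_trans->.
have n1 : 1 <= n%:R :> K by rewrite ler1n.
have Fjk : F j <= n%:R * F k by exact: le_trans (kmax j isT) (ler_peMl (ltW Fk0) n1).
have coef0 i : 0 < F i -> p`_i != 0 by rewrite /F normr_gt0 mulf_eq0 negb_or => /andP[-> _].
have main (i l : 'I_n) : (i < l)%N -> 0 < F i -> 0 < F l -> F i <= n%:R * F l ->
    F l <= n%:R * F i -> exists i j, [/\ (i < j < n)%N, p`_i != 0, p`_j != 0,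
    `|p`_j * x ^+ (j - i)| <= n%:R * `|p`_i| & `|p`_i| <= n%:R * `|p`_j * x ^+ (j - i)|].
  move=> il Fi Fl Fil Fli; exists i, l; rewrite il ltn_ord !coef0 //; split=> //.
    have xi : 0 < `|x ^+ i| by rewrite normr_gt0 expf_neq0.
    by rewrite -(ler_pM2r xi) -mulrA -!normrM -mulrA -exprD subnK ?(ltnW il).
  have xi : 0 < `|x ^+ i| by rewrite normr_gt0 expf_neq0.
  by rewrite -(ler_pM2r xi) -mulrA -!normrM -mulrA -exprD subnK ?(ltnW il).
case: (ltngtP j k) => jk'; [exact: (main j k)|exact: (main k j)|].
by rewrite (ord_inj jk') eqxx in jk.
Qed.

(* [t ^ m * c] and [d] differ by a factor in [1/N, N], so that the value of the
   algebraic element [t] is [(v d - v c) / m]. *)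
Lemma algebraic_value (q t : pterm) :
  exists C : seq (pterm * pterm * nat * nat), forall (K : rcfType) (e : nat -> K) y,
    tpoly q e != 0 -> peval (scons y e) q = 0 -> peval (scons y e) t != 0 ->
    exists2 w, w \in C & let: (c, d, m, N) := w in
      [/\ (0 < m)%N, peval e c != 0, peval e d != 0,
          `|peval (scons y e) t ^+ m * peval e c| <= N%:R * `|peval e d| &
          `|peval e d| <= N%:R * `|peval (scons y e) t ^+ m * peval e c|].
Proof.
have [R RP] := annihilators q t.
have [C CP] : exists C : seq (pterm * pterm * nat * nat), {in R,
  forall m (K : rcfType) (e : nat -> K) x,
    tpoly m e != 0 -> root (tpoly m e) x -> x != 0 ->
    exists2 w, w \in C & let: (c, d, m, N) := w in
      [/\ (0 < m)%N, peval e c != 0, peval e d != 0,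
          `|x ^+ m * peval e c| <= N%:R * `|peval e d| &
          `|peval e d| <= N%:R * `|x ^+ m * peval e c|]}.
  apply: seq_finite_choice => [m C C' H K e x m0 mx x0|m C C' H K e x m0 mx x0|m _].
  - by have [w wC] := H K e x m0 mx x0; exists w; rewrite // mem_cat wC.
  - by have [w wC] := H K e x m0 mx x0; exists w; rewrite // mem_cat wC orbT.
  have [s sE] := formal_tpoly m; pose n := size s.
  exists [seq (pcoef s j, pcoef s i, (j - i)%N, n) | i <- iota 0 n, j <- iota 0 n].
  move=> K e x m0 mx x0.
  have szm : (size (tpoly m e) <= n)%N by rewrite sE size_ppoly.
  have [i [j [/andP[ij jn] pi0 pj0 le1 le2]]] := dominant_terms m0 mx x0 szm.
  exists (pcoef s j, pcoef s i, (j - i)%N, n).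
    by apply/allpairsP; exists (i, j); rewrite !mem_iota /= !add0n jn (ltn_trans ij jn).
  by rewrite -!coef_ppoly -sE subn_gt0 ij pi0 pj0 mulrC.
exists C => K e y q0 qy ty; have [m mR [m0 mt]] := RP K e y q0 qy.
exact: (CP m mR).
Qed.

(** * Convexly valued real closed fields *)

(** Convexity yields closure under negation and makes [vint] a valuation ring. Properness makes the
    valuation nontrivial, so that nonzero elements have others of strictly smaller and strictly
    larger value. *)
Record vrcf : Type := Vrcf {
  vrcf_rcf :> rcfType;
  vint : vrcf_rcf -> Prop;
  vint1 : vint 1;
  vintD : forall x y, vint x -> vint y -> vint (x + y);
  vintM : forall x y, vint x -> vint y -> vint (x * y);
  vint_convex : forall x y, vint y -> `|x| <= `|y| -> vint x;
  vint_proper : exists x, ~ vint x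
}.

(** This is [v(a) <= v(b)], which runs against the order of absolute values. *)
Definition vdiv (S : vrcf) (a b : S) : Prop := exists2 z : S, vint z & b = a * z.

Section Vdiv.

Variable S : vrcf.
Implicit Types a b c d x y z : S.

Lemma vint_nat n : vint (n%:R : S).
Proof.
elim: n => [|n IHn]; last by rewrite mulrSr; apply: vintD IHn (vint1 S).
by apply: (@vint_convex S 0 1) (vint1 S) _; rewrite normr0.
Qed.

Lemma vdiv_refl a : vdiv a a.
Proof. by exists 1; [exact: vint1|rewrite mulr1]. Qed.

Lemma vdiv_trans b a c : vdiv a b -> vdiv b c -> vdiv a c.
Proof. by move=> [x Ox ->] [y Oy ->]; exists (x * y); [exact: vintM|rewrite mulrA]. Qed.

Lemma vdivx0 a : vdiv a 0.
Proof. by exists 0; [exact: (vint_nat 0)|rewrite mulr0]. Qed.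

Lemma vdiv0x a : vdiv 0 a <-> a = 0.
Proof. by split=> [[z _ ->]|->]; [rewrite mul0r|exact: vdivx0]. Qed.

(** The subring contains the naturals, so a bound up to a natural factor is a bound on values. This
    is the bridge from signs to values. *)
Lemma vdiv_nat_norm n a b : `|b| <= n%:R * `|a| -> vdiv a b.
Proof.
have [->|a0] := eqVneq a 0.
  by rewrite normr0 mulr0 normr_le0 => /eqP->; apply: vdivx0.
move=> le; exists (b / a); last by rewrite mulrC divfK.
apply: (@vint_convex S _ n%:R) (vint_nat n) _.
by rewrite normf_div normr_nat ler_pdivrMr ?normr_gt0.
Qed.

Lemma vdiv_norm a b : `|b| <= `|a| -> vdiv a b.
Proof. by move=> le; apply: (@vdiv_nat_norm 1); rewrite mul1r. Qed.

Lemma vdiv_total a b : vdiv a b \/ vdiv b a.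
Proof. by have /orP[] := le_total `|a| `|b| => /vdiv_norm; [right|left]. Qed.

Lemma vdivN_norm a b : ~ vdiv a b -> `|a| < `|b|.
Proof. by move=> nab; rewrite ltNge; apply/negP => /vdiv_norm. Qed.

Lemma vdiv_mul a b c d : vdiv a b -> vdiv c d -> vdiv (a * c) (b * d).
Proof.
move=> [x Ox ->] [y Oy ->]; exists (x * y); first exact: vintM.
by rewrite mulrACA.
Qed.

Lemma vdiv_mul2r c a b : c != 0 -> vdiv (a * c) (b * c) <-> vdiv a b.
Proof.
move=> c0; split=> [[z Oz e]|/vdiv_mul]; last by apply; apply: vdiv_refl.
by exists z => //; apply: (mulIf c0); rewrite e mulrAC.
Qed.

Lemma vdiv_mul2l c a b : c != 0 -> vdiv (c * a) (c * b) <-> vdiv a b.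
Proof. by rewrite ![c * _]mulrC; apply: vdiv_mul2r. Qed.

(** The value group is torsion-free: if [b / a] exceeds 1 in absolute value, it is bounded by its
    own power, and convexity applies. *)
Lemma vdiv_exp n a b : (0 < n)%N -> vdiv (a ^+ n) (b ^+ n) <-> vdiv a b.
Proof.
move=> n0; split=> [[z Oz e]|ab]; last first.
  by elim: n {n0} => [|n IHn]; rewrite ?exprS; [exact: vdiv_refl|exact: vdiv_mul].
have [a0|a0] := eqVneq a 0.
  by move/eqP: e; rewrite a0 expr0n eqn0Ngt n0 mul0r expf_eq0 n0 => /eqP->; apply: vdivx0.
have [le|lt] := lerP `|b| `|a|; first exact: vdiv_norm.
exists (b / a); last by rewrite mulrC divfK.
apply: vint_convex Oz _; rewrite -(mulKf (expf_neq0 n a0) z) -e.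
rewrite -exprVn -exprMn mulrC normrX; apply: ler_eXnr => //.
by rewrite mulrC normf_div ler_pdivlMr ?normr_gt0 // mul1r ltW.
Qed.

Definition vequiv a b : Prop := vdiv a b /\ vdiv b a.

Lemma vequiv_refl a : vequiv a a.
Proof. by split; apply: vdiv_refl. Qed.

Lemma vequiv_bounds n m a b : `|a| <= n%:R * `|b| -> `|b| <= m%:R * `|a| -> vequiv a b.
Proof. by move=> /vdiv_nat_norm ? /vdiv_nat_norm. Qed.

Lemma vdiv_equiv a a' b b' : vequiv a a' -> vequiv b b' -> vdiv a b <-> vdiv a' b'.
Proof.
move=> [aa' a'a] [bb' b'b]; split=> h.
  by apply: vdiv_trans a'a (vdiv_trans h bb').
by apply: vdiv_trans aa' (vdiv_trans h b'b).
Qed.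

Lemma vequiv_mul a a' b b' : vequiv a a' -> vequiv b b' -> vequiv (a * b) (a' * b').
Proof. by move=> [? ?] [? ?]; split; apply: vdiv_mul. Qed.

Lemma vequiv_exp n a b : vequiv a b -> vequiv (a ^+ n) (b ^+ n).
Proof.
move=> ab; elim: n => [|n IHn]; first exact: vequiv_refl.
by rewrite !exprS; apply: vequiv_mul.
Qed.

End Vdiv.

Definition agree (L : seq pterm) (S S' : vrcf) (e : nat -> S) (e' : nat -> S') : Prop :=
  sign_agree L e e' /\
  {in L &, forall t u, vdiv (peval e t) (peval e u) <-> vdiv (peval e' t) (peval e' u)}.

Lemma agree_sub L M (S S' : vrcf) (e : nat -> S) (e' : nat -> S') :
  {subset L <= M} -> agree M e e' -> agree L e e'.
Proof.
move=> LM [sg dv]; split; first exact: sign_agree_sub LM sg.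
by move=> t u tL uL; apply: dv; apply: LM.
Qed.

Lemma agree_cat L M (S S' : vrcf) (e : nat -> S) (e' : nat -> S') :
  agree (L ++ M) e e' -> agree L e e' /\ agree M e e'.
Proof.
by move=> ag; split; apply: agree_sub ag => t; rewrite mem_cat => ->;
  rewrite ?orbT.
Qed.

Lemma agree_sym L (S S' : vrcf) (e : nat -> S) (e' : nat -> S') :
  agree L e e' -> agree L e' e.
Proof. by move=> [sg dv]; split=> [|t u tL uL]; [apply: sign_agree_sym|rewrite dv]. Qed.

Lemma sgz_eq_eq0 (K K' : rcfType) (x : K) (x' : K') : sgz x = sgz x' -> (x == 0) = (x' == 0).
Proof. by move=> xx'; rewrite -sgz_eq0 xx' sgz_eq0. Qed.

Lemma sgz_eq_gt0 (K K' : rcfType) (x : K) (x' : K') : sgz x = sgz x' -> (0 < x) = (0 < x').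
Proof. by move=> xx'; rewrite -sgz_gt0 xx' sgz_gt0. Qed.

Lemma sgz_eq_ge0 (K K' : rcfType) (x : K) (x' : K') : sgz x = sgz x' -> (0 <= x) = (0 <= x').
Proof. by move=> xx'; rewrite -sgz_ge0 xx' sgz_ge0. Qed.

(** Squares remove the absolute values, so that a comparison up to the factor [n] becomes a sign
    condition. *)
Definition pbound (n : nat) (a b : pterm) : pterm :=
  PAdd (PMul (PNat n) (PMul (PNat n) (PMul b b))) (POpp (PMul a a)).

Arguments pbound : simpl never.

Lemma peval_pbound (K : rcfType) (e : nat -> K) n a b :
  (0 <= peval e (pbound n a b)) = (`|peval e a| <= n%:R * `|peval e b|).
Proof.
rewrite /pbound /= subr_ge0 -[in RHS]ler_sqr ?nnegrE ?mulr_ge0 ?ler0n //.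
by rewrite exprMn !real_normK ?num_real // !expr2 !mulrA.
Qed.

(** Each nonzero [t(y)] has the value of an m-th root of [d / c], with [c] and [d] free of [y], and
    the bounds that express this are sign conditions. A [y'] with the same signs inherits them, so
    comparing two values reduces to terms in the old variables. *)
Lemma agree_back_forth_root (L : seq pterm) (q : pterm) :
  exists L', forall (S S' : vrcf) (e : nat -> S) (e' : nat -> S'), agree L' e e' ->
    forall y, tpoly q e != 0 -> peval (scons y e) q = 0 ->
    exists y', agree L (scons y e) (scons y' e').
Proof.
have [C CP] : exists C : seq (pterm * pterm * nat * nat), {in L, forall t
    (K : rcfType) (e : nat -> K) y,
    tpoly q e != 0 -> peval (scons y e) q = 0 -> peval (scons y e) t != 0 ->
    exists2 w, w \in C & let: (c, d, m, N) := w in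
      [/\ (0 < m)%N, peval e c != 0, peval e d != 0,
          `|peval (scons y e) t ^+ m * peval e c| <= N%:R * `|peval e d| &
          `|peval e d| <= N%:R * `|peval (scons y e) t ^+ m * peval e c|]}.
  apply: seq_finite_choice => [t C C' H K e y q0 qy ty|t C C' H K e y q0 qy ty|t _].
  - by have [w wC] := H K e y q0 qy ty; exists w; rewrite // mem_cat wC.
  - by have [w wC] := H K e y q0 qy ty; exists w; rewrite // mem_cat wC orbT.
  - exact: algebraic_value.
pose lhs (t : pterm) (w : pterm * pterm * nat * nat) :=
  let: (c, d, m, N) := w in PMul (pexp t m) (pren succn c).
pose rhs (w : pterm * pterm * nat * nat) := let: (c, d, m, N) := w in pren succn d.
pose B := L ++ [seq pren succn w.1.1.1 | w <- C] ++ [seq rhs w | w <- C]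
  ++ [seq pbound w.2 (lhs t w) (rhs w) | t <- L, w <- C]
  ++ [seq pbound w.2 (rhs w) (lhs t w) | t <- L, w <- C].
(* Comparing the m-th root of [d / c] with the m'-th root of [d' / c'] means comparing [d^m' c'^m]
   with [d'^m c^m']. *)
pose val (w w' : pterm * pterm * nat * nat) :=
  let: (c, d, m, N) := w in let: (c', d', m', N') := w' in
  PMul (pexp d m') (pexp c' m).
have [L' L'P] := sign_back_forth B.
exists (L' ++ [seq val w w' | w <- C, w' <- C]) => S S' e e'.
move=> /agree_cat[[/L'P sg _] [_ dv]] y q0 qy; have [y' yy'] := sg y.
exists y'; split; first by apply: sign_agree_sub yy' => t tL; rewrite mem_cat tL.
have agL t : t \in L -> sgz (peval (scons y e) t) = sgz (peval (scons y' e') t).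
  by move=> tL; apply: yy'; rewrite mem_cat tL.
have value t : t \in L -> peval (scons y e) t != 0 ->
    exists2 w, w \in C & [/\ (0 < w.1.2)%N,
      vequiv (peval (scons y e) t ^+ w.1.2 * peval e w.1.1.1) (peval e w.1.1.2),
      vequiv (peval (scons y' e') t ^+ w.1.2 * peval e' w.1.1.1) (peval e' w.1.1.2),
      peval e w.1.1.1 != 0 & peval e' w.1.1.1 != 0].
  move=> tL t0; have [[[[c d] m] N] wC [m0 c0 d0 le1 le2]] := CP t tL S e y q0 qy t0.
  exists (c, d, m, N) => //=.
  have c0' : peval e' c != 0.
    have : pren succn c \in B.
      rewrite !mem_cat; apply/orP; right; apply/orP; left.
      by apply/mapP; exists (c, d, m, N).
    by move=> /yy' /sgz_eq_eq0; rewrite !peval_lift => <-.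
  split=> //; first exact: vequiv_bounds le1 le2.
  have bnd a b : pbound N a b \in B -> (`|peval (scons y' e') a| <= N%:R * `|peval (scons y' e') b|)
      = (`|peval (scons y e) a| <= N%:R * `|peval (scons y e) b|).
    by move=> /yy' /sgz_eq_ge0; rewrite !peval_pbound.
  have := bnd (lhs t (c, d, m, N)) (rhs (c, d, m, N)).
  have := bnd (rhs (c, d, m, N)) (lhs t (c, d, m, N)).
  rewrite /= !peval_pexp !peval_lift le1 le2 => le2' le1'.
  apply: (@vequiv_bounds _ N N); [rewrite le1'|rewrite le2'] => //.
    rewrite !mem_cat; do 3![apply/orP; right]; apply/orP; left.
    by apply/allpairsP; exists (t, (c, d, m, N)).
  rewrite !mem_cat; do 4![apply/orP; right].
  by apply/allpairsP; exists (t, (c, d, m, N)).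
have eq0E t : t \in L -> (peval (scons y e) t == 0) = (peval (scons y' e') t == 0).
  by move=> /agL/sgz_eq_eq0.
move=> t u tL uL.
have [u0|u0] := eqVneq (peval (scons y e) u) 0.
  have /eqP u0' : peval (scons y' e') u == 0 by rewrite -eq0E // u0.
  by rewrite u0 u0'; split=> _; apply: vdivx0.
have [t0|t0] := eqVneq (peval (scons y e) t) 0.
  have /eqP t0' : peval (scons y' e') t == 0 by rewrite -eq0E // t0.
  rewrite t0 t0' !vdiv0x; split=> /eqP; first by rewrite (negPf u0).
  by rewrite -eq0E // (negPf u0).
have [w wC [m0 tw tw' c0 c0']] := value t tL t0.
have [w' wC' [m0' uw uw' d0 d0']] := value u uL u0.
have red (S1 : vrcf) (e1 : nat -> S1) (x z : S1) :
    vequiv (x ^+ w.1.2 * peval e1 w.1.1.1) (peval e1 w.1.1.2) ->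
    vequiv (z ^+ w'.1.2 * peval e1 w'.1.1.1) (peval e1 w'.1.1.2) ->
    peval e1 w.1.1.1 != 0 -> peval e1 w'.1.1.1 != 0 ->
    vdiv x z <-> vdiv (peval e1 (val w w')) (peval e1 (val w' w)).
  case: w w' {wC wC' tw tw' uw uw' c0 c0' d0 d0'} m0 m0' =>
    [[[c d] m] N] [[[c' d'] m'] N'] /= m0 m0'.
  move=> xw zw c0 c0'; rewrite !peval_pexp.
  rewrite -(vdiv_exp _ _ (_ : 0 < m * m')%N) ?muln_gt0 ?m0 //.
  rewrite -(vdiv_mul2r _ _ (_ : peval e1 c ^+ m' * peval e1 c' ^+ m != 0)) ?mulf_neq0 ?expf_neq0 //.
  apply: vdiv_equiv.
    rewrite mulrA exprM -exprMn; apply: vequiv_mul (vequiv_refl _).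
    exact: vequiv_exp.
  rewrite [_ * peval e1 c' ^+ m]mulrC mulrA mulnC exprM -exprMn.
  by apply: vequiv_mul (vequiv_refl _); apply: vequiv_exp.
rewrite (red _ e _ _ tw uw) // (red _ e' _ _ tw' uw') //; apply: dv.
  by apply/allpairsP; exists (w, w').
by apply/allpairsP; exists (w', w).
Qed.

(** * Dominant monomials *)

(** Coefficients arise from values by the inverse Vandermonde matrix. Rational nodes give it
    rational entries, so one natural number bounds it in all fields. *)
Lemma interpolation_bound (n : nat) (x : 'I_n -> rat) : injective x ->
  exists C : nat, forall (K : rcfType) (p : {poly K}) (M : K), (size p <= n)%N -> 0 <= M ->
    (forall i, `|p.[ratr (x i)]| <= M) -> forall k, `|p`_k| <= C%:R * M.
Proof.
move=> xinj; pose V := Vandermonde n (\row_i x i).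
have Vunit : V \in unitmx.
  rewrite unitmxE unitfE det_Vandermonde; apply/prodf_neq0 => i _.
  apply/prodf_neq0 => j ij; rewrite !mxE subr_eq0 (inj_eq xinj).
  by apply: contraTneq ij => ->; rewrite ltnn.
pose W := invmx V; pose s : rat := \sum_i \sum_k `|W i k|.
have s0 : 0 <= s by do 2!apply: sumr_ge0 => ? _.
exists (Num.bound s) => K p M szp M0 pM k.
have [kn|nk] := ltnP k n; last first.
  by rewrite nth_default ?(leq_trans szp) // normr0 mulr_ge0 ?ler0n.
pose c := \row_(i < n) p`_i; pose v := \row_(i < n) p.[ratr (x i)].
have cV : c *m map_mx ratr V = v.
  apply/rowP => j; rewrite !mxE (horner_coef_wide _ szp); apply: eq_bigr => i _.
  by rewrite !mxE rmorphXn.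
have -> : p`_k = (v *m map_mx ratr W) 0 (Ordinal kn).
  by rewrite -cV -mulmxA -map_mxM mulmxV // map_mx1 mulmx1 mxE.
rewrite mxE; apply: (le_trans (ler_norm_sum _ _ _)).
apply: le_trans (_ : ratr s * M <= _); last first.
  by rewrite ler_wpM2r // -(ratr_nat K) ler_rat ltW // archi_boundP.
rewrite rmorph_sum mulr_suml ler_sum //= => i _.
rewrite !mxE normrM mulrC ler_pM // -ratr_norm ler_rat.
by rewrite (bigD1 (Ordinal kn)) //= lerDl sumr_ge0.
Qed.

(** The derivative [2 p p'] of [p^2] has constant sign between 0 and 2, so [|p|] is monotone
    there. *)
Lemma norm_monotone_near1 (K : rcfType) (p : {poly K}) :
  (forall z, `|z - 1| < 1 -> p != 0 -> ~~ root p z) ->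
  (forall z, `|z - 1| < 1 -> p^`() != 0 -> ~~ root p^`() z) ->
  (forall z, 0 < z < 1 -> `|p.[z]| <= `|p.[1]|) \/
  (forall z, 1 < z < 2 -> `|p.[z]| <= `|p.[1]|).
Proof.
move=> rp rp'; pose f := p * p; pose g := p * p^`().
have f' : f^`() = g + g by rewrite /f derivM mulrC.
have gcst : {in `]0, 2[ &, forall y x, Num.sg g.[x] = Num.sg g.[y]}.
  have [->|g0] := eqVneq g 0; first by move=> x y _ _; rewrite !horner0.
  apply: polyrN0_itv => z; rewrite in_itv /= => /andP[z0 z2].
  move: g0; rewrite mulf_eq0 negb_or => /andP[p0 p'0].
  rewrite rootM negb_or rp ?rp' //; rewrite ltr_distl subrr z0 /=; lra.
have in1 : (1 : K) \in `]0, 2[ by rewrite in_itv /= ltr01 ltr1n.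
have reduce z : f.[z] <= f.[1] -> `|p.[z]| <= `|p.[1]|.
  by rewrite /f !hornerM -!expr2 -(real_normK (num_real p.[z])) -(real_normK (num_real p.[1]))
    ler_sqr ?nnegrE.
have [g1|g1] := lerP 0 g.[1]; [left|right] => z /andP[z0 z1]; apply: reduce.
  have [c] := poly_mvt f z1; rewrite in_itv /= => /andP[zc c1].
  rewrite f' -subr_ge0 => ->; rewrite mulr_ge0 ?subr_ge0 ?(ltW z1) // hornerD.
  have : 0 <= g.[c] by rewrite -sgr_ge0 (gcst 1) ?sgr_ge0 // in_itv /=; lra.
  lra.
have [c] := poly_mvt f z0; rewrite in_itv /= => /andP[zc c1].
rewrite f' -subr_le0 => ->; rewrite mulr_le0_ge0 ?subr_ge0 ?(ltW z0) // hornerD.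
have : g.[c] < 0 by rewrite -sgr_lt0 (gcst 1) ?sgr_lt0 // in_itv /=; lra.
lra.
Qed.

(** The nodes [(i + 1) / (n + 1)] lie left of 1, their reflections [2 - x] lie right of it. By
    monotonicity [|p(1)|] bounds the values at one of the two families; the sum of the two constants
    covers both cases. *)
Lemma coef_bound_near1 (n : nat) :
  exists C : nat, forall (K : rcfType) (p : {poly K}), (size p <= n)%N ->
  (forall z, `|z - 1| < 1 -> p != 0 -> ~~ root p z) ->
  (forall z, `|z - 1| < 1 -> p^`() != 0 -> ~~ root p^`() z) ->
  forall k, `|p`_k| <= C%:R * `|p.[1]|.
Proof.
pose x (i : 'I_n) : rat := i.+1%:R / n.+1%:R.
have n1 : 0 < n.+1%:R :> rat by rewrite ltr0n.
have xinj : injective x.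
  move=> i j /(mulIf (invr_neq0 (lt0r_neq0 n1)))/eqP; rewrite eqr_nat => /eqP[].
  exact: ord_inj.
have x01 i : 0 < x i < 1.
  by rewrite divr_gt0 ?ltr0n //= ltr_pdivrMr // mul1r ltr_nat ltnS.
have [C CP] := interpolation_bound xinj.
pose y i := 2 - x i.
have [|D DP] := @interpolation_bound n y; first by move=> i j /addrI/oppr_inj/xinj.
exists (C + D)%N => K p szp rp rp' k; rewrite natrD mulrDl.
have r01 i : 0 < (ratr (x i) : K) < 1.
  by have := x01 i; rewrite -[0 < x i](ltr_rat K) -[x i < 1](ltr_rat K) rmorph0 rmorph1.
have [le|le] := norm_monotone_near1 rp rp'.
  by rewrite (le_trans (CP K p `|p.[1]| szp (normr_ge0 _) _ k)) ?lerDl ?mulr_ge0 ?ler0n // =>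
    i; apply: le.
rewrite (le_trans (DP K p `|p.[1]| szp (normr_ge0 _) _ k)) ?lerDr ?mulr_ge0 ?ler0n // => i;
  apply: le.
by rewrite /y rmorphB rmorph_nat; have := r01 i; lra.
Qed.

Lemma comp_poly_scale (R : comNzRingType) (p : {poly R}) (h : R) :
  p \Po (h *: 'X) = \poly_(i < size p) (p`_i * h ^+ i).
Proof. by rewrite comp_polyE poly_def; apply: eq_bigr => i _; rewrite exprZn scalerA. Qed.

(* If [p] and [p'] have no root closer to [h] than [0], the size of [p(h)] is
   that of the largest term of [p] at [h], up to a factor depending only on the degree. *)
Lemma dominant_monomial (n : nat) :
  exists C : nat, forall (K : rcfType) (p : {poly K}) (h : K), (size p <= n.+1)%N -> h != 0 ->
  (forall z, `|z - h| < `|h| -> p != 0 -> ~~ root p z) ->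
  (forall z, `|z - h| < `|h| -> p^`() != 0 -> ~~ root p^`() z) ->
  exists k, [/\ (k <= n)%N, `|p.[h]| <= C%:R * `|p`_k * h ^+ k| &
    `|p`_k * h ^+ k| <= C%:R * `|p.[h]|].
Proof.
have [C CP] := coef_bound_near1 n.+1.
(* [n.+1] terms are each at most the largest one, and [C] bounds the largest term by [p(h)]. *)
exists (n.+1 + C)%N => K p h szp h0 rp rp'.
pose F (i : 'I_n.+1) := `|p`_i * h ^+ i|.
have [k _ kmax] := @arg_maxP _ K _ ord0 predT F isT.
exists k; rewrite -ltnS ltn_ord; split=> //.
  rewrite (horner_coef_wide _ szp) (le_trans (ler_norm_sum _ _ _)) //.
  apply: le_trans (_ : \sum_(i < n.+1) F k <= _); first by apply: ler_sum => i _; apply: kmax.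
  rewrite sumr_const card_ord -[X in X <= _]mulr_natl ler_wpM2r ?normr_ge0 //.
  by rewrite ler_nat leq_addr.
(* Rescaling moves [h] to 1 and the root-free interval to [|z - 1| < 1]. *)
pose q := p \Po (h *: 'X).
have qE z : q.[z] = p.[h * z] by rewrite horner_comp hornerZ hornerX.
have q0 : q != 0 -> p != 0 by apply: contra_neq => p0; rewrite /q p0 comp_poly0.
have q'E : q^`() = h *: (p^`() \Po (h *: 'X)).
  by rewrite deriv_comp derivZ derivX alg_polyC mulrC mul_polyC.
have q'0 : q^`() != 0 -> p^`() != 0.
  by apply: contra_neq => p0; rewrite q'E p0 comp_poly0 scaler0.
have near z : `|z - 1| < 1 -> `|h * z - h| < `|h|.
  by rewrite -{2}[h]mulr1 -mulrBr normrM gtr_pMr ?normr_gt0.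
have szq : (size q <= n.+1)%N by rewrite /q comp_poly_scale (leq_trans (size_poly _ _)).
have -> : p`_k * h ^+ k = q`_k.
  rewrite /q comp_poly_scale coef_poly; case: ltnP => // le.
  by rewrite nth_default ?mul0r.
have -> : p.[h] = q.[1] by rewrite qE mulr1.
apply: le_trans (CP K q szq _ _ k) _.
- by move=> z /near zh /q0 p0; rewrite rootE qE -rootE rp.
- move=> z /near zh /q'0 p0; rewrite rootE q'E hornerZ mulf_eq0 (negPf h0) /=.
  by rewrite horner_comp hornerZ hornerX -rootE rp'.
- by rewrite ler_wpM2r // ler_nat leq_addl.
Qed.

(** * Gaps between algebraic elements *)

Lemma agree_back_forth_roots (L Q : seq pterm) :
  exists L', {in Q, forall q (S S' : vrcf) (e : nat -> S) (e' : nat -> S'), agree L' e e' ->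
    forall y, tpoly q e != 0 -> peval (scons y e) q = 0 ->
    exists y', agree L (scons y e) (scons y' e')}.
Proof.
apply: seq_finite_choice => [q s s' H S S' e e'|q s s' H S S' e e'|q _].
- by move=> /agree_cat[/H].
- by move=> /agree_cat[_ /H].
- exact: agree_back_forth_root.
Qed.

Lemma exists_root_pow (K : rcfType) (c : K) m : (0 < m)%N -> 0 < c ->
  exists2 g, 0 < g & g ^+ m = c.
Proof.
move=> m0 c0; have [||g /andP[g0 _]] := @poly_ivt K ('X^m - c%:P) 0 (1 + c).
- by rewrite addr_ge0 ?ltW.
- rewrite !hornerE expr0n eqn0Ngt m0 /= sub0r oppr_le0 (ltW c0) /=.
  rewrite subr_ge0 (le_trans (_ : c <= 1 + c)) ?lerDr // ler_eXnr //.
  by rewrite lerDl ltW.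
rewrite rootE !hornerE subr_eq0 => /eqP gm; exists g => //.
rewrite lt_neqAle g0 andbT; apply: contraTneq c0 => /esym g_eq0.
by rewrite -gm g_eq0 expr0n eqn0Ngt m0 ltxx.
Qed.

Section Gaps.

Variable S : vrcf.
Implicit Types a b g h s t x : S.

Lemma vdiv_pow_below s h a b m : ~ vdiv s h -> (0 < m)%N -> b != 0 -> vdiv (a * s ^+ m) b ->
  vdiv (a * h ^+ m) b /\ ~ vdiv b (a * h ^+ m).
Proof.
move=> nsh m0 b0 sb; have [//|hs] := vdiv_total s h; split.
  apply: vdiv_trans sb; apply: vdiv_mul (vdiv_refl a) _.
  by rewrite vdiv_exp.
move=> /(vdiv_trans sb); have [a0|a0] := eqVneq a 0.
  by move: sb; rewrite a0 mul0r vdiv0x => /eqP; rewrite (negPf b0).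
by rewrite vdiv_mul2l // vdiv_exp.
Qed.

Lemma vdiv_pow_above t h a b m : ~ vdiv h t -> (0 < m)%N -> a != 0 -> vdiv b (a * t ^+ m) ->
  vdiv b (a * h ^+ m) /\ ~ vdiv (a * h ^+ m) b.
Proof.
move=> nht m0 a0 bt; have [//|th] := vdiv_total h t; split.
  apply: vdiv_trans bt _; apply: vdiv_mul (vdiv_refl a) _.
  by rewrite vdiv_exp.
by move=> hb; have := vdiv_trans hb bt; rewrite vdiv_mul2l // vdiv_exp.
Qed.


Lemma exists_huge : exists2 x : S, 1 < x & ~ vint x.
Proof.
have [x nx] := @vint_proper S; exists `|x|.
  rewrite ltNge; apply/negP => x1; apply: nx.
  by apply: (@vint_convex S x 1) (vint1 S) _; rewrite normr1.
by move=> nx'; apply: nx; apply: vint_convex nx' _; rewrite normr_id.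
Qed.

(** The geometric mean has the average value. For [s = 0], whose value is infinite, [t] is divided
    by an element greater than 1 outside the subring. *)
Lemma exists_vdiv_between s t : 0 <= s -> s < t -> ~ vdiv s t ->
  exists h, [/\ s < h < t, ~ vdiv s h & ~ vdiv h t].
Proof.
move=> s0 st nst; have t0 : 0 < t := le_lt_trans s0 st.
suff [h h0 [nsh nht]] : exists2 h, 0 < h & ~ vdiv s h /\ ~ vdiv h t.
  exists h; split=> //; have := vdivN_norm nsh; have := vdivN_norm nht.
  by rewrite (gtr0_norm h0) (gtr0_norm t0) (ger0_norm s0) => -> ->.
have [s_eq0|s_neq0] := eqVneq s 0.
  have [x x1 nx] := exists_huge; have x0 : 0 < x := lt_trans ltr01 x1.
  exists (t / x); first exact: divr_gt0.
  split; first by rewrite s_eq0 vdiv0x => /eqP; rewrite gt_eqF ?divr_gt0.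
  move=> [z Oz e]; apply: nx; suff -> : x = z by [].
  by apply: (mulfI (lt0r_neq0 t0)); rewrite [in LHS]e mulrAC divfK ?gt_eqF.
have s_gt0 : 0 < s by rewrite lt_neqAle eq_sym s_neq0.
exists (Num.sqrt (s * t)); first by rewrite sqrtr_gt0 mulr_gt0.
have sq : Num.sqrt (s * t) ^+ 2 = s * t by rewrite sqr_sqrtr // mulr_ge0 // ltW.
split=> h; apply: nst.
  by move: h; rewrite -(@vdiv_exp _ 2) // sq expr2 vdiv_mul2l.
by move: h; rewrite -(@vdiv_exp _ 2) // sq expr2 vdiv_mul2r ?gt_eqF.
Qed.

Lemma exists_vdiv_above s : 0 <= s -> exists2 h, s < h & ~ vdiv s h.
Proof.
move=> s0; suff [h h0 nsh] : exists2 h, 0 < h & ~ vdiv s h.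
  exists h => //; have := vdivN_norm nsh.
  by rewrite (gtr0_norm h0) (ger0_norm s0).
have [->|s_neq0] := eqVneq s 0.
  by exists 1 => //; rewrite vdiv0x; apply/eqP; rewrite oner_eq0.
have [x x1 nx] := exists_huge; have x0 : 0 < x := lt_trans ltr01 x1.
have s_gt0 : 0 < s by rewrite lt_neqAle eq_sym s_neq0.
exists (s * x); first exact: mulr_gt0.
by move=> [z Oz /(mulfI s_neq0) e]; apply: nx; rewrite e.
Qed.

(** The threshold [g], the positive m-th root of [|b / a|], is where [a g^m] and [b] have equal
    absolute value; the squared equation makes it algebraic whatever the signs. [P] is the
    alternative to lying at or below [s]: beyond a gap, or empty for a ray. *)
Lemma vdiv_pow_neighbour a b m s (P : S -> Prop) : (0 < m)%N -> a != 0 -> b != 0 ->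
  (forall g, 0 < g -> a ^+ 2 * g ^+ (2 * m) = b ^+ 2 -> g <= s \/ P g) -> 0 <= s ->
  vdiv (a * s ^+ m) b \/ exists2 g, P g & vequiv b (a * g ^+ m).
Proof.
move=> m0 a0 b0 ng s0.
have [|g g0 gm] := @exists_root_pow S (`|b| / `|a|) m m0; first by rewrite divr_gt0 ?normr_gt0.
have bg : `|b| = `|a * g ^+ m| by rewrite normrM gm normf_div !normr_id mulrC divfK // normr_eq0.
have eqv : vequiv b (a * g ^+ m) by split; apply: vdiv_norm; rewrite bg.
have [|gs|Pg] := ng g g0; last by right; exists g.
- rewrite mulnC exprM -exprMn; apply/eqP.
  by rewrite -(real_normK (num_real b)) bg real_normK ?num_real.
left; apply: vdiv_trans eqv.2; apply: vdiv_mul (vdiv_refl a) _.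
by rewrite vdiv_exp //; apply: vdiv_norm; rewrite !ger0_norm // ltW.
Qed.

End Gaps.

(* [h] lies so far above [s] that the value of [s] decides all comparisons of
   nonzero monomials in [h]. *)
Definition far_above (S : vrcf) (A : seq pterm) (N : nat) (e : nat -> S) (s h : S) : Prop :=
  {in A &, forall a b m, (0 < m <= N)%N -> peval e a != 0 -> peval e b != 0 ->
    (vdiv (peval e a * h ^+ m) (peval e b) <-> vdiv (peval e a * s ^+ m) (peval e b)) /\
    (vdiv (peval e b) (peval e a * h ^+ m) <-> ~ vdiv (peval e a * s ^+ m) (peval e b))}.

Definition monomials_agree (A : seq pterm) (N : nat) (S S' : vrcf)
    (e : nat -> S) (e' : nat -> S') (h : S) (h' : S') : Prop :=
  {in A &, forall a b k l, (k <= N)%N -> (l <= N)%N ->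
    vdiv (peval e a * h ^+ k) (peval e b * h ^+ l) <->
    vdiv (peval e' a * h' ^+ k) (peval e' b * h' ^+ l)}.

Lemma monomials_agree_equiv (A : seq pterm) (N : nat) (S S' : vrcf)
    (e : nat -> S) (e' : nat -> S') (x h : S) (x' h' : S') :
  vequiv x h -> vequiv x' h' -> monomials_agree A N e e' x x' -> monomials_agree A N e e' h h'.
Proof.
move=> xh xh' xx a b aA bA k l kN lN.
have red (S1 : vrcf) (e1 : nat -> S1) (u v : S1) : vequiv u v ->
    vdiv (peval e1 a * u ^+ k) (peval e1 b * u ^+ l) <->
    vdiv (peval e1 a * v ^+ k) (peval e1 b * v ^+ l).
  by move=> uv; apply: vdiv_equiv; apply: vequiv_mul (vequiv_refl _) (vequiv_exp _ uv).
by rewrite -(red _ _ _ _ xh) -(red _ _ _ _ xh'); apply: xx.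
Qed.

(** Cancelling the common power of [h] leaves a comparison of two coefficients or one covered by
    [far_above]; both are decided at [s]. *)
Lemma monomials_agree_far (A : seq pterm) (N : nat) (S S' : vrcf)
    (e : nat -> S) (e' : nat -> S') (s h : S) (s' h' : S') :
  h != 0 -> h' != 0 -> far_above A N e s h -> far_above A N e' s' h' ->
  {in A, forall a, (peval e a == 0) = (peval e' a == 0)} ->
  monomials_agree A N e e' s s' -> monomials_agree A N e e' h h'.
Proof.
move=> h0 h0' far far' eq0 ss a b aA bA k l kN lN.
have [b0|b0] := eqVneq (peval e b) 0.
  have /eqP-> : peval e' b == 0 by rewrite -eq0 ?b0.
  by rewrite b0 !mul0r; split=> _; apply: vdivx0.
have b0' : peval e' b != 0 by rewrite -eq0.
have [a0|a0] := eqVneq (peval e a) 0.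
  have /eqP-> : peval e' a == 0 by rewrite -eq0 ?a0.
  by rewrite a0 !mul0r !vdiv0x; split=> /eqP;
    rewrite mulf_eq0 expf_eq0 ?(negPf b0) ?(negPf b0') ?(negPf h0) ?(negPf h0') andbF.
have a0' : peval e' a != 0 by rewrite -eq0.
have low m c d : c \in A -> d \in A -> (m <= N)%N -> 
    vdiv (peval e c * s ^+ m) (peval e d) <-> vdiv (peval e' c * s' ^+ m) (peval e' d).
  by move=> cA dA mN; have := ss c d cA dA m 0%N mN isT; rewrite !expr0 !mulr1.
case: (ltngtP k l) => [kl|lk|->]; last first.
- rewrite !vdiv_mul2r ?expf_neq0 //.
  by have := low 0%N a b aA bA isT; rewrite !expr0 !mulr1.
- have mN : (0 < k - l <= N)%N by rewrite subn_gt0 lk (leq_trans (leq_subr _ _)).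
  rewrite -(subnK (ltnW lk)) !exprD !mulrA !vdiv_mul2r ?expf_neq0 //.
  have [-> _] := far a b aA bA _ mN a0 b0; have [-> _] := far' a b aA bA _ mN a0' b0'.
  by apply: low => //; case/andP: mN.
- have mN : (0 < l - k <= N)%N by rewrite subn_gt0 kl (leq_trans (leq_subr _ _)).
  rewrite -(subnK (ltnW kl)) !exprD !mulrA !vdiv_mul2r ?expf_neq0 //.
  have [_ ->] := far b a bA aA _ mN b0 a0; have [_ ->] := far' b a bA aA _ mN b0' a0'.
  by rewrite low //; case/andP: mN.
Qed.

(** * Transfer of an element lying between consecutive algebraic elements *)

Definition skip1 (t : pterm) : pterm := pren (fun i => if i is j.+1 then j.+2 else 0%N) t.

Lemma peval_skip1 (R : nzRingType) (e : nat -> R) z x t :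
  peval (scons z (scons x e)) (skip1 t) = peval (scons z e) t.
Proof. by rewrite peval_pren; apply: eq_peval => -[]. Qed.

Lemma tpoly_skip1 (K : rcfType) (e : nat -> K) x t : tpoly (skip1 t) (scons x e) = tpoly t e.
Proof. by rewrite /tpoly peval_pren; apply: eq_peval => -[]. Qed.

Definition monomials (A : seq pterm) (N : nat) (x : pterm) : seq pterm :=
  [seq PMul a (pexp x k) | a <- A, k <- iota 0 N.+1].

Lemma mem_monomials A N x a k : a \in A -> (k <= N)%N ->
  PMul a (pexp x k) \in monomials A N x.
Proof.
by move=> aA kN; apply/allpairsP; exists (a, k); rewrite mem_iota add0n ltnS.
Qed.

Lemma agree_monomials A N x (S S' : vrcf) (e : nat -> S) (e' : nat -> S') :
  agree (monomials A N x) e e' -> monomials_agree A N e e' (peval e x) (peval e' x).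
Proof.
move=> [_ dv] a b aA bA k l kN lN.
by have := dv _ _ (mem_monomials x aA kN) (mem_monomials x bA lN); rewrite /= !peval_pexp.
Qed.

Lemma monomials_agree_lift A N (S S' : vrcf) (e : nat -> S) (e' : nat -> S') y y' h h' :
  monomials_agree (map (pren succn) A) N (scons y e) (scons y' e') h h' ->
  monomials_agree A N e e' h h'.
Proof.
move=> ag a b aA bA k l kN lN.
by have := ag _ _ (map_f _ aA) (map_f _ bA) k l kN lN; rewrite !peval_lift.
Qed.

Lemma agree_sign1 L (S S' : vrcf) (e : nat -> S) (e' : nat -> S') t :
  agree L e e' -> t \in L -> sgz (peval e t) = sgz (peval e' t).
Proof. by case=> sg _; apply: sg. Qed.

Lemma sgz_noroot (K : rcfType) (i : interval K) (p : {poly K}) :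
  {in i, forall z, p != 0 -> ~~ root p z} ->
  {in i &, forall x y, sgz p.[x] = sgz p.[y]}.
Proof.
move=> rp x y xi yi; have [->|p0] := eqVneq p 0; first by rewrite !horner0.
rewrite -[LHS]sgz_sgr -[RHS]sgz_sgr; congr sgz; apply: (@polyrN0_itv _ i) => // z zi.
exact: rp.
Qed.

(** Every [h'] between [s'] and [t'] has the right signs, so only its value must be chosen: that of
    [s'], that of [t'], or one strictly between, as for [h]. In the last case all thresholds lie
    outside the gap and every comparison of monomials is forced. *)
Lemma gap_transfer (M A : seq pterm) (N : nat) :
  exists L, forall (S S' : vrcf) (e : nat -> S) (e' : nat -> S') s t s' t',
  agree L (scons s (scons t e)) (scons s' (scons t' e')) ->
  forall h, 0 <= s -> s < h < t ->
  {in M, forall m z, s < z < t -> tpoly m e != 0 -> ~~ root (tpoly m e) z} ->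
  {in A &, forall a b m, (0 < m <= N)%N -> peval e a != 0 -> peval e b != 0 ->
    forall g, 0 < g -> peval e a ^+ 2 * g ^+ (2 * m) = peval e b ^+ 2 -> g <= s \/ t <= g} ->
  exists h', sign_agree M (scons h e) (scons h' e') /\ monomials_agree A N e e' h h'.
Proof.
pose A2 := [seq pren succn (pren succn a) | a <- A].
have [R RP] := sign_back_forth ([seq skip1 (skip1 m) | m <- M]
  ++ [:: PAdd (PVar 0) (POpp (PVar 1)); PAdd (PVar 2) (POpp (PVar 0))]).
pose base := [:: PVar 0; PVar 1; PAdd (PVar 1) (POpp (PVar 0))] ++ A2.
exists (R ++ base ++ monomials A2 N (PVar 0) ++ monomials A2 N (PVar 1)
  ++ (monomials A2 N (PVar 0) ++ monomials A2 N (PVar 1) ++ base)).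
move=> S S' e e' s t s' t' /agree_cat[[agR _]].
move=> /agree_cat[agb /agree_cat[ags /agree_cat[agt agst]]] h s0 /andP[sh ht] noroot ng.
have st := lt_trans sh ht.
have h0 : 0 < h := le_lt_trans s0 sh; have t0 := lt_trans h0 ht.
have s0' : 0 <= s'.
  by rewrite -(sgz_eq_ge0 (agree_sign1 (t := PVar 0) agb _)) // mem_head.
have st' : s' < t'.
  rewrite -subr_gt0 -(sgz_eq_gt0 (agree_sign1 (t := PAdd (PVar 1) (POpp (PVar 0))) agb _))
    ?subr_gt0 //.
  by rewrite !inE eqxx !orbT.
have monos : monomials_agree A N e e' s s'.
  have := agree_monomials ags; rewrite /A2 map_comp.
  by move=> /monomials_agree_lift/monomials_agree_lift.
have monot : monomials_agree A N e e' t t'.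
  have := agree_monomials agt; rewrite /A2 map_comp.
  by move=> /monomials_agree_lift/monomials_agree_lift.
(* [h'] is carried back to some [z] between [s] and [t], where no polynomial of [M] changes sign. *)
have signs h' : s' < h' < t' -> sign_agree M (scons h e) (scons h' e').
  move=> /andP[sh' ht'].
  have [z zz] := RP S' S _ _ (sign_agree_sym agR) h'.
  have /andP[sz zt] : s < z < t.
    rewrite -subr_gt0 -[z < t]subr_gt0.
    have z1 := zz (PAdd (PVar 0) (POpp (PVar 1))).
    have z2 := zz (PAdd (PVar 2) (POpp (PVar 0))).
    rewrite !mem_cat !inE !eqxx !orbT in z1 z2.
    rewrite -(sgz_eq_gt0 (z1 isT)) -(sgz_eq_gt0 (z2 isT)) /= !subr_gt0.
    by rewrite sh' ht'.
  move=> m mM; have := zz (skip1 (skip1 m));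
    rewrite mem_cat (map_f (fun m => skip1 (skip1 m)) mM) !peval_skip1 => /(_ isT) ->.
  rewrite -!horner_tpoly; apply: (@sgz_noroot _ `]s, t[); rewrite ?in_itv /= ?sh ?sz //.
  by move=> x; rewrite in_itv /= => /(noroot m mM).
have [hs|nsh] := classic (vdiv s h).
  have s_gt0 : 0 < s.
    by rewrite lt_neqAle s0 andbT; apply: contraPneq hs => <-; rewrite vdiv0x => /eqP;
      rewrite gt_eqF.
  have s_gt0' : 0 < s'.
    by rewrite -(sgz_eq_gt0 (agree_sign1 (t := PVar 0) agb _)) // mem_head.
  (* Within a factor 2 of [s'], hence of the same value, and still below [t']. *)
  exists (Num.min (2 * s') ((s' + t') / 2)).
  have bnd : s' < Num.min (2 * s') ((s' + t') / 2) <= 2 * s' /\ Num.min (2 * s') ((s' + t') /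
    2) < t'.
    rewrite lt_min ge_min gt_min lexx /= andbT; split; first by apply/andP; split; lra.
    by apply/orP; right; lra.
  move: bnd; set h' := Num.min _ _ => -[/andP[lo hi] hi'].
  split; first by apply: signs; rewrite lo.
  apply: (monomials_agree_equiv (x := s) (x' := s')) monos.
    by split=> //; apply: vdiv_norm; rewrite !ger0_norm // ltW.
  apply: (@vequiv_bounds _ 1 2); rewrite !gtr0_norm ?(lt_trans s_gt0' lo) // ?mul1r //.
  exact: ltW.
have [th|nht] := classic (vdiv h t).
  (* As [s'] is nonnegative, the midpoint is at least half of [t'] and has its value. *)
  exists ((s' + t') / 2); split; first by apply: signs; apply/andP; split; lra.
  apply: (monomials_agree_equiv (x := t) (x' := t')) monot.
    by split=> //; apply: vdiv_norm; rewrite !ger0_norm // ltW.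
  by apply: (@vequiv_bounds _ 2 1); rewrite !ger0_norm; lra.
have nst : ~ vdiv s t.
  move=> h_st; apply: nsh; apply: vdiv_trans h_st _; apply: vdiv_norm.
  by rewrite !gtr0_norm // ltW.
have nst' : ~ vdiv s' t'.
  have [_ dv] := agb; have := dv (PVar 0) (PVar 1); rewrite !inE !eqxx !orbT => /(_ isT isT) /= <-.
  exact: nst.
have [h' [sht' nsh' nht']] := exists_vdiv_between s0' st' nst'.
exists h'; split; first exact: signs.
have eq0 : {in A, forall a, (peval e a == 0) = (peval e' a == 0)}.
  move=> a aA; have := agree_sign1 (t := pren succn (pren succn a)) agb.
  rewrite mem_cat (map_f (fun a => pren succn (pren succn a)) aA) orbT !peval_lift => /(_ isT).
  exact: sgz_eq_eq0.
have far_of (S1 : vrcf) (e1 : nat -> S1) s1 t1 h1 :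
    ~ vdiv s1 h1 -> ~ vdiv h1 t1 ->
    {in A &, forall a b m, (0 < m <= N)%N -> peval e1 a != 0 -> peval e1 b != 0 ->
      vdiv (peval e1 a * s1 ^+ m) (peval e1 b) \/ vdiv (peval e1 b) (peval e1 a * t1 ^+ m)} ->
    far_above A N e1 s1 h1.
  move=> sh1 ht1 near a b aA bA m /[dup] mN /andP[m0 _] a0 b0.
  have below := vdiv_pow_below sh1 m0 b0.
  have above := vdiv_pow_above ht1 m0 a0.
  have [sb|sb] := classic (vdiv (peval e1 a * s1 ^+ m) (peval e1 b)).
    by have [] := below _ sb.
  by have [/sb//|/above[]] := near a b aA bA m mN a0 b0.
(* The threshold for [a] and [b] is at most [s] or at least [t], so one of the two ends already
   decides the comparison. *)
have near : {in A &, forall a b m, (0 < m <= N)%N -> peval e a != 0 -> peval e b != 0 ->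
      vdiv (peval e a * s ^+ m) (peval e b) \/ vdiv (peval e b) (peval e a * t ^+ m)}.
  move=> a b aA bA m /[dup] mN /andP[m0 _] a0 b0.
  have [|[g tg bg]] := vdiv_pow_neighbour m0 a0 b0 (ng a b aA bA m mN a0 b0) s0; first by left.
  right; apply: vdiv_trans bg.1 _; apply: vdiv_mul (vdiv_refl _) _.
  rewrite vdiv_exp //; apply: vdiv_norm; rewrite !ger0_norm // ?(ltW t0) //.
  exact: le_trans (ltW t0) tg.
apply: (monomials_agree_far (s := s) (s' := s')) => //.
- by rewrite gt_eqF.
- by case/andP: sht' => /(le_lt_trans s0') h0' _; rewrite gt_eqF.
- exact: (far_of _ _ _ t).
apply: (far_of _ _ _ t') => // a b aA bA m /[dup] mN /andP[_ mN'] a0 b0.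
have a0' : peval e a != 0 by rewrite eq0.
have b0' : peval e b != 0 by rewrite eq0.
have := near a b aA bA m mN a0' b0'.
have aA2 : pren succn (pren succn a) \in A2 by apply: (map_f (fun a => pren succn (pren succn a))).
have bA2 : pren succn (pren succn b) \in A2 by apply: (map_f (fun a => pren succn (pren succn a))).
have [_ dv] := agst.
have := dv _ (pren succn (pren succn b)) (_ : PMul (pren succn (pren succn a)) (pexp (PVar 0)
  m) \in _).
rewrite /= !peval_pexp !peval_lift => <-.
have := dv (pren succn (pren succn b)) _ _ (_ : PMul (pren succn (pren succn a)) (pexp (PVar 1)
  m) \in _).
rewrite /= !peval_pexp !peval_lift => <- //.
all: rewrite 2?mem_cat ?mem_monomials ?orbT //.
all: by rewrite !mem_cat bA2 !orbT.
Qed.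

(** With no upper end, all thresholds lie at or below [s], and an element of strictly smaller value
    than [s'] exists because the valuation is nontrivial. *)
Lemma ray_transfer (M A : seq pterm) (N : nat) :
  exists L, forall (S S' : vrcf) (e : nat -> S) (e' : nat -> S') s s',
  agree L (scons s e) (scons s' e') ->
  forall h, 0 <= s -> s < h ->
  {in M, forall m z, s < z -> tpoly m e != 0 -> ~~ root (tpoly m e) z} ->
  {in A &, forall a b m, (0 < m <= N)%N -> peval e a != 0 -> peval e b != 0 ->
    forall g, 0 < g -> peval e a ^+ 2 * g ^+ (2 * m) = peval e b ^+ 2 -> g <= s} ->
  exists h', sign_agree M (scons h e) (scons h' e') /\ monomials_agree A N e e' h h'.
Proof.
pose A1 := map (pren succn) A.
have [R RP] := sign_back_forth (map skip1 M ++ [:: PAdd (PVar 0) (POpp (PVar 1))]).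
pose base := PVar 0 :: A1.
exists (R ++ base ++ monomials A1 N (PVar 0) ++ (monomials A1 N (PVar 0) ++ base)).
move=> S S' e e' s s' /agree_cat[[agR _]].
move=> /agree_cat[agb /agree_cat[ags [_ dv]]] h s0 sh noroot ng.
have h0 : 0 < h := le_lt_trans s0 sh.
have s0' : 0 <= s'.
  by rewrite -(sgz_eq_ge0 (agree_sign1 (t := PVar 0) agb _)) // mem_head.
have monos : monomials_agree A N e e' s s'.
  by have := agree_monomials ags; move=> /monomials_agree_lift.
have signs h' : s' < h' -> sign_agree M (scons h e) (scons h' e').
  move=> sh'; have [z zz] := RP S' S _ _ (sign_agree_sym agR) h'.
  have sz : s < z.
    have z1 := zz (PAdd (PVar 0) (POpp (PVar 1))).
    rewrite !mem_cat !inE !eqxx !orbT in z1.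
    by rewrite -subr_gt0 -(sgz_eq_gt0 (z1 isT)) /= !subr_gt0.
  move=> m mM; have := zz (skip1 m); rewrite mem_cat (map_f skip1 mM) !peval_skip1 => /(_ isT) ->.
  rewrite -!horner_tpoly; apply: (@sgz_noroot _ `]s, +oo[); rewrite ?in_itv /= ?sh ?sz //.
  by move=> x; rewrite in_itv /= andbT => /(noroot m mM).
have [hs|nsh] := classic (vdiv s h).
  have s_gt0 : 0 < s.
    by rewrite lt_neqAle s0 andbT; apply: contraPneq hs => <-; rewrite vdiv0x => /eqP;
      rewrite gt_eqF.
  have s_gt0' : 0 < s'.
    by rewrite -(sgz_eq_gt0 (agree_sign1 (t := PVar 0) agb _)) // mem_head.
  exists (2 * s'); split; first by apply: signs; lra.
  apply: (monomials_agree_equiv (x := s) (x' := s')) monos.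
    by split=> //; apply: vdiv_norm; rewrite !ger0_norm // ltW.
  by apply: (@vequiv_bounds _ 1 2); rewrite !gtr0_norm ?mulr_gt0 //; lra.
have [h' sh' nsh'] := exists_vdiv_above s0'.
exists h'; split; first exact: signs.
have eq0 : {in A, forall a, (peval e a == 0) = (peval e' a == 0)}.
  move=> a aA; have := agree_sign1 (t := pren succn a) agb.
  rewrite in_cons (map_f (pren succn) aA) orbT !peval_lift => /(_ isT).
  exact: sgz_eq_eq0.
have far_of (S1 : vrcf) (e1 : nat -> S1) s1 h1 : ~ vdiv s1 h1 ->
    {in A &, forall a b m, (0 < m <= N)%N -> peval e1 a != 0 -> peval e1 b != 0 ->
      vdiv (peval e1 a * s1 ^+ m) (peval e1 b)} ->
    far_above A N e1 s1 h1.
  move=> sh1 near a b aA bA m /[dup] mN /andP[m0 _] a0 b0.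
  have sb := near a b aA bA m mN a0 b0.
  by have [] := vdiv_pow_below sh1 m0 b0 sb.
have near : {in A &, forall a b m, (0 < m <= N)%N -> peval e a != 0 -> peval e b != 0 ->
      vdiv (peval e a * s ^+ m) (peval e b)}.
  move=> a b aA bA m /[dup] mN /andP[m0 _] a0 b0.
  have [||[g []]] // := vdiv_pow_neighbour (P := fun=> False) m0 a0 b0 _ s0.
  by move=> g g0 gm; left; apply: (ng a b aA bA m).
apply: (monomials_agree_far (s := s) (s' := s')) => //.
- by rewrite gt_eqF.
- by rewrite gt_eqF // (le_lt_trans s0').
- exact: far_of.
apply: far_of => // a b aA bA m /[dup] mN /andP[_ mN'] a0 b0.
have := near a b aA bA m mN; rewrite !eq0 // => /(_ a0 b0).
have aM : PMul (pren succn a) (pexp (PVar 0) m) \in monomials A1 N (PVar 0) ++ base.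
  by rewrite mem_cat mem_monomials // map_f.
have bB : pren succn b \in monomials A1 N (PVar 0) ++ base.
  by rewrite mem_cat /base in_cons map_f ?orbT.
have := dv _ _ aM bB.
by rewrite /= !peval_pexp !peval_lift => <-.
Qed.

Lemma exists_pred (K : rcfType) (s : seq K) h : h \notin s -> (exists2 x, x \in s & x < h) ->
  exists2 x, x \in s & x < h /\ {in s, forall y, y < h -> y <= x}.
Proof.
elim: s => [|a s IHs]; first by move=> _ [].
rewrite in_cons negb_or => /andP[ha hs] [x xas xh].
have [[y ys yh]|no] := classic (exists2 y, y \in s & y < h).
  have [|z zs [zh zmax]] := IHs hs; first by exists y.
  have [az|za] := leP (if a < h then a else z) z.
    exists z; rewrite ?in_cons ?zs ?orbT //; split=> // w; rewrite in_cons => /predU1P[->|/zmax//].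
    by move=> ah; rewrite ah in az.
  move: za; case: ifP => [ah za|_]; last by rewrite ltxx.
  exists a; rewrite ?mem_head //; split=> // w; rewrite in_cons => /predU1P[->//|ws wh].
  exact: le_trans (zmax w ws wh) (ltW za).
exists a; rewrite ?mem_head //; split.
  by move: xas xh; rewrite in_cons => /predU1P[->//|xs xh]; case: no; exists x.
move=> w; rewrite in_cons => /predU1P[->//|ws wh].
by case: no; exists w.
Qed.

Lemma exists_succ (K : rcfType) (s : seq K) h : h \notin s -> (exists2 x, x \in s & h < x) ->
  exists2 x, x \in s & h < x /\ {in s, forall y, h < y -> x <= y}.
Proof.
move=> hs [x xs hx]; have [||y /mapP[z zs ->] [zh zmax]] := @exists_pred K (map -%R s) (- h).
- by rewrite (mem_map oppr_inj).
- by exists (- x); rewrite ?map_f // ltrN2.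
exists z => //; rewrite ltrN2 in zh; split=> // w ws hw.
by rewrite -lerN2; apply: zmax; rewrite ?map_f // ltrN2.
Qed.

(** Critical are 0, the roots of polynomials of [M], and the roots of [a^2 X^(2m) - b^2], where
    monomials change order. If [h] is not critical, its critical neighbours are algebraic and can be
    transferred; they bound a gap or a ray around [h]. *)
Lemma monomial_back_forth_pos (M A : seq pterm) (N : nat) :
  exists L, forall (S S' : vrcf) (e : nat -> S) (e' : nat -> S'), agree L e e' ->
  forall h, 0 < h ->
  exists h', sign_agree M (scons h e) (scons h' e') /\ monomials_agree A N e e' h h'.
Proof.
pose lft := pren succn.
pose gpoly a b m := PAdd (PMul (PMul (lft a) (lft a)) (pexp (PVar 0) (2 * m)))
  (POpp (PMul (lft b) (lft b))).
pose Q := PVar 0 :: M ++ [seq gpoly w.1 w.2 m | w <- [seq (a, b) | a <- A, b <- A], m <- iota 1 N].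
have [Lgap LgapP] := gap_transfer M A N.
have [Lray LrayP] := ray_transfer M A N.
have [La LaP] := agree_back_forth_roots Lgap (map skip1 Q).
have [Lb LbP] := agree_back_forth_roots La Q.
have [Lc LcP] := agree_back_forth_roots Lray Q.
have [Ld LdP] := agree_back_forth_roots (M ++ monomials (map lft A) N (PVar 0)) Q.
exists (Lb ++ Lc ++ Ld) => S S' e e' /agree_cat[agb /agree_cat[agc agd]] h h0.
pose G := flatten [seq rootsR (tpoly q e) | q <- Q & tpoly q e != 0].
have GP x : reflect (exists2 q, q \in Q & tpoly q e != 0 /\ peval (scons x e) q = 0) (x \in G).
  apply: (iffP flattenP) => [[r /mapP[q qf ->] xq]|[q qQ [q0 qx]]].
    move: qf; rewrite mem_filter => /andP[q0 qQ]; exists q => //; split=> //.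
    by move: xq; rewrite -(roots_on_rootsR q0) rootE horner_tpoly => /eqP.
  exists (rootsR (tpoly q e)); first by apply/mapP; exists q; rewrite ?mem_filter ?q0.
  by rewrite -(roots_on_rootsR q0) rootE horner_tpoly qx eqxx.
have [/GP[q qQ [q0 qh]]|hG] := boolP (h \in G).
  have [h' /agree_cat[[sg _] agA]] := LdP q qQ _ _ _ _ agd h q0 qh.
  exists h'; split=> //.
  have := agree_monomials agA; exact: monomials_agree_lift.
have G0 : 0 \in G.
  apply/GP; exists (PVar 0); first exact: mem_head.
  by rewrite /tpoly /= polyX_eq0.
have [|s sG [sh smax]] := exists_pred hG; first by exists 0.
have s0 : 0 <= s := smax 0 G0 h0.
have MQ m : m \in M -> m \in Q by move=> mM; rewrite in_cons mem_cat mM orbT.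
have noroot m z : m \in M -> tpoly m e != 0 -> root (tpoly m e) z -> z \in G.
  move=> mM m0 mz; apply/GP; exists m; rewrite ?MQ //; split=> //.
  by apply/eqP; rewrite -horner_tpoly -rootE.
have gG a b m g : a \in A -> b \in A -> (0 < m <= N)%N -> peval e a != 0 -> peval e b != 0 ->
    peval e a ^+ 2 * g ^+ (2 * m) = peval e b ^+ 2 -> g \in G.
  move=> aA bA mN a0 b0 gm; apply/GP; exists (gpoly a b m).
    rewrite in_cons mem_cat; apply/orP; right; apply/orP; right.
    apply/allpairsP; exists ((a, b), m); rewrite mem_iota add1n ltnS; split=> //.
    by apply/allpairsP; exists (a, b).
  split; last by rewrite /= peval_pexp !peval_lift -!expr2 gm subrr.
  apply: contra_neq b0 => /(congr1 (fun p => p.[0])).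
  rewrite horner0 horner_tpoly /= peval_pexp !peval_lift /= -!expr2 expr0n muln_eq0 /=.
  rewrite eqn0Ngt; case/andP: mN => -> _; rewrite mulr0 sub0r => /eqP.
  by rewrite oppr_eq0 expf_eq0 => /eqP.
have /GP[qs qsQ [qs0 qss]] := sG.
have [tex|nt] := classic (exists2 x, x \in G & h < x).
  have [t tG [ht tmin]] := exists_succ hG tex.
  have /GP[qt qtQ [qt0 qtt]] := tG.
  have [t' agt] := LbP qt qtQ _ _ _ _ agb t qt0 qtt.
  (* [t] has been adjoined before [s] and occupies a variable that the equation of [s] must skip. *)
  have [|s' ags] := LaP (skip1 qs) (map_f _ qsQ) _ _ _ _ agt s _ (etrans (peval_skip1 _ _ _ _) qss).
    by rewrite tpoly_skip1.
  apply: (LgapP _ _ _ _ _ _ _ _ ags) => //; first by rewrite sh.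
    move=> m mM z /andP[sz zt] m0; apply/negP => /(noroot m z mM m0) zG.
    case: (ltgtP z h) => [/(smax z zG)|/(tmin z zG)|zh]; rewrite ?leNgt ?sz ?zt //.
    by rewrite -zh zG in hG.
  move=> a b aA bA m mN a0 b0 g g0 /(gG a b m g aA bA mN a0 b0) gG'.
  case: (ltgtP g h) => [/(smax g gG')|/(tmin g gG')|zh]; [by left|by right|].
  by rewrite -zh gG' in hG.
have [s' ags] := LcP qs qsQ _ _ _ _ agc s qs0 qss.
apply: (LrayP _ _ _ _ _ _ ags) => // [m mM z sz m0|a b aA bA m mN a0 b0 g g0].
  apply/negP => /(noroot m z mM m0) zG.
  case: (ltgtP z h) => [/(smax z zG)|zh|zh]; first by rewrite leNgt sz.
    by apply: nt; exists z.
  by rewrite -zh zG in hG.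
move=> /(gG a b m g aA bA mN a0 b0) gG'.
case: (ltgtP g h) => [/(smax g gG')//|gh|zh]; first by case: nt; exists g.
by rewrite -zh gG' in hG.
Qed.

Fixpoint flip0 (t : pterm) : pterm :=
  match t with
  | PVar 0 => POpp (PVar 0)
  | PVar i => PVar i
  | PNat n => PNat n
  | PAdd u v => PAdd (flip0 u) (flip0 v)
  | POpp u => POpp (flip0 u)
  | PMul u v => PMul (flip0 u) (flip0 v)
  end.

Lemma peval_flip0 (R : nzRingType) (e : nat -> R) x t :
  peval (scons x e) (flip0 t) = peval (scons (- x) e) t.
Proof. by elim: t => [[|i]|n|u IHu v IHv|u IHu|u IHu v IHv] //=; rewrite ?IHu ?IHv. Qed.

(** Values ignore the sign of [h]; for negative [h] the sign conditions are rewritten in terms of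
    [- h]. *)
Lemma monomial_back_forth (M A : seq pterm) (N : nat) :
  exists L, forall (S S' : vrcf) (e : nat -> S) (e' : nat -> S'), agree L e e' ->
  forall h, h != 0 ->
  exists h', sign_agree M (scons h e) (scons h' e') /\ monomials_agree A N e e' h h'.
Proof.
have [L LP] := monomial_back_forth_pos M A N.
have [L' L'P] := monomial_back_forth_pos (map flip0 M) A N.
exists (L ++ L') => S S' e e' /agree_cat[/LP posP /L'P negP'] h h0.
have [h_gt0|] := ltP 0 h; first exact: posP.
rewrite le_eqVlt (negPf h0) /= -oppr_gt0 => /negP'[h' [sg ag]]; exists (- h'); split.
  move=> m mM; rewrite -(opprK h).
  by have := sg _ (map_f flip0 mM); rewrite !peval_flip0.
have eqvN (S1 : vrcf) (x : S1) : vequiv x (- x) by split; apply: vdiv_norm; rewrite normrN.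
by apply: monomials_agree_equiv ag; rewrite -1?[h in X in vequiv _ X]opprK; apply: eqvN.
Qed.

(** * Back-and-forth for valued real closed fields *)

Lemma tpoly_lift (K : rcfType) (e : nat -> K) t : tpoly (pren succn t) e = (peval e t)%:P.
Proof.
rewrite /tpoly peval_pren; elim: t => //= [n|u -> v ->|u ->|u -> v ->].
- by rewrite polyC_natr.
- by rewrite polyCD.
- by rewrite polyCN.
- by rewrite polyCM.
Qed.

(** Converse of [formal_tpoly]; it names the derivative of a term by a term. *)
Lemma formal_pterm P : formal P ->
  exists t, forall (K : rcfType) (e : nat -> K), tpoly t e = P K e.
Proof.
move=> [s PE].
exists (psum (fun i => PMul (pren succn (pcoef s i)) (pexp (PVar 0) i)) (size s)) => K e.
have termE i : tpoly (PMul (pren succn (pcoef s i)) (pexp (PVar 0) i)) e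
    = (peval e (pcoef s i))%:P * 'X^i.
  by rewrite -tpoly_lift /tpoly /= peval_pexp.
rewrite PE /tpoly peval_psum; under eq_bigr => i _ do rewrite -/(tpoly _ _) termE.
apply/polyP => k; rewrite coef_ppoly coef_sum.
under eq_bigr => i _ do rewrite coefCM coefXn.
have [ks|sk] := ltnP k (size s).
  rewrite (bigD1 (Ordinal ks)) //= eqxx mulr1 big1 ?addr0 // => i ik.
  by rewrite -val_eqE /= eq_sym in ik; rewrite (negPf ik) mulr0.
rewrite {2}/pcoef nth_default //= big1 // => i _; case: eqP => [ki|_]; last by rewrite mulr0.
by have := ltn_ord i; rewrite -ki ltnNge sk.
Qed.

(** Substitutes [r + h] for variable 0, with [h] the new variable 0 and [r] variable 1. As a
    polynomial in [h] it has the Taylor coefficients at [r]. *)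
Fixpoint translate (t : pterm) : pterm :=
  match t with
  | PVar i => if i is j.+1 then PVar j.+2 else PAdd (PVar 1) (PVar 0)
  | PNat n => PNat n
  | PAdd u v => PAdd (translate u) (translate v)
  | POpp u => POpp (translate u)
  | PMul u v => PMul (translate u) (translate v)
  end.

Lemma peval_translate (R : nzRingType) (e : nat -> R) h r t :
  peval (scons h (scons r e)) (translate t) = peval (scons (r + h) e) t.
Proof. by elim: t => [[|i]|n|u IHu v IHv|u IHu|u IHu v IHv] //=; rewrite ?IHu ?IHv. Qed.

Lemma tpoly_translate (K : rcfType) (e : nat -> K) r t :
  tpoly (translate t) (scons r e) = tpoly t e \Po (r%:P + 'X).
Proof.
rewrite /tpoly; elim: t => [[|i]|n|u IHu v IHv|u IHu|u IHu v IHv] /=.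
- by rewrite comp_polyX.
- by rewrite comp_polyC.
- by rewrite -polyC_natr comp_polyC.
- by rewrite comp_polyD IHu IHv.
- by rewrite IHu raddfN.
- by rewrite comp_polyM IHu IHv.
Qed.

Lemma exists_nearest (K : rcfType) (s : seq K) (y x : K) : x \in s ->
  exists2 r, r \in s & {in s, forall z, `|r - y| <= `|z - y|}.
Proof.
elim: s x => // a s IHs x xas.
have [[z zs]|no] := classic (exists z, z \in s).
  have [r rs rmin] := IHs z zs.
  have [ar|ra] := lerP `|a - y| `|r - y|.
    exists a; first exact: mem_head.
    by move=> w; rewrite in_cons => /predU1P[->//|/rmin]; apply: le_trans.
  exists r; first by rewrite in_cons rs orbT.
  by move=> w; rewrite in_cons => /predU1P[->|/rmin//]; apply: ltW.
exists a; first exact: mem_head.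
by move=> w; rewrite in_cons => /predU1P[->//|ws]; case: no; exists w.
Qed.

Lemma translate_coefs (L : seq pterm) : exists (A : seq pterm) (n : nat),
  {in L, forall t (K : rcfType) (e : nat -> K),
    (size (tpoly (translate t) e) <= n.+1)%N /\
    forall k, exists2 a, a \in A & (tpoly (translate t) e)`_k = peval e a}.
Proof.
elim: L => [|t L [A [n AP]]]; first by exists [::], 0%N.
have [s sE] := formal_tpoly (translate t).
exists (PNat 0 :: s ++ A), (size s + n)%N => u; rewrite in_cons => /predU1P[->|uL] K e.
  rewrite sE; split; first by rewrite (leq_trans (size_ppoly _ _)) // -addnS leq_addr.
  move=> k; exists (pcoef s k); last exact: coef_ppoly.
  have [ks|sk] := ltnP k (size s); last by rewrite /pcoef nth_default ?mem_head.
  by rewrite in_cons mem_cat mem_nth ?orbT.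
have [sz co] := AP u uL K e; split; first by rewrite (leq_trans sz) // ltnS leq_addl.
by move=> k; have [a aA ->] := co k; exists a; rewrite // in_cons mem_cat aA !orbT.
Qed.

Theorem agree_back_forth (L : seq pterm) :
  exists L', forall (S S' : vrcf) (e : nat -> S) (e' : nat -> S'), agree L' e e' ->
    forall y, exists y', agree L (scons y e) (scons y' e').
Proof.
have [A [n AP]] := translate_coefs L.
have [C CP] := dominant_monomial n.
pose mono a k := PMul (pren succn a) (pexp (PVar 0) k).
(* Besides the signs of the translated terms, [M] records which monomials match each of them up to
   the factor [C], so that dominance is carried to the other side by signs. *)
pose M := map translate L
  ++ [seq pbound C (translate t) m | t <- L, m <- [seq mono a k | a <- A, k <- iota 0 n.+1]]
  ++ [seq pbound C m (translate t) | t <- L, m <- [seq mono a k | a <- A, k <- iota 0 n.+1]].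
have [Lm LmP] := monomial_back_forth M A n.
have [D DP] : exists D : seq pterm, {in L, forall t, exists2 d,
  d \in D & forall (K : rcfType) (e : nat -> K),
    tpoly d e = (tpoly t e)^`()}.
  apply: seq_finite_choice => [t s s' [d ds]|t s s' [d ds]|t _].
  - by exists d; rewrite // mem_cat ds.
  - by exists d; rewrite // mem_cat ds orbT.
  have [d dE] := formal_pterm (formal_deriv (formal_tpoly t)).
  by exists [:: d]; exists d; rewrite ?mem_head.
(* [PVar 0] contributes the root 0, so that a closest root always exists. *)
pose Q := PVar 0 :: L ++ D.
have [La LaP] := agree_back_forth_roots Lm Q.
have [Lb LbP] := agree_back_forth_roots L Q.
exists (La ++ Lb) => S S' e e' /agree_cat[aga agb] y.
pose G := flatten [seq rootsR (tpoly q e) | q <- Q & tpoly q e != 0].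
have GP x : reflect (exists2 q, q \in Q & tpoly q e != 0 /\ peval (scons x e) q = 0) (x \in G).
  apply: (iffP flattenP) => [[r /mapP[q qf ->] xq]|[q qQ [q0 qx]]].
    move: qf; rewrite mem_filter => /andP[q0 qQ]; exists q => //; split=> //.
    by move: xq; rewrite -(roots_on_rootsR q0) rootE horner_tpoly => /eqP.
  exists (rootsR (tpoly q e)); first by apply/mapP; exists q; rewrite ?mem_filter ?q0.
  by rewrite -(roots_on_rootsR q0) rootE horner_tpoly qx eqxx.
have [/GP[q qQ [q0 qy]]|yG] := boolP (y \in G); first exact: (LbP q qQ _ _ _ _ agb).
have [|r rG rmin] := @exists_nearest S G y 0.
  apply/GP; exists (PVar 0); first exact: mem_head.
  by rewrite /tpoly /= polyX_eq0.
have /GP[q qQ [q0 qr]] := rG.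
have [r' agr] := LaP q qQ _ _ _ _ aga r q0 qr.
pose h := y - r.
have h0 : h != 0 by rewrite subr_eq0; apply: contraNneq yG => ->.
have rh : r + h = y by rewrite addrC subrK.
have [h' [sg monos]] := LmP _ _ _ _ agr h h0.
exists (r' + h').
(* No critical element is closer to [y] than [r]. Translated by [r], this is the root-free interval
   around [h] that dominance of a monomial requires. *)
have away z : `|z - h| < `|h| -> r + z \notin G.
  move=> zh; apply/negP => /rmin; rewrite leNgt -[r - y]opprB normrN -/h.
  by rewrite /h opprB addrA [z + r]addrC in zh; rewrite zh.
have dominant t : t \in L -> exists a k, [/\ a \in A, (k <= n)%N,
    vequiv (peval (scons y e) t) (peval (scons r e) a * h ^+ k) &
    vequiv (peval (scons (r' + h') e') t) (peval (scons r' e') a * h' ^+ k)].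
  move=> tL; have [szt co] := AP t tL S (scons r e).
  have [z zh p0|z zh p'0|k [kn le1 le2]] := CP S (tpoly (translate t) (scons r e)) h szt h0.
  - rewrite tpoly_translate; apply: contra (away z zh) => tz; apply/GP; exists t.
      by rewrite in_cons mem_cat tL orbT.
    split; first by apply: contra_neq p0 => t0; rewrite tpoly_translate t0 comp_poly0.
    move: tz; rewrite rootE horner_comp !hornerE horner_tpoly => /eqP.
    by [].
  - have [d dD dE] := DP t tL.
    have E : (tpoly (translate t) (scons r e))^`() = tpoly d e \Po (r%:P + 'X).
      by rewrite tpoly_translate deriv_comp derivD derivC derivX add0r mulr1 dE.
    rewrite E; apply: contra (away z zh) => tz; apply/GP; exists d.
      by rewrite in_cons mem_cat dD !orbT.
    split; first by apply: contra_neq p'0 => d0; rewrite E d0 comp_poly0.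
    by move: tz; rewrite rootE horner_comp !hornerE horner_tpoly => /eqP.
  have [a aA aE] := co k.
  rewrite horner_tpoly peval_translate rh aE in le1 le2.
  have bnd u v : pbound C u v \in M ->
      (`|peval (scons h (scons r e)) u| <= C%:R * `|peval (scons h (scons r e)) v|) =
      (`|peval (scons h' (scons r' e')) u| <= C%:R * `|peval (scons h' (scons r' e')) v|).
    by move=> /sg/sgz_eq_ge0; rewrite !peval_pbound.
  have := bnd (translate t) (mono a k); have := bnd (mono a k) (translate t).
  rewrite /= !peval_pexp !peval_lift !peval_translate rh le1 le2 /= => le2' le1'.
  have mk : mono a k \in [seq mono a k | a <- A, k <- iota 0 n.+1].
    by apply/allpairsP; exists (a, k); rewrite mem_iota add0n ltnS.
  exists a, k; split=> //; first exact: vequiv_bounds le1 le2.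
  apply: (@vequiv_bounds _ C C); [rewrite -le1' //|rewrite -le2' //]; rewrite !mem_cat.
    by apply/orP; right; apply/orP; left; apply/allpairsP; exists (t, mono a k).
  by do 2![apply/orP; right]; apply/allpairsP; exists (t, mono a k).
split.
  move=> t tL; have := sg (translate t); rewrite mem_cat (map_f translate tL) => /(_ isT).
  by rewrite !peval_translate rh.
move=> t u tL uL.
have [a [k [aA kn ta ta']]] := dominant t tL.
have [b [l [bA ln ub ub']]] := dominant u uL.
rewrite (vdiv_equiv ta ub) (vdiv_equiv ta' ub').
exact: monos.
Qed.

(** * The fraction field of a real closed valuation ring *)

Section OrderedFractions.

Variable V : realDomainType.

Local Notation "x %:F" := (@FracField.tofrac V x).
Local Open Scope quotient_scope.

Lemma frac_eq (x : {fraction V}) :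
  exists a b : V, b != 0 /\ x = a%:F / b%:F.
Proof.
elim/quotW: x => r; exists \n_r, \d_r; split; first exact: denom_ratioP.
rewrite -[_ / _]/(FracField.mul _ (FracField.inv _)) !piE.
apply/eqmodP; rewrite /= FracField.equivfE /FracField.mulf /FracField.invf.
by rewrite !numden_Ratio ?(oner_eq0, mulf_neq0, denom_ratioP) // mul1r mulr1 mulrC.
Qed.

(** The sign is read off the chosen representative; [frac_ge0E] makes it independent of the
    choice. *)
Definition frac_ge0 (x : {fraction V}) : bool := 0 <= \n_(repr x) * \d_(repr x).

Lemma frac_ge0E (a b : V) : b != 0 -> frac_ge0 (a%:F / b%:F) = (0 <= a * b).
Proof.
move=> b0; rewrite /frac_ge0; set r := repr _.
have r0 : \d_r != 0 := denom_ratioP r.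
have b0' : b%:F != 0 by rewrite tofrac_eq0.
have r0' : (\d_r)%:F != 0 by rewrite tofrac_eq0.
have e : (\n_r)%:F / (\d_r)%:F = a%:F / b%:F.
  rewrite -[RHS]reprK -/r -[_ / _]/(FracField.mul _ (FracField.inv _)) !piE.
  apply/eqmodP; rewrite /= FracField.equivfE /FracField.mulf /FracField.invf.
  by rewrite !numden_Ratio ?(oner_eq0, mulf_neq0, denom_ratioP) // mul1r mulr1 mulrC.
have {}e : \n_r * b = a * \d_r.
  apply/eqP; rewrite -tofrac_eq !tofracM; apply/eqP.
  by move/eqP: e; rewrite eqr_div // => /eqP.
rewrite -(pmulr_lge0 (\n_r * \d_r) (_ : 0 < b ^+ 2)) ?exprn_even_gt0 //.
rewrite -[RHS](pmulr_lge0 (a * b) (_ : 0 < \d_r ^+ 2)) ?exprn_even_gt0 //.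
suff -> : \n_r * \d_r * b ^+ 2 = a * b * \d_r ^+ 2 by [].
rewrite !expr2 (_ : _ * (b * b) = (\n_r * b) * (\d_r * b)); last by ring.
by rewrite e; ring.
Qed.

Definition frac_le (x y : {fraction V}) := frac_ge0 (y - x).
Definition frac_lt (x y : {fraction V}) := (y != x) && frac_le x y.
Definition frac_norm (x : {fraction V}) := if frac_ge0 x then x else - x.

Lemma frac_pos_eq (x : {fraction V}) : exists a b : V, 0 < b /\ x = a%:F / b%:F.
Proof.
have [a [b [b0 ->]]] := frac_eq x.
have [bgt|blt|b_eq] := ltrgtP 0 b; last by rewrite -b_eq eqxx in b0.
  by exists a, b.
by exists (- a), (- b); rewrite oppr_gt0 !tofracN invrN mulrNN.
Qed.

Lemma frac_ge0_pos (a b : V) : 0 < b -> frac_ge0 (a%:F / b%:F) = (0 <= a).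
Proof. by move=> b0; rewrite frac_ge0E ?gt_eqF // pmulr_lge0. Qed.

Lemma frac_le0_add x y : frac_le 0 x -> frac_le 0 y -> frac_le 0 (x + y).
Proof.
rewrite /frac_le !subr0; have [a [b [b0 ->]]] := frac_pos_eq x;
  have [c [d [d0 ->]]] := frac_pos_eq y.
rewrite addf_div ?tofrac_eq0 ?gt_eqF // -!tofracM -tofracD !frac_ge0_pos ?mulr_gt0 //.
by move=> a0 c0; rewrite addr_ge0 ?mulr_ge0 // ltW.
Qed.

Lemma frac_le0_mul x y : frac_le 0 x -> frac_le 0 y -> frac_le 0 (x * y).
Proof.
rewrite /frac_le !subr0; have [a [b [b0 ->]]] := frac_pos_eq x;
  have [c [d [d0 ->]]] := frac_pos_eq y.
by rewrite mulf_div -!tofracM !frac_ge0_pos ?mulr_gt0 //; apply: mulr_ge0.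
Qed.

Lemma frac_le0_anti x : frac_le 0 x -> frac_le x 0 -> x = 0.
Proof.
rewrite /frac_le subr0 sub0r; have [a [b [b0 ->]]] := frac_pos_eq x.
rewrite -mulNr -tofracN !frac_ge0_pos // oppr_ge0 => a0 a0'.
have /eqP-> : a == 0 by rewrite eq_le a0 a0'.
by rewrite tofrac0 mul0r.
Qed.

Lemma frac_sub_ge0 x y : frac_le 0 (y - x) = frac_le x y.
Proof. by rewrite /frac_le subr0. Qed.

Lemma frac_le0_total x : frac_le 0 x || frac_le x 0.
Proof.
rewrite /frac_le subr0 sub0r; have [a [b [b0 ->]]] := frac_pos_eq x.
by rewrite -mulNr -tofracN !frac_ge0_pos // oppr_ge0 le_total.
Qed.

Lemma frac_normN x : frac_norm (- x) = frac_norm x.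
Proof.
rewrite /frac_norm opprK; have := frac_le0_total x; have := @frac_le0_anti x.
rewrite /frac_le subr0 sub0r.
case: (frac_ge0 x); case: (frac_ge0 (- x)) => //= anti _.
by rewrite anti ?oppr0.
Qed.

Lemma frac_ge0_norm x : frac_le 0 x -> frac_norm x = x.
Proof. by rewrite /frac_le /frac_norm subr0 => ->. Qed.

Lemma frac_lt_def x y : frac_lt x y = (y != x) && frac_le x y.
Proof. by []. Qed.

End OrderedFractions.

Definition ordered_fraction (V : realDomainType) : Type := {fraction V}.

HB.instance Definition _ (V : realDomainType) := GRing.Field.on (ordered_fraction V).
HB.instance Definition _ (V : realDomainType) :=
  Num.IntegralDomain_isLeReal.Build (ordered_fraction V)
    (@frac_le0_add V) (@frac_le0_mul V) (@frac_le0_anti V) (@frac_sub_ge0 V)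
    (@frac_le0_total V) (@frac_normN V) (@frac_ge0_norm V) (@frac_lt_def V).

Definition to_frac (V : realDomainType) (v : V) : ordered_fraction V := @FracField.tofrac V v.

HB.instance Definition _ (V : realDomainType) :=
  GRing.isZmodMorphism.Build V (ordered_fraction V) (@to_frac V) (@tofrac_is_zmod_morphism V).
HB.instance Definition _ (V : realDomainType) :=
  GRing.isMonoidMorphism.Build V (ordered_fraction V) (@to_frac V) (@tofrac_is_monoid_morphism V).

Section OrderedFractionTheory.

Variable V : realDomainType.
Local Notation "x %:F" := (@to_frac V x).

Lemma to_frac_ge0 (a : V) : (0 <= a%:F) = (0 <= a).
Proof.
rewrite -[0 <= a%:F]/(frac_ge0 (_ - 0)) subr0 -[X in frac_ge0 X]divr1 -[1]/(FracField.tofrac 1).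
by rewrite frac_ge0_pos.
Qed.

Lemma to_frac_le (a b : V) : (a%:F <= b%:F) = (a <= b).
Proof. by rewrite -subr_ge0 -rmorphB to_frac_ge0 subr_ge0. Qed.

Lemma to_frac_inj : injective (@to_frac V).
Proof. by move=> a b /eqP; rewrite eq_le !to_frac_le -eq_le => /eqP. Qed.

Lemma to_frac_eq0 (a : V) : (a%:F == 0) = (a == 0).
Proof. by rewrite -(rmorph0 (@to_frac V)) (inj_eq to_frac_inj). Qed.

Lemma to_frac_lt (a b : V) : (a%:F < b%:F) = (a < b).
Proof. by rewrite !lt_neqAle to_frac_le (inj_eq to_frac_inj). Qed.

Lemma to_frac_norm (a : V) : `|a%:F| = `|a|%:F.
Proof.
have [a0|a0] := leP 0 a; first by rewrite !ger0_norm ?to_frac_ge0.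
by rewrite !ltr0_norm ?rmorphN // -(rmorph0 (@to_frac V)) to_frac_lt.
Qed.

Lemma to_frac_div (x : ordered_fraction V) : exists a b : V, 0 < b /\ x = a%:F / b%:F.
Proof. exact: frac_pos_eq. Qed.

Lemma common_denominator (s : seq (ordered_fraction V)) :
  exists2 d : V, 0 < d & {in s, forall x, exists v : V, d%:F * x = v%:F}.
Proof.
elim: s => [|x s [d d0 dP]]; first by exists 1.
have [a [b [b0 xE]]] := to_frac_div x.
exists (b * d) => [|y]; first exact: mulr_gt0.
rewrite in_cons => /predU1P[->|/dP[v vE]].
  exists (d * a); rewrite xE !rmorphM /= [b%:F * _]mulrC -mulrA; congr (_ * _).
  by rewrite mulrC divfK // to_frac_eq0 gt_eqF.
by exists (b * v); rewrite !rmorphM -mulrA vE.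
Qed.

(** Clearing denominators: for a common denominator [d > 0], the polynomial [P] over [V] satisfies
    [P(d x) = d^(n+1) p(x)], so signs agree and a root of [P] divided by [d] is a root of [p]. *)
Lemma ordered_fraction_real_closed :
  Num.real_closed_axiom V -> Num.real_closed_axiom (ordered_fraction V).
Proof.
move=> ivt p a b ab /andP[pa pb].
have [d d0 dP] := common_denominator (a :: b :: p).
have [a1 a1E] : exists v : V, d%:F * a = v%:F by apply: dP; rewrite mem_head.
have [b1 b1E] : exists v : V, d%:F * b = v%:F by apply: dP; rewrite !inE eqxx orbT.
have [c cE] : exists c : nat -> V, forall i, d%:F * p`_i = (c i)%:F.
  suff H i : exists v : V, d%:F * p`_i == v%:F by exists (fun i => xchoose (H i)) => i;
    apply/eqP/(xchooseP (H i)).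
  have [ip|pi] := ltnP i (size p); last by exists 0; rewrite nth_default // mulr0 rmorph0.
  by have [|v ->] := dP p`_i; [rewrite !in_cons mem_nth ?orbT|exists v].
have dF0 : d%:F != 0 by rewrite to_frac_eq0 gt_eqF.
have dF : 0 < d%:F by rewrite -(rmorph0 (@to_frac V)) to_frac_lt.
pose n := size p; pose P := \poly_(i < n) (c i * d ^+ (n - i)).
have PE (y : V) (x : ordered_fraction V) : d%:F * x = y%:F -> (P.[y])%:F = d%:F ^+ n.+1 * p.[x].
  move=> xy; rewrite horner_poly horner_coef rmorph_sum mulr_sumr /=; apply: eq_bigr => i _.
  rewrite !rmorphM !rmorphXn /= -cE -xy exprMn.
  have -> : d%:F ^+ n.+1 = d%:F * d%:F ^+ (n - i) * d%:F ^+ i.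
    by rewrite -mulrA -exprD subnK -?exprS // ltnW.
  by ring.
have sgnP y x : d%:F * x = y%:F -> (0 <= P.[y]) = (0 <= p.[x]) /\ (P.[y] <= 0) = (p.[x] <= 0).
  move=> /PE E; rewrite -to_frac_ge0 E pmulr_rge0 ?exprn_gt0 //; split=> //.
  by rewrite -to_frac_le E rmorph0 pmulr_rle0 ?exprn_gt0.
have [||x /andP[ax xb] Px] := ivt P a1 b1.
- by rewrite -to_frac_le -a1E -b1E ler_pM2l.
- by rewrite (sgnP _ _ a1E).2 (sgnP _ _ b1E).1 pa pb.
have xE : d%:F * (x%:F / d%:F) = x%:F by rewrite mulrC divfK.
exists (x%:F / d%:F).
  by rewrite ler_pdivlMr // mulrC a1E ler_pdivrMr // [b * _]mulrC b1E !to_frac_le ax.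
move: Px; rewrite !rootE => /eqP Px; have := PE _ _ xE; rewrite Px rmorph0 => /esym/eqP.
by rewrite mulf_eq0 expf_eq0 (negPf dF0).
Qed.

End OrderedFractionTheory.

(** The proof [ivt] is a parameter of the type because the real closed structure depends on it. *)
Definition rcf_fraction (V : realDomainType) (ivt : Num.real_closed_axiom V) : Type :=
  ordered_fraction V.

HB.instance Definition _ V ivt := Num.RealField.on (@rcf_fraction V ivt).
HB.instance Definition _ V ivt := Num.RealField_isClosed.Build (@rcf_fraction V ivt)
  (ordered_fraction_real_closed ivt).

Section FractionVrcf.

Variables (V : realDomainType) (hV : real_closed_valuation_ring V).

Let K : rcfType := rcf_fraction hV.1.

Definition frac_int (x : K) : Prop := exists v : V, x = to_frac v.

Fact frac_int1 : frac_int 1.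
Proof. by exists 1; rewrite rmorph1. Qed.

Fact frac_intD x y : frac_int x -> frac_int y -> frac_int (x + y).
Proof. by move=> [v ->] [w ->]; exists (v + w); rewrite rmorphD. Qed.

Fact frac_intM x y : frac_int x -> frac_int y -> frac_int (x * y).
Proof. by move=> [v ->] [w ->]; exists (v * w); rewrite rmorphM. Qed.

(** The intermediate value property in degree 1: a quotient [a / b] between 0 and [|v|] is the root
    of [b X - a], which changes sign on that interval. *)
Fact frac_int_convex x y : frac_int y -> `|x| <= `|y| -> frac_int x.
Proof.
move=> [v ->]; rewrite to_frac_norm => xv.
suff [w wE] : exists w : V, `|x| = to_frac w.
  have [x0|x0] := leP 0 x; first by exists w; rewrite -wE ger0_norm.
  by exists (- w); rewrite rmorphN /= -wE ltr0_norm // opprK.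
have [a [b [b0 xE]]] := to_frac_div `|x|.
have bF0 : 0 < to_frac b by rewrite -(rmorph0 (@to_frac V)) to_frac_lt.
have a0 : 0 <= a.
  by have := normr_ge0 x; rewrite xE pmulr_lge0 ?invr_gt0 // to_frac_ge0.
have av : a <= `|v| * b.
  by rewrite -to_frac_le rmorphM /= -ler_pdivrMr // -xE.
have [||w _] := hV.1 (b%:P * 'X - a%:P) 0 `|v|; first exact: normr_ge0.
  by rewrite !hornerE oppr_le0 a0 subr_ge0 mulrC.
rewrite rootE !hornerE subr_eq0 => /eqP bw; exists w.
by rewrite xE -bw rmorphM mulrC mulKf // gt_eqF.
Qed.

Fact frac_int_proper : exists x, ~ frac_int x.
Proof.
apply: NNPP => all_int; apply: hV.2 => x x0.
have [v vE] : frac_int (to_frac x)^-1.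
  by apply: NNPP => nv; apply: all_int; exists (to_frac x)^-1.
apply/unitrP; exists v; rewrite [x * v]mulrC; suff -> : v * x = 1 by [].
by apply: to_frac_inj; rewrite rmorphM /= -vE mulVf ?rmorph1 // to_frac_eq0.
Qed.

Definition frac_vrcf : vrcf :=
  Vrcf frac_int1 frac_intD frac_intM frac_int_convex frac_int_proper.

Definition to_vrcf (v : V) : frac_vrcf := to_frac v.

End FractionVrcf.

(** * Formulas and quantifier-free refinement *)

Lemma extend_ord0 (T : Type) n (x : T) (e : 'I_n -> T) : extend x e ord0 = x.
Proof. by rewrite /extend unlift_none. Qed.

Lemma extend_lift (T : Type) n (x : T) (e : 'I_n -> T) i : extend x e (lift ord0 i) = e i.
Proof. by rewrite /extend liftK. Qed.

Lemma eq_extend (T : Type) n (x : T) (e e' : 'I_n -> T) :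
  e =1 e' -> extend x e =1 extend x e'.
Proof. by move=> ee i; rewrite /extend; case: unlift. Qed.

Lemma extend_eta (T : Type) n (e : 'I_n.+1 -> T) :
  extend (e ord0) (fun i => e (lift ord0 i)) =1 e.
Proof. by move=> i; rewrite /extend; case: unliftP => [j ->|->]. Qed.

Lemma eq_eval (M : structure) n (e e' : 'I_n -> M) t : e =1 e' -> eval e t = eval e' t.
Proof.
by move=> ee; elim: t => //= [u -> v ->|u ->|u -> v ->|u -> v ->|u -> v ->].
Qed.

Lemma eq_holds (M : structure) n (f : formula n) (e e' : 'I_n -> M) :
  e =1 e' -> holds f e <-> holds f e'.
Proof.
elim: f e e' => {n} [n t u|n r t u|n f IH|n f IHf g IHg|n f IHf g IHg|n f IHf g IHg|n f IH|n f
  IH] e e' ee /=.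
- by rewrite !(eq_eval _ ee).
- by rewrite !(eq_eval _ ee).
- by rewrite (IH _ _ ee).
- by rewrite (IHf _ _ ee) (IHg _ _ ee).
- by rewrite (IHf _ _ ee) (IHg _ _ ee).
- by rewrite (IHf _ _ ee) (IHg _ _ ee).
- by split=> H x; apply/(IH _ _ (eq_extend x ee)).
- by split=> -[x H]; exists x; apply/(IH _ _ (eq_extend x ee)).
Qed.

Fixpoint univ_closure n : formula n -> sentence :=
  match n return formula n -> sentence with
  | 0 => fun f => f
  | m.+1 => fun f => univ_closure (FAll f)
  end.

Lemma valid_univ_closure (M : structure) n (f : formula n) :
  valid M (univ_closure f) <-> valid M f.
Proof.
elim: n f => [|n IHn] f //=; rewrite IHn; split=> H e; last by move=> x; apply: H.
by apply/(eq_holds f (extend_eta e)); apply: H.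
Qed.

(** An equivalence that is true in [M] is, after universal closure, a sentence of its theory, so it
    holds in every model. *)
Lemma quantifier_elimination_Th (M : structure) :
  (forall n (f : formula n), exists2 g : formula n, quantifier_free g &
    forall e : 'I_n -> M, holds f e <-> holds g e) ->
  quantifier_elimination (Th M).
Proof.
move=> qe n f; have [g qg fg] := qe n f; exists g => // N modelN.
apply/valid_univ_closure; apply: modelN; apply/valid_univ_closure => e /=.
by have [] := fg e.
Qed.

(** Finitely many truth values of quantifier-free formulas suffice to guarantee [R]. *)
Definition refinable (M : structure) n (R : ('I_n -> M) -> ('I_n -> M) -> Prop) : Prop :=
  exists2 G : seq (formula n), all (@quantifier_free n) G &
    forall x x', foldr (fun g H => (holds g x <-> holds g x') /\ H) True G -> R x x'.

Section Refinable.

Variables (M : structure) (n : nat).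
Implicit Types (R : ('I_n -> M) -> ('I_n -> M) -> Prop).

Lemma refinable_qf (g : formula n) : quantifier_free g ->
  refinable (fun x x' : 'I_n -> M => holds g x <-> holds g x').
Proof. by move=> qg; exists [:: g] => [|x x' []] //=; rewrite qg. Qed.

Lemma refinable_sub R R' : (forall x x', R x x' -> R' x x') -> refinable R -> refinable R'.
Proof. by move=> RR' [G qG GR]; exists G => // x x' /GR/RR'. Qed.

Lemma refinable_and R R' : refinable R -> refinable R' ->
  refinable (fun x x' => R x x' /\ R' x x').
Proof.
move=> [G qG GR] [G' qG' GR']; exists (G ++ G'); first by rewrite all_cat qG qG'.
move=> x x' H; suff [/GR ? /GR' ?] : foldr (fun g H => (holds g x <-> holds g x') /\ H) True G /\
  foldr (fun g H => (holds g x <-> holds g x') /\ H) True G' by [].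
by elim: G {qG GR} H => //= g G IHG [gg /IHG[]].
Qed.

Lemma refinable_in (T : eqType) (s : seq T) (R : T -> ('I_n -> M) -> ('I_n -> M) -> Prop) :
  (forall t, refinable (R t)) -> refinable (fun x x' => {in s, forall t, R t x x'}).
Proof.
move=> rR; elim: s => [|t s IHs]; first by exists [::].
apply: refinable_sub (refinable_and (rR t) IHs) => x x' [Rt Rs] u.
by rewrite in_cons => /predU1P[->|/Rs].
Qed.

Lemma refinable_forall_bool (R : bool -> ('I_n -> M) -> ('I_n -> M) -> Prop) :
  (forall b, refinable (R b)) -> refinable (fun x x' => forall b, R b x x').
Proof.
by move=> rR; apply: refinable_sub (refinable_and (rR true) (rR false)) => x x' [? ?] [].
Qed.

(** [P] is a union of some of the finitely many classes cut out by the truth values of [G]. *)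
Lemma refinable_equivalent R (P : ('I_n -> M) -> Prop) : refinable R ->
  (forall x x', R x x' -> P x -> P x') ->
  exists2 g : formula n, quantifier_free g & forall x, P x <-> holds g x.
Proof.
move=> [G qG GR] RP.
have {}RP (x x' : 'I_n -> M) : foldr (fun g H => (holds g x <-> holds g x') /\ H) True G ->
  P x -> P x'.
  by move=> /GR/RP.
elim: G P {R GR} RP qG => [|g G IHG] P GP /=.
  (* Without formulas all tuples are equivalent, so [P] is empty or total. *)
  have [[x Px]|noP] := classic (exists x, P x) => _.
    by exists (FEq (TZero n) (TZero n)) => // y; split=> // _; apply: GP Px.
  by exists (FNot (FEq (TZero n) (TZero n))) => // y; split=> [Py|[]] //; case: noP; exists y.
move=> /andP[qg qG].
pose same (G : seq (formula n)) (x x' : 'I_n -> M) := foldr (fun g H => (holds g x <->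
  holds g x') /\ H) True G.
have same_sym G' x x' : same G' x x' -> same G' x' x.
  by elim: G' => //= h G' IHG' [? /IHG' ?]; split; [symmetry|].
have same_refl G' x : same G' x x by elim: G' => //= h G' IHG'.
have same_trans G' x x' x'' : same G' x x' -> same G' x' x'' -> same G' x x''.
  elim: G' => //= h G' IHG' [e1 /IHG' H] [e2 /H]; split=> //.
  by rewrite e1.
(* The part of [P] where [g] has truth value [b], saturated for the remaining formulas so that the
   induction applies. *)
pose P1 (b : bool) (x : 'I_n -> M) := exists x' : 'I_n ->
  M, [/\ P x', (if b then holds g x' else ~ holds g x') & same G x x'].
have QP b : exists2 h, quantifier_free h & forall x, P1 b x <-> holds h x.
  apply: IHG => // x x' xx' [y [Py gy xy]]; exists y; split=> //.
  exact: same_trans (same_sym _ _ _ xx') xy.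
have [h1 q1 H1] := QP true; have [h2 q2 H2] := QP false.
exists (FOr (FAnd g h1) (FAnd (FNot g) h2)); first by rewrite /= qg q1 q2.
move=> x; rewrite /= -H1 -H2; split.
  by move=> Px; have [gx|gx] := classic (holds g x); [left|right]; split=> //; exists x; split.
move=> [[gx [y [Py gy xy]]]|[gx [y [Py gy xy]]]]; apply: GP Py => /=; split=> //.
  exact: same_sym.
exact: same_sym.
Qed.

End Refinable.

(** * Terms with lattice operations and the data deciding atomic formulas *)

Fixpoint leval (K : realDomainType) n (e : nat -> K) (t : term n) : K :=
  match t with
  | TVar i => e i
  | TZero => 0
  | TOne => 1
  | TAdd u v => leval e u + leval e v
  | TOpp u => - leval e u
  | TMul u v => leval e u * leval e v
  | TMeet u v => Num.min (leval e u) (leval e v)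
  | TJoin u v => Num.max (leval e u) (leval e v)
  end.

(** Minimum and maximum are piecewise polynomial; the sign of the difference of the arguments
    selects the piece. *)
Lemma leval_pieces n (t : term n) : exists L (l : seq pterm),
  forall (K K' : rcfType) (e : nat -> K) (e' : nat -> K'), sign_agree L e e' ->
  exists2 p, p \in l & leval e t = peval e p /\ leval e' t = peval e' p.
Proof.
elim: t => [i|||u [L [l uP]] v [M [m vP]]|u [L [l uP]]|u [L [l uP]] v [M [m vP]]|u [L [l uP]] v
  [M [m vP]]|u [L [l uP]] v [M [m vP]]].
- by exists [::], [:: PVar i] => K K' e e' _; exists (PVar i); rewrite ?mem_head.
- by exists [::], [:: PNat 0] => K K' e e' _; exists (PNat 0); rewrite ?mem_head.
- by exists [::], [:: PNat 1] => K K' e e' _; exists (PNat 1); rewrite ?mem_head.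
- exists (L ++ M), [seq PAdd p q | p <- l, q <- m] =>
  K K' e e' /sign_agree_cat[/uP[p pl [up up']] /vP[q qm [vq vq']]].
  by exists (PAdd p q); [apply/allpairsP; exists (p, q)|rewrite /= up up' vq vq'].
- exists L, [seq POpp p | p <- l] => K K' e e' /uP[p pl [up up']].
  by exists (POpp p); [apply: map_f|rewrite /= up up'].
- exists (L ++ M), [seq PMul p q | p <- l, q <- m] =>
  K K' e e' /sign_agree_cat[/uP[p pl [up up']] /vP[q qm [vq vq']]].
  by exists (PMul p q); [apply/allpairsP; exists (p, q)|rewrite /= up up' vq vq'].
all: exists (L ++ M ++ [seq PAdd q (POpp p) | p <- l, q <- m]), (l ++ m) => K K' e e';
  move=> /sign_agree_cat[/uP[p pl [up up']] /sign_agree_cat[/vP[q qm [vq vq']] ag]];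
  have := ag (PAdd q (POpp p)); rewrite (allpairs_f (fun p q => PAdd q (POpp p))) // =>
    /(_ isT)/sgz_eq_gt0 /=;
  rewrite !subr_gt0 up up' vq vq' !/(Num.min _ _) !/(Num.max _ _) => <-; case: ifP => _.
- by exists p; rewrite // mem_cat pl.
- by exists q; rewrite // mem_cat qm orbT.
- by exists q; rewrite // mem_cat qm orbT.
- by exists p; rewrite // mem_cat pl.
Qed.

Lemma leval_determined n (t u : term n) : exists L,
  forall (S S' : vrcf) (e : nat -> S) (e' : nat -> S'), agree L e e' ->
  [/\ leval e t = leval e u <-> leval e' t = leval e' u,
      leval e t = 0 <-> leval e' t = 0,
      leval e u = 0 <-> leval e' u = 0 &
      vdiv (leval e t) (leval e u) <-> vdiv (leval e' t) (leval e' u)].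
Proof.
have [L [l tP]] := leval_pieces t; have [M [m uP]] := leval_pieces u.
exists (L ++ M ++ (l ++ m) ++ [seq PAdd p (POpp q) | p <- l, q <- m]) => S S' e e'.
move=> /agree_cat[[/tP[p pl [tp tp']] _] /agree_cat[[/uP[q qm [uq uq']] _] /agree_cat[[sg dv]
  [sgB _]]]].
have eq0 (x : S) (x' : S') : sgz x = sgz x' -> x = 0 <-> x' = 0.
  by move=> /sgz_eq_eq0 xx'; split=> /eqP h; apply/eqP; rewrite ?xx' // -xx'.
have plm : p \in l ++ m by rewrite mem_cat pl.
have qlm : q \in l ++ m by rewrite mem_cat qm orbT.
rewrite tp tp' uq uq'; split; last exact: dv.
- have := sgB (PAdd p (POpp q)); rewrite (allpairs_f (fun p q => PAdd p (POpp q))) // =>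
  /(_ isT) /eq0 /= h.
  by split=> /eqP; rewrite -subr_eq0 => /eqP /h /eqP; rewrite subr_eq0 => /eqP.
- exact: eq0 (sg p plm).
- exact: eq0 (sg q qlm).
Qed.

(** * The product of two real closed valuation rings *)

Lemma eq_agree L (S S' : vrcf) (e f : nat -> S) (e' f' : nat -> S') :
  e =1 f -> e' =1 f' -> agree L e e' -> agree L f f'.
Proof.
move=> ef ef' [sg dv]; split=> [t tL|t u tL uL].
  by rewrite -(eq_peval t ef) -(eq_peval t ef'); apply: sg.
by rewrite -!(eq_peval _ ef) -!(eq_peval _ ef'); apply: dv.
Qed.

Section Product.

Variables V0 V1 : realDomainType.
Hypotheses (hV0 : real_closed_valuation_ring V0) (hV1 : real_closed_valuation_ring V1).

Local Notation A := (prod_structure V0 V1).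

Definition factor (b : bool) : vrcf := if b then frac_vrcf hV1 else frac_vrcf hV0.

Definition comp (b : bool) : V0 * V1 -> factor b :=
  match b return V0 * V1 -> factor b with
  | true => fun y => to_vrcf hV1 y.2
  | false => fun y => to_vrcf hV0 y.1
  end.

Lemma compD b x y : comp b (x + y) = comp b x + comp b y.
Proof. by case: b; rewrite /= /to_vrcf; apply: rmorphD. Qed.

Lemma compM b x y : comp b (x * y) = comp b x * comp b y.
Proof. by case: b; rewrite /= /to_vrcf; apply: rmorphM. Qed.

Lemma compN b x : comp b (- x) = - comp b x.
Proof. by case: b; rewrite /= /to_vrcf; apply: rmorphN. Qed.

Lemma comp0 b : comp b 0 = 0.
Proof. by case: b; rewrite /= /to_vrcf; apply: rmorph0. Qed.

Lemma comp1 b : comp b 1 = 1.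
Proof. by case: b; rewrite /= /to_vrcf; apply: rmorph1. Qed.

Lemma comp_inj x y : (forall b, comp b x = comp b y) -> x = y.
Proof.
case: x y => [x0 x1] [y0 y1] xy.
by have /to_frac_inj /= -> := xy false; have /to_frac_inj /= -> := xy true.
Qed.

Lemma comp_int b x : vint (comp b x).
Proof. by case: b; [exists x.2|exists x.1]. Qed.

Lemma comp_surj (z : forall b, factor b) : (forall b, vint (z b)) ->
  exists x, forall b, comp b x = z b.
Proof.
move=> zint; have [v0 v0E] : exists v, z false = to_frac v := zint false.
have [v1 v1E] : exists v, z true = to_frac v := zint true.
by exists (v0, v1) => -[].
Qed.

Lemma eq_comp0 x : x = 0 <-> forall b, comp b x = 0.
Proof. by split=> [-> b|x0]; [exact: comp0|apply: comp_inj => b; rewrite x0 comp0]. Qed.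

Lemma to_frac_min (V : realDomainType) (x y : V) :
  to_frac (Num.min x y) = Num.min (to_frac x) (to_frac y).
Proof. by rewrite !/(Num.min _ _) to_frac_lt; case: ifP. Qed.

Lemma to_frac_max (V : realDomainType) (x y : V) :
  to_frac (Num.max x y) = Num.max (to_frac x) (to_frac y).
Proof. by rewrite !/(Num.max _ _) to_frac_lt; case: ifP. Qed.

Definition env n (b : bool) (x : 'I_n -> V0 * V1) (i : nat) : factor b :=
  if insub i is Some j then comp b (x j) else 0.

Lemma comp_eval n (x : 'I_n -> A) b t : comp b (eval x t) = leval (@env n b x) t.
Proof.
elim: t => /= [i|||u IHu v IHv|u IHu|u IHu v IHv|u IHu v IHv|u IHu v IHv].
- by rewrite /env valK.
- exact: comp0.
- exact: comp1.
- by rewrite -IHu -IHv; apply: compD.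
- by rewrite -IHu; apply: compN.
- by rewrite -IHu -IHv; apply: compM.
- by rewrite -IHu -IHv; case: (b); rewrite /= /to_vrcf -to_frac_min meetEtotal.
- by rewrite -IHu -IHv; case: (b); rewrite /= /to_vrcf -to_frac_max joinEtotal.
Qed.

Lemma env_extend n b (y : V0 * V1) (x : 'I_n -> V0 * V1) :
  @env n.+1 b (extend y x) =1 scons (comp b y) (@env n b x).
Proof.
move=> i; rewrite /env; case: i => [|i].
  by rewrite insubT /= (_ : Sub 0%N _ = ord0) ?extend_ord0 //; apply: val_inj.
have [lt|ge] := ltnP i n.
  rewrite insubT /= /scons insubT (_ : Sub i.+1 _ = lift ord0 (Sub i lt)) ?extend_lift //.
  by apply: val_inj.
have lt : (i < n)%N = false by rewrite ltnNge ge.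
by rewrite /= !insubF.
Qed.

Lemma comp_divides (x y : V0 * V1) : divides x y <-> forall b, vdiv (comp b x) (comp b y).
Proof.
split=> [[z <-] b|xy]; first by exists (comp b z); [exact: comp_int|rewrite compM].
have H b : exists z, vint z /\ comp b y = comp b x * z.
  by have [z zint e] := xy b; exists z.
have [z0 [z0int e0]] := H false; have [z1 [z1int e1]] := H true.
have [|z zE] := @comp_surj (fun b => match b return factor b with true => z1 | false => z0 end).
  by case.
exists z; apply: comp_inj => b; rewrite compM zE.
by case: b.
Qed.

(** The idempotent supported on one factor tests the annihilator there, and each factor is a
    domain. *)
Lemma comp_radical (x y : V0 * V1) :
  radical_rel x y <-> forall b, comp b y = 0 -> comp b x = 0.
Proof.
split=> [xy b yb|xy z /eq_comp0 yz].
  have [|z zE] := @comp_surj (fun c => if c == b then 1 else 0).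
    by move=> c; case: ifP => _; [exact: vint1|exact: (vint_nat _ 0)].
  have yz : y * z = 0.
    apply/eq_comp0 => c; rewrite compM zE; case: eqP => [->|_]; last by rewrite mulr0.
    by rewrite yb mul0r.
  by have /eq_comp0/(_ b) := xy z yz; rewrite compM zE eqxx mulr1.
apply/eq_comp0 => b; have /eqP := yz b; rewrite !compM mulf_eq0 => /orP[/eqP/xy->|/eqP->].
  exact: mul0r.
exact: mulr0.
Qed.

(** [w (y - w) = 0] forces each component of [w] to be 0 or that of [y]; a nonzero [w] thus singles
    out a factor where [y] does not vanish. *)
Lemma comp_loc_divides (x y : V0 * V1) :
  loc_divides x y <-> y = 0 \/ exists b, comp b y <> 0 /\ vdiv (comp b x) (comp b y).
Proof.
split=> [[->|[w [w0 /eq_comp0 wyw /comp_divides xw]]]|[->|[b [yb xyb]]]]; [by left| |by left|].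
  right; apply: NNPP => no; apply: w0; apply/eq_comp0 => b; apply: NNPP => wb; apply: no.
  exists b; have := wyw b; rewrite compM compD compN => /eqP; rewrite mulf_eq0 subr_eq0.
  by move=> /orP[/eqP//|/eqP->].
right; have [|w wE] := @comp_surj (fun c => if c == b then comp c y else 0).
  by move=> c; case: ifP => _; [exact: comp_int|exact: (vint_nat _ 0)].
exists w; split.
- by move=> /eq_comp0/(_ b); rewrite wE eqxx.
- apply/eq_comp0 => c; rewrite compM compD compN wE; case: eqP => [->|_]; last by rewrite mul0r.
  by rewrite subrr mulr0.
- apply/comp_divides => c; rewrite wE; case: eqP => [->|_] //; exact: vdivx0.
Qed.

(** [s] records an exchange of the factors: the language has no names for them. *)
Definition similar n (L : seq pterm) (x x' : 'I_n -> V0 * V1) : Prop :=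
  exists s, forall b, agree L (@env n b x) (@env n (b (+) s) x').

Lemma similar_sym n L (x x' : 'I_n -> V0 * V1) : similar L x x' -> similar L x' x.
Proof.
move=> [s xx']; exists s => b; have := agree_sym (xx' (b (+) s)).
by rewrite -addbA addbb addbF.
Qed.

Lemma similar_sub n L M (x x' : 'I_n -> V0 * V1) :
  {subset L <= M} -> similar M x x' -> similar L x x'.
Proof. by move=> LM [s xx']; exists s => b; apply: agree_sub LM (xx' b). Qed.

Lemma similar_cat n L M (x x' : 'I_n -> V0 * V1) :
  similar (L ++ M) x x' -> similar L x x' /\ similar M x x'.
Proof.
by move=> xx'; split; apply: similar_sub xx' => t tL; rewrite mem_cat tL ?orbT.
Qed.

Lemma forall_addb (s : bool) (P : bool -> Prop) : (forall b, P (b (+) s)) <-> forall b, P b.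
Proof.
by split=> H b; [have := H (b (+) s); rewrite -addbA addbb addbF|apply: H].
Qed.

Lemma similar_extend L : exists L', forall n (x x' : 'I_n -> V0 * V1), similar L' x x' ->
  forall y, exists y', similar L (extend y x : 'I_n.+1 -> V0 * V1) (extend y' x').
Proof.
(* The answer must lie in the valuation ring and not just in its fraction field; comparing 1 with
   the new variable records this. *)
have [L' LP] := agree_back_forth ([:: PNat 1; PVar 0] ++ L).
exists L' => n x x' [s xx'] y.
have z_ex b : exists z : factor (b (+) s), vint z /\
    agree L (scons (comp b y) (env b x)) (scons z (env (b (+) s) x')).
  have [z /agree_cat[[_ dv] ag]] := LP _ _ _ _ (xx' b) (comp b y).
  exists z; split=> //; have := dv (PNat 1) (PVar 0); rewrite !inE !eqxx !orbT => /(_ isT isT) /=.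
  case=> [+ _] => -[|w wint ->]; last by rewrite mul1r.
  by exists (comp b y); rewrite ?mul1r //; apply: comp_int.
have [y' y'E] : exists y', forall b, agree L (scons (comp b y) (env b x)) (scons (comp (b (+)
  s) y') (env (b (+) s) x')).
  case: s xx' z_ex => [] xx' z_ex.
    have [z0 [z0int ag0]] := z_ex true; have [z1 [z1int ag1]] := z_ex false.
    have [|y' y'E] := @comp_surj (fun b => match b return factor b with true => z1 | false =>
      z0 end).
      by case.
    by exists y' => -[]; rewrite y'E.
  have [z0 [z0int ag0]] := z_ex false; have [z1 [z1int ag1]] := z_ex true.
  have [|y' y'E] := @comp_surj (fun b => match b return factor b with true => z1 | false => z0 end).
    by case.
  by exists y' => -[]; rewrite y'E.
exists y'; exists s => b; apply: eq_agree (y'E b).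
  by move=> i; rewrite env_extend.
by move=> i; rewrite env_extend.
Qed.

(** Each atomic formula is a condition symmetric in the two factors, so an exchange does not affect
    it. *)
Lemma holds_similar n (f : formula n) : exists L, forall x x' : 'I_n -> A,
  similar L x x' -> holds f x -> holds f x'.
Proof.
elim: f => {n} [n t u|n r t u|n f [L fP]|n f [L fP] g [M gP]|n f [L fP] g [M gP]|n f [L fP] g
  [M gP]|n f [L fP]|n f [L fP]].
- have [L LP] := leval_determined t u; exists L => x x' [s xx'] /= e.
  apply: comp_inj; apply/(forall_addb s) => b; rewrite !comp_eval.
  by have [h _ _ _] := LP _ _ _ _ (xx' b); apply/h; rewrite -!comp_eval e.
- have [L LP] := leval_determined t u; exists L => x x' [s xx'].
  have t0 b : comp b (eval x t) = 0 <-> comp (b (+) s) (eval x' t) = 0.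
    by rewrite !comp_eval; have [_ h _ _] := LP _ _ _ _ (xx' b).
  have u0 b : comp b (eval x u) = 0 <-> comp (b (+) s) (eval x' u) = 0.
    by rewrite !comp_eval; have [_ _ h _] := LP _ _ _ _ (xx' b).
  have dv b : vdiv (comp b (eval x t)) (comp b (eval x u)) <->
      vdiv (comp (b (+) s) (eval x' t)) (comp (b (+) s) (eval x' u)).
    by rewrite !comp_eval; have [_ _ _ h] := LP _ _ _ _ (xx' b).
  case: r => /=.
  + move=> /comp_divides tu; apply/comp_divides; apply/(forall_addb s) => b.
    by apply/dv.
  + move=> /comp_radical tu; apply/comp_radical; apply/(forall_addb s) => b.
    by move=> /u0 /tu /t0.
  + move=> /comp_loc_divides tu; apply/comp_loc_divides.
    case: tu => [/eq_comp0 ux|[b [ub tub]]]; [left|right].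
      by apply/eq_comp0; apply/(forall_addb s) => b; apply/u0.
    by exists (b (+) s); split; [move=> /u0|apply/dv].
- by exists L => x x' /similar_sym xx' /= nf /(fP _ _ xx').
- by exists (L ++ M) => x x' /similar_cat[/fP fx /gP gx] /= [/fx ? /gx ?].
- by exists (L ++ M) => x x' /similar_cat[/fP fx /gP gx] /= [/fx ?|/gx ?]; [left|right].
- exists (L ++ M) => x x' /similar_cat[/similar_sym/fP fx /gP gx] /= fg.
  by move=> /fx/fg/gx.
- have [L' LP] := similar_extend L; exists L' => x x' /similar_sym xx' /= fx y.
  have [y' yy'] := LP _ _ _ xx' y.
  exact: fP (similar_sym yy') (fx y').
- have [L' LP] := similar_extend L; exists L' => x x' xx' /= [y fy].
  have [y' yy'] := LP _ _ _ xx' y.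
  by exists y'; apply: fP yy' fy.
Qed.

(** * Quantifier-free formulas describing a tuple up to exchange of the factors *)

Fixpoint nat_term n (k : nat) : term n :=
  if k is k'.+1 then TAdd (TOne n) (nat_term n k') else TZero n.

Fixpoint to_term n (p : pterm) : term n :=
  match p with
  | PVar i => if insub i is Some j then TVar j else TZero n
  | PNat k => nat_term n k
  | PAdd u v => TAdd (to_term n u) (to_term n v)
  | POpp u => TOpp (to_term n u)
  | PMul u v => TMul (to_term n u) (to_term n v)
  end.

Lemma comp_to_term n (x : 'I_n -> A) b p : comp b (eval x (to_term n p)) = peval (env b x) p.
Proof.
elim: p => /= [i|k|u IHu v IHv|u IHu|u IHu v IHv].
- by rewrite /env; case: (insub i) => [j|] //=; exact: comp0.
- elim: k => [|k IHk] /=; first exact: comp0.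
  by rewrite mulrS -IHk -(comp1 b); apply: compD.
- by rewrite -IHu -IHv; apply: compD.
- by rewrite -IHu; apply: compN.
- by rewrite -IHu -IHv; apply: compM.
Qed.

(** Positive and negative parts turn signs into patterns of zeros, which annihilators can detect in
    a single factor. *)
Definition signed_part (K : realDomainType) (s : bool) (a : K) : K :=
  Num.max (if s then a else - a) 0.

Lemma signed_part_eq0 (K : realDomainType) s (a : K) :
  signed_part s a = 0 <-> (if s then a <= 0 else 0 <= a).
Proof.
rewrite /signed_part; case: s; last rewrite -oppr_le0.
  by split=> [<-|/max_r//]; rewrite le_max lexx.
by split=> [<-|/max_r//]; rewrite le_max lexx.
Qed.

Lemma sgz_signed_part (K K' : realDomainType) (a : K) (a' : K') :
  (forall s, signed_part s a = 0 <-> signed_part s a' = 0) -> sgz a = sgz a'.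
Proof.
move=> H; have := H true; have := H false; rewrite !signed_part_eq0 => ge le.
have {}ge : (0 <= a) = (0 <= a') by apply/idP/idP => /ge.
have {}le : (a <= 0) = (a' <= 0) by apply/idP/idP => /le.
case: (ltgtP a' 0) le ge => [a0'|a0'|->]; case: (ltgtP a 0) => [a0|a0|->] // _ _.
- by rewrite !ltr0_sgz.
- by rewrite !gtr0_sgz.
- by rewrite !sgz0.
Qed.

Lemma signed_part_sgz (K K' : realDomainType) s (a : K) (a' : K') :
  sgz a = sgz a' -> signed_part s a = 0 <-> signed_part s a' = 0.
Proof.
move=> aa'; rewrite !signed_part_eq0; case: s; first by rewrite -sgz_le0 aa' sgz_le0.
by rewrite -sgz_ge0 aa' sgz_ge0.
Qed.

Definition part n s p : term n :=
  TJoin (if s then to_term n p else TOpp (to_term n p)) (TZero n).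

Lemma comp_part n (x : 'I_n -> A) b s p :
  comp b (eval x (part n s p)) = signed_part s (peval (env b x) p).
Proof.
rewrite comp_eval /= /signed_part; case: s => /=; rewrite -comp_eval comp_to_term //.
Qed.

Lemma neq_negb (b i : bool) : b != i -> b = ~~ i.
Proof. by case: b i => [] []. Qed.

(** * Access to each factor through an element vanishing in exactly one *)

Section Separated.

Variables (c : V0 * V1) (i : bool).
Hypotheses (ci : comp i c <> 0) (cNi : comp (~~ i) c = 0).

Lemma forall_side (P : bool -> Prop) : (forall b, P b) <-> P i /\ P (~~ i).
Proof. by case: i; split=> [H|[? ?] []]. Qed.

Lemma separated_eq0 w : c * w = 0 <-> comp i w = 0.
Proof.
rewrite eq_comp0 forall_side !compM cNi mul0r; split=> [[/eqP + _]|->]; last by rewrite mulr0.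
by rewrite mulf_eq0 => /orP[/eqP|/eqP].
Qed.

Lemma separated_radical w : radical_rel w c <-> comp (~~ i) w = 0.
Proof. by rewrite comp_radical forall_side; split=> [[_ ->]|]. Qed.

Lemma separated_divides q r :
  divides (c * q) (c * r) <-> vdiv (comp i q) (comp i r).
Proof.
rewrite comp_divides forall_side !compM cNi !mul0r vdiv_mul2l; last exact/eqP.
by split=> [[]|] //; split=> //; apply: vdivx0.
Qed.

(** If [q] divides [r] in factor [i], full divisibility tests the other factor; if not, only the
    other factor can witness local divisibility. The first alternative treats an [r] vanishing
    there, where it cannot be a witness. *)
Lemma separated_vdiv q r : vdiv (comp (~~ i) q) (comp (~~ i) r) <->
  radical_rel r c \/ divides (c * q) (c * r) /\ divides q r \/
  ~ divides (c * q) (c * r) /\ loc_divides q r.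
Proof.
rewrite separated_radical separated_divides comp_divides forall_side comp_loc_divides.
split.
  move=> d; have [r0|r0] := classic (comp (~~ i) r = 0); first by left.
  right; have [di|di] := classic (vdiv (comp i q) (comp i r)); [left|right] => //.
  by split=> //; right; exists (~~ i).
case=> [->|[[_ []]|[ndi]]] //; first exact: vdivx0.
case=> [->|[b [rb d]]]; first by rewrite comp0; apply: vdivx0.
have [bi|bi] := eqVneq b i; first by case: ndi; rewrite -bi.
by rewrite -(neq_negb bi).
Qed.

End Separated.

(** The nonzero zero divisors: [radical_rel 1 c] says that [c] has trivial annihilator. *)
Definition separating (c : V0 * V1) : Prop := c <> 0 /\ ~ radical_rel 1 c.

Lemma separating_side c : separating c -> exists i, comp i c <> 0 /\ comp (~~ i) c = 0.
Proof.
move=> [c0 nc]; have [i ci] : exists i, comp i c <> 0.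
  by apply: NNPP => no; apply: c0; apply/eq_comp0 => b; apply: NNPP => cb; apply: no; exists b.
exists i; split=> //; apply: NNPP => cNi; apply: nc; apply/comp_radical.
by apply/(forall_side i); split.
Qed.

Lemma not_separating c : ~ separating c ->
  forall b b', comp b c = 0 -> comp b' c = 0.
Proof.
move=> nc b b' cb; apply: NNPP => cb'; apply: nc; split=> [c0|].
  by apply: cb'; rewrite c0 comp0.
by move=> /comp_radical/(_ b cb)/eqP; rewrite comp1 oner_eq0.
Qed.

(* The sign of [cross q r s t] compares |r / q| and |t / s|. *)
Definition cross (q r s t : pterm) : pterm :=
  PAdd (PMul (PMul r s) (PMul r s)) (POpp (PMul (PMul t q) (PMul t q))).

Lemma cross_le0 (K : rcfType) (e : nat -> K) q r s t :
  (peval e (cross q r s t) <= 0) = (`|peval e r * peval e s| <= `|peval e t * peval e q|).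
Proof.
by rewrite /= subr_le0 -!expr2 -[RHS]ler_sqr ?nnegrE // !real_normK ?num_real.
Qed.

Lemma vdiv_cross (S : vrcf) (q r s t : S) : s != 0 ->
  `|r * s| <= `|t * q| -> vdiv s t -> vdiv q r.
Proof.
move=> s0 le [z Oz e]; apply: (@vdiv_trans _ (q * z)); first by exists z.
apply: vdiv_norm; rewrite -(ler_pM2r (_ : 0 < `|s|)) ?normr_gt0 // -!normrM.
by rewrite [q * z * s](_ : _ = t * q) // e; ring.
Qed.

(** * Tuples whose terms have equal signs in both factors *)

Section Unseparated.

Variables (n : nat) (L : seq pterm) (x : 'I_n -> A).
Hypothesis sgn : forall b b', {in L ++ [seq cross qr.1 qr.2 st.1 st.2 |
    qr <- [seq (q, r) | q <- L, r <- L], st <- [seq (q, r) | q <- L, r <- L]],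
  forall p, sgz (peval (@env n b x) p) = sgz (peval (@env n b' x) p)}.

Let sgnL b b' p : p \in L -> sgz (peval (@env n b x) p) = sgz (peval (@env n b' x) p).
Proof. by move=> pL; apply: sgn; rewrite mem_cat pL. Qed.

Let eq0L b b' p : p \in L -> peval (@env n b x) p = 0 -> peval (@env n b' x) p = 0.
Proof. by move=> /(sgnL b b')/sgz_eq_eq0 h /eqP; rewrite h => /eqP. Qed.

Let crossL b b' q r s t : q \in L -> r \in L -> s \in L -> t \in L ->
  sgz (peval (@env n b x) (cross q r s t)) = sgz (peval (@env n b' x) (cross q r s t)).
Proof.
move=> qL rL sL tL; apply: sgn; rewrite mem_cat; apply/orP; right.
by apply/allpairsP; exists ((q, r), (s, t)); split=> //; apply/allpairsP;
  [exists (q, r)|exists (s, t)].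
Qed.

(* The factors induce the same order on the values, so that their
   divisibility relations come from comparable convex valuation rings. *)
Lemma unseparated_nested : exists i, {in L &, forall q r,
  vdiv (peval (@env n (~~ i) x) q) (peval (@env n (~~ i) x) r) ->
  vdiv (peval (@env n i x) q) (peval (@env n i x) r)}.
Proof.
have [H|H] := classic ({in L &, forall q r,
  vdiv (peval (@env n true x) q) (peval (@env n true x) r) ->
  vdiv (peval (@env n false x) q) (peval (@env n false x) r)}); first by exists false.
(* Failures of both inclusions exclude each other: the smaller of [|r / q|] and [|t / s|] is the
   same one in both factors, and in each it is integral if the larger is. *)
exists true => s t sL tL /= d0; apply: NNPP => nd1; apply: H => q r qL rL d1.
have s0 : peval (@env n false x) s != 0.
  apply/eqP => s0; move: d0; rewrite s0 => /vdiv0x t0; apply: nd1.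
  by rewrite (@eq0L false true t tL t0); apply: vdivx0.
have [q0|/eqP q0] := classic (peval (@env n true x) q = 0).
  move: d1; rewrite q0 => /vdiv0x r0.
  by rewrite (@eq0L true false r rL r0); apply: vdivx0.
have cr := crossL false true qL rL sL tL.
have [le|lt] := lerP (peval (@env n false x) (cross q r s t)) 0.
  by move: le; rewrite cross_le0 => le; apply: vdiv_cross le d0.
case: nd1; move: lt; rewrite (sgz_eq_gt0 cr) ltNge cross_le0 -ltNge => /ltW.
by move=> le; apply: vdiv_cross le d1.
Qed.

(** Divisibility in the factor [~~ i] implies that in [i], so the conjunction of the two is the
    former and their disjunction the latter. Equal zeros in both factors reconcile this with the
    nonvanishing required by [|_loc]. *)
Lemma unseparated_vdiv : exists i, {in L &, forall q r,
  (vdiv (peval (@env n i x) q) (peval (@env n i x) r) <->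
     loc_divides (eval x (to_term n q)) (eval x (to_term n r))) /\
  (vdiv (peval (@env n (~~ i) x) q) (peval (@env n (~~ i) x) r) <->
     divides (eval x (to_term n q)) (eval x (to_term n r)))}.
Proof.
have [i nested] := unseparated_nested; exists i => q r qL rL.
rewrite comp_loc_divides comp_divides (forall_side i) !comp_to_term.
split; last by split=> [d|[]] //; split=> //; apply: nested.
have [r0|r0] := classic (peval (@env n i x) r = 0).
  rewrite r0; split=> _; last exact: vdivx0.
  left; apply/eq_comp0 => b; rewrite comp_to_term.
  exact: (eq0L b rL r0).
split=> [d|[e|[b [_]]]]; first by right; exists i; rewrite !comp_to_term.
  by case: r0; have /eq_comp0/(_ i) := e; rewrite comp_to_term.
rewrite !comp_to_term; have [->//|bi] := eqVneq b i.
by rewrite (neq_negb bi); apply: nested.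
Qed.

End Unseparated.

Lemma refinable_similar n (L : seq pterm) : refinable (M := A) (@similar n L).
Proof.
pose tm := to_term n.
pose eqv (g : formula n) (x x' : 'I_n -> A) := holds g x <-> holds g x'.
pose P := L ++ [seq cross qr.1 qr.2 st.1 st.2 |
    qr <- [seq (q, r) | q <- L, r <- L], st <- [seq (q, r) | q <- L, r <- L]].
(* Which term yields a separating element depends on the tuple, so the formulas of every candidate
   [p] and [s] are included. *)
pose sep_formulas p s (x x' : 'I_n -> A) :=
  [/\ eqv (FEq (part n s p) (TZero n)) x x' /\ eqv (FRel RRad (TOne n) (part n s p)) x x',
    {in L, forall q, forall s', eqv (FEq (TMul (part n s p) (part n s' q)) (TZero n)) x x' /\
      eqv (FRel RRad (part n s' q) (part n s p)) x x'} &
    {in L, forall q, {in L, forall r,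
      eqv (FRel RDvd (TMul (part n s p) (tm q)) (TMul (part n s p) (tm r))) x x' /\
      eqv (FRel RRad (tm r) (part n s p)) x x'}}].
pose dvd_formulas (x x' : 'I_n -> A) := {in L, forall q, {in L, forall r,
  eqv (FRel RDvd (tm q) (tm r)) x x' /\ eqv (FRel RDvdLoc (tm q) (tm r)) x x'}}.
apply: (@refinable_sub A n (fun x x' =>
    {in P, forall p, forall s, sep_formulas p s x x'} /\ dvd_formulas x x')); last first.
  have eqvP g : quantifier_free g -> refinable (eqv g) := @refinable_qf A n g.
  apply: refinable_and.
    apply: refinable_in => p; apply: refinable_forall_bool => s.
    apply: (@refinable_sub A n (fun x x' =>
      (eqv (FEq (part n s p) (TZero n)) x x' /\ eqv (FRel RRad (TOne n) (part n s p)) x x') /\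
      {in L, forall q, forall s', eqv (FEq (TMul (part n s p) (part n s' q)) (TZero n)) x x' /\
        eqv (FRel RRad (part n s' q) (part n s p)) x x'} /\
      {in L, forall q, {in L, forall r,
        eqv (FRel RDvd (TMul (part n s p) (tm q)) (TMul (part n s p) (tm r))) x x' /\
        eqv (FRel RRad (tm r) (part n s p)) x x'}})); first by move=> x x' [? []].
    apply: refinable_and; first by apply: refinable_and; apply: eqvP.
    apply: refinable_and.
      apply: refinable_in => q; apply: refinable_forall_bool => s'.
      by apply: refinable_and; apply: eqvP.
    by do 2![apply: refinable_in => ?]; apply: refinable_and; apply: eqvP.
  by do 2![apply: refinable_in => ?]; apply: refinable_and; apply: eqvP.
move=> x x' [sepE dvdE].
have LP q : q \in L -> q \in P by rewrite mem_cat => ->.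
have signs b b' : {in L, forall q s, signed_part s (peval (env b x) q) = 0 <->
      signed_part s (peval (env b' x') q) = 0} ->
    {in L, forall q, sgz (peval (env b x) q) = sgz (peval (env b' x') q)}.
  by move=> H q qL; apply: sgz_signed_part => s; apply: H.
have similarI i i' : (forall b, b = i \/ b = ~~ i ->
  agree L (env b x) (env (b (+) (i (+) i')) x')) ->
    similar L x x'.
  by move=> H; exists (i (+) i') => b; apply: H; case: (b); case: (i); auto.
have agreeI b b' : {in L, forall q s, signed_part s (peval (env b x) q) = 0 <->
      signed_part s (peval (env b' x') q) = 0} ->
    {in L &, forall q r, vdiv (peval (env b x) q) (peval (env b x) r) <->
       vdiv (peval (env b' x') q) (peval (env b' x') r)} ->
    agree L (env b x) (env b' x').
  by move=> /signs.
have sepP p s : p \in P -> separating (eval x (part n s p)) <-> separating (eval x' (part n s p)).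
  move=> pP; have [[h1 h2] _ _] := sepE p pP s.
  by rewrite /separating; split=> -[a b]; split=> [/h1//|/h2//].
have [[p [s [pP sepx]]]|nosep] := classic (exists p s, p \in P /\ separating (eval x (part n s p))).
  have sepx' := (sepP p s pP).1 sepx.
  have [_ h1 h2] := sepE p pP s.
  have [i [ci cNi]] := separating_side sepx; have [i' [ci' cNi']] := separating_side sepx'.
  (* The same term separates in both tuples, perhaps on different sides [i] and [i']; their sum is
     the exchange. *)
  apply: (similarI i i') => b [->|->].
    rewrite addKb; apply: agreeI => [q qL s'|q r qL rL].
      rewrite -!comp_part -(separated_eq0 ci cNi) -(separated_eq0 ci' cNi').
      by have [+ _] := h1 q qL s'.
    rewrite -!comp_to_term -(separated_divides ci cNi) -(separated_divides ci' cNi').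
    by have [+ _] := h2 q qL r rL.
  rewrite addNb addKb; apply: agreeI => [q qL s'|q r qL rL].
    rewrite -!comp_part -(separated_radical ci cNi) -(separated_radical ci' cNi').
    by have [_ +] := h1 q qL s'.
  rewrite -!comp_to_term (separated_vdiv ci cNi) (separated_vdiv ci' cNi').
  have [e1 e2] := h2 q qL r rL; have [e3 e4] := dvdE q qL r rL.
  by rewrite /eqv /= /tm in e1 e2 e3 e4; rewrite e1 e2 e3 e4.
have nosep' p s : p \in P -> ~ separating (eval x' (part n s p)).
  by move=> pP /(sepP p s pP) sepx; apply: nosep; exists p, s.
(* A part that is not separating vanishes in both factors or in neither, so the sign of [p] is the
   same in both. *)
have const (y : 'I_n -> A) : (forall p s, p \in P -> ~ separating (eval y (part n s p))) ->
    forall b b', {in P, forall p, sgz (peval (env b y) p) = sgz (peval (env b' y) p)}.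
  move=> ns b b' p pP; apply: sgz_signed_part => s; rewrite -!comp_part.
  by split=> h; apply: (not_separating (ns p s pP) _ h).
have cx b b' := const x (fun p s pP sx => nosep (ex_intro _ p (ex_intro _ s (conj pP sx)))) b b'.
have cx' b b' := const x' nosep' b b'.
(* The factors are matched by their divisibility: [i] and [i'] carry [|_loc], the other two carry
   [|]. *)
have [i iP] := unseparated_vdiv cx; have [i' iP'] := unseparated_vdiv cx'.
have zero b b' : {in L, forall q s, signed_part s (peval (env b x) q) = 0 <->
      signed_part s (peval (env b' x') q) = 0}.
  move=> q qL s; have [[h _] _ _] := sepE q (LP q qL) s.
  have all0 (y : 'I_n -> A) c : (forall b b', {in P, forall p,
    sgz (peval (env b y) p) = sgz (peval (env b' y) p)}) ->
      signed_part s (peval (env c y) q) = 0 <-> eval y (part n s q) = 0 :> (V0 * V1).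
    move=> cy; rewrite eq_comp0; split=> [y0 d|/(_ c)]; rewrite comp_part //.
    by apply/(signed_part_sgz s (cy c d q (LP q qL))).
  by rewrite (all0 x) // (all0 x').
apply: (similarI i i') => b [->|->].
  rewrite addKb; apply: agreeI => [|q r qL rL]; first exact: zero.
  have [-> _] := iP q r qL rL; have [-> _] := iP' q r qL rL.
  by have [_] := dvdE q qL r rL.
rewrite addNb addKb; apply: agreeI => [|q r qL rL]; first exact: zero.
have [_ ->] := iP q r qL rL; have [_ ->] := iP' q r qL rL.
by have [] := dvdE q qL r rL.
Qed.

End Product.

Theorem theorem3p1 (V0 V1 : realDomainType)
    (hV0 : real_closed_valuation_ring V0)
    (hV1 : real_closed_valuation_ring V1) :
  quantifier_elimination (Th (prod_structure V0 V1)).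
Proof.
apply: quantifier_elimination_Th => n f.
have [L fL] := holds_similar hV0 hV1 f.
exact: refinable_equivalent (refinable_similar hV0 hV1 n L) fL.
Qed.
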